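(* Let $k\ge \ell\ge 1$ be integers with $k+\ell\ge 6$. If $k=\ell$, then $$i(S_{k,\ell})=\frac{(2k+1)!}{2^{2k}(k!)^2}\cdot \max_{\alpha\in[0,1]}\left\{\alpha(1-\alpha)^{2k}+(1-\alpha)\alpha^{2k}\right\}.$$ If $k\ge \ell+1$, then $$i(S_{k,\ell})=\frac{(k+\ell+1)!}{k!\,\ell!}\max_{(\alpha,d)\in[0,\frac12]\times[0,\frac{k}{k+\ell}]}\left\{\alpha(1-\alpha)^{k+\ell}d^k(1-d)^\ell+\frac{(k-1)^{k-1}\ell^\ell}{(k+\ell-1)^{k+\ell-1}}(1-\alpha)\alpha^{k+\ell}(1-d)\right\}.$$
   Context: Digraphs are finite and without loops; $xy$ denotes an arc from $x$ to $y$. For nonnegative integers $k,\ell$, the oriented star $S_{k,\ell}$ is the digraph with a center $c$, $k$ out-leaves $o$ (arcs $co$) and $\ell$ in-leaves $i$ (arcs $ic$), and no other arcs. For digraphs $H,G$, the induced density $i(H,G)$ is the number of induced copies of $H$ in $G$ (i.e. vertex subsets $W$ with $G[W]\cong H$) divided by $\binom{|V(G)|}{|V(H)|}$; $i(H,n)$ is the maximum of $i(H,G)$ over all $n$-vertex digraphs $G$; and the inducibility is $i(H)=\lim_{n\to\infty}i(H,n)$. *)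

(* Defs.v *)
From HB Require Import structures.
From mathcomp Require Import all_boot all_order all_algebra.
From mathcomp Require Import all_classical all_reals all_analysis.
Set Implicit Arguments. Unset Strict Implicit. Unset Printing Implicit Defensive.
Import Order.TTheory GRing.Theory Num.Theory.

(* A digraph on vertex set 'I_n is given by its arc set A : {set 'I_n * 'I_n};
   (x, y) \in A means the arc xy.  Digraphs are loopless. *)
Definition loopless (n : nat) (A : {set 'I_n * 'I_n}) : bool :=
  [forall x, (x, x) \notin A].

Definition induced_copy (m n : nat) (H : {set 'I_m * 'I_m})
    (G : {set 'I_n * 'I_n}) (W : {set 'I_n}) : bool :=
  [exists f : {ffun 'I_m -> 'I_n},
     [&& injectiveb f, f @: setT == W &
         [forall i, forall j, ((i, j) \in H) == ((f i, f j) \in G)]]].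

Definition ind_count (m n : nat) (H : {set 'I_m * 'I_m})
    (G : {set 'I_n * 'I_n}) : nat :=
  #|[set W : {set 'I_n} | induced_copy H G W]|.

Local Open Scope ring_scope.

Definition ind_density (R : realType) (m n : nat) (H : {set 'I_m * 'I_m})
    (G : {set 'I_n * 'I_n}) : R :=
  (ind_count H G)%:R / ('C(n, m))%:R.

(* i(H,n): maximum over all loopless digraphs on n vertices
   (densities are >= 0, so 0 is a harmless neutral element) *)
Definition ind_max (R : realType) (m : nat) (H : {set 'I_m * 'I_m}) (n : nat) : R :=
  \big[Num.max/0]_(G : {set 'I_n * 'I_n} | loopless G) ind_density R H G.

(* The oriented star S_{k,l} on 'I_(k+l+1): center 0, out-leaves 1..k,
   in-leaves k+1..k+l. *)
Definition ostar (k l : nat) : {set 'I_(k + l + 1) * 'I_(k + l + 1)} :=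
  [set p | ((val p.1 == 0%N) && (1 <= val p.2 <= k)%N)
        || ((val p.2 == 0%N) && (k + 1 <= val p.1)%N)].

(* Main.v *)
(* Upper bound. Put s = k + l. A copy of S_{k,l} centred at v is an independent
   k-set of pure out-neighbours of v together with an independent l-set of pure
   in-neighbours, so we bound the number T of such tuples with repetitions allowed.
   Deleting a vertex lying in few stars, we may assume by induction that every
   vertex lies in about the average number of stars. After normalization, a vertex
   of degree d is the centre of at most h d^s stars and a leaf of at most
   K d (1-d)^(s-1), so its degree cannot lie in a middle range: the vertices split
   into a set A of vertices adjacent to almost everything and a rest W of low
   degree, with |A| close to 1/(s+1) and both A and W almost independent. Nearly
   all stars then have their leaves on the side opposite to the centre. Writing
   alpha = |A|, and o, i for the weights of the out- and in-neighbours in W of a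
   vertex u of A, this gives at most the sum over u in A of
   o^k i^l + c alpha^(s-1) i, which is the maximized function of the theorem; the
   missing arcs between A and W and the superfluous edges inside W cost more stars
   centred in A than they create. When l = 1 an edge inside W between vertices that
   receive almost no arcs from A costs nothing; these vertices are treated apart.
   If they are few, then the stars between them are compensated by the slack of
   the bound on stars centred in W, and otherwise by comparing with the digraph in
   which alpha is replaced by the weight of the non-out-neighbours in W.

   Lower bound. Take a complete bipartite digraph on A and B1, B2 with all arcs from
   A to B1, and orient the arcs between A and B2 in a regular pattern modulo k+l-1
   such that the vertices of B2 have out- and in-degrees in the ratio k-1 : l. *)

Require Import Defs.
From HB Require Import structures.
From mathcomp Require Import all_boot all_order all_algebra.
From mathcomp Require classical_sets.
From mathcomp Require Import ring lra zify.
Set Implicit Arguments. Unset Strict Implicit. Unset Printing Implicit Defensive.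
Import Order.TTheory GRing.Theory Num.Theory.
Local Open Scope ring_scope.

(** * Real inequalities *)

(** The structural information is crude but the final count is exact: the threshold [999 / 1000] on
    the stars per vertex yields only constants such as [36 / 100], yet with these every deviation
    loses at least what it gains, so [tot <= M] has no error term. Estimates are made in units of
    [star_max k l] and must be uniform in [s = k + l]; since [s * x^(s-1)] does not increase for
    [s >= 6], [x <= 6 / 7], they reduce to numbers at [s = 6], with [11 / 4] in place of e.
    Repetitions make the count homogeneous in the vertex weight [w], so the total weight can be
    normalized to 1. The vertices of [A] need not resemble each other: each [u] is bounded with its
    own in-weight, and the bounds are summed (with one use of convexity when [l = 1]). The case
    [l = 1] differs because a star then has no pair of in-leaf positions that an edge could spoil.
    For [k > l] the maximand appears as [x * (y^k * z^l + c * x^(s-1) * z)] with [x + y + z = 1],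
    that is, [x = alpha], [y = (1 - alpha) d], [z = (1 - alpha) (1 - d)]. *)

Section Real.
Variable R : realFieldType.

(** The arithmetic-geometric inequality for [p] copies of [x / p] and [q] copies of [y / q]; zero
    exponents are separate because of the divisions. *)
Lemma amgm (p q : nat) (x y : R) : 0 <= x -> 0 <= y ->
  x ^+ p * y ^+ q <=
  (p%:R ^+ p * q%:R ^+ q) / (p + q)%:R ^+ (p + q) * (x + y) ^+ (p + q).
Proof.
move=> x0 y0.
case: p => [|p].
  rewrite !expr0 !mul1r add0n; case: q => [|q]; first by rewrite !expr0 invr1 !mulr1.
  rewrite divff ?mul1r ?expf_neq0 ?pnatr_eq0 //.
  by apply: lerXn2r; rewrite ?nnegrE ?addr_ge0 // lerDr.
case: q => [|q].
  rewrite !expr0 !mulr1 addn0 divff ?mul1r ?expf_neq0 ?pnatr_eq0 //.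
  by apply: lerXn2r; rewrite ?nnegrE ?addr_ge0 // lerDl.
set P := p.+1; set Q := q.+1.
have P0 : 0 < P%:R :> R by rewrite ltr0n.
have Q0 : 0 < Q%:R :> R by rewrite ltr0n.
pose E (i : 'I_(P + Q)) : R := if (i < P)%N then x / P%:R else y / Q%:R.
have E0 : {in predT, forall i, 0 <= E i}.
  by move=> i _; rewrite /E; case: ifP => _; rewrite divr_ge0 // ltW.
have EL i : E (lshift Q i) = x / P%:R by rewrite /E /= (ltn_ord i).
have ER i : E (rshift P i) = y / Q%:R by rewrite /E /= ltnNge leq_addr.
have := (leif_AGM E0).1; rewrite !big_split_ord /= card_ord.
rewrite (eq_bigr _ (fun i _ => EL i)) (eq_bigr _ (fun i _ => ER i)).
rewrite [X in _ <= ((X + _) / _) ^+ _](eq_bigr _ (fun i _ => EL i)).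
rewrite [X in _ <= ((_ + X) / _) ^+ _](eq_bigr _ (fun i _ => ER i)).
rewrite !prodr_const !sumr_const !card_ord.
rewrite -(mulr_natr (x / _) P) -(mulr_natr (y / _) Q) !divfK ?lt0r_neq0 //.
rewrite !expr_div_n => H.
have H1 : 0 < P%:R ^+ P * Q%:R ^+ Q :> R by rewrite mulr_gt0 ?exprn_gt0.
rewrite mulf_div ler_pdivrMr // in H.
apply: (le_trans H); rewrite le_eqVlt; apply/orP; left; apply/eqP.
rewrite mulrC mulrA; field.
by rewrite expf_neq0 // pnatr_eq0.
Qed.

Lemma bernoulli (x : R) n : -1 <= x -> 1 + n%:R * x <= (1 + x) ^+ n.
Proof.
move=> x1; elim: n => [|n IH]; first by rewrite expr0 mul0r addr0.
rewrite exprS; have h : 0 <= 1 + x by lra.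
apply: (le_trans _ (ler_wpM2l h IH)).
rewrite -natr1; have : 0 <= n%:R * x ^+ 2 by rewrite mulr_ge0 ?sqr_ge0.
rewrite -subr_ge0 => H; rewrite -subr_ge0; move: H; rewrite !subr0 => H.
by have -> : (1 + x) * (1 + n%:R * x) - (1 + (n%:R + 1) * x) = n%:R * x ^+ 2 by ring.
Qed.

End Real.

(** * Numerical constants uniform in k + l *)

Section Num.
Variable R : realFieldType.

Lemma pow64 (x : R) : 0 <= x -> x <= 64 / 63 -> x ^+ 64 <= 11 / 4.
Proof.
move=> x0 x1.
have sq (y c d : R) : 0 <= y -> y <= c -> c ^+ 2 <= d -> y ^+ 2 <= d.
  by move=> y0 yc; apply: le_trans; apply: lerXn2r; rewrite ?nnegrE // (le_trans y0).
have H2 : x ^+ 2 <= 1032 / 1000 by apply: sq x1 _ => //; lra.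
have H4 := sq _ _ (1 + 65 / 1000 + 3 / (100 * 1000)) (sqr_ge0 _) H2 ltac:(lra).
have H8 := sq _ _ (1 + 134 / 1000 + 3 / (10 * 1000)) (sqr_ge0 _) H4 ltac:(lra).
have H16 := sq _ _ (1 + 286 / 1000 + 7 / (10 * 1000)) (sqr_ge0 _) H8 ltac:(lra).
have H32 := sq _ _ (1 + 655 / 1000 + 7 / (10 * 1000)) (sqr_ge0 _) H16 ltac:(lra).
have := sq _ _ (11 / 4) (sqr_ge0 _) H32 ltac:(lra).
by rewrite -!exprM.
Qed.

Lemma inv_bern (x : R) n : 0 <= x -> n%:R * x < 1 ->
  (1 + x) ^+ n <= (1 - n%:R * x)^-1.
Proof.
move=> x0 nx; have h : 0 < 1 - n%:R * x by lra.
case: n nx h => [|n] nx h; first by rewrite expr0 mul0r subr0 invr1.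
have x1 : x <= 1.
  apply: le_trans (ltW nx); rewrite -[leLHS]mul1r ler_wpM2r // ler1n //.
rewrite -[leRHS]mul1r ler_pdivlMr //.
have := @bernoulli R (- x) n.+1 ltac:(lra); rewrite mulrN => /(ler_wpM2l _) H.
apply: (le_trans (H _ _)); first by rewrite exprn_ge0 //; lra.
rewrite -exprMn; apply: exprn_ile1; nra.
Qed.

(** [1 + 1 / n] is replaced by [(1 + 1 / (64 n))^64]; for this small increment [inv_bern] is
    accurate enough and gives the base [64 / 63] of [pow64]. *)
Lemma euler_le n : (1 + n%:R^-1) ^+ n <= 11 / 4 :> R.
Proof.
case: n => [|n]; first by rewrite expr0; lra.
set m := n.+1; have m0 : 0 < m%:R :> R by rewrite ltr0n.
pose x : R := (m%:R * 64)^-1.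
have x0 : 0 <= x by rewrite invr_ge0 mulr_ge0 // ltW.
have mx : m%:R * x = 64^-1 by rewrite /x invfM mulrA divff ?mul1r // lt0r_neq0.
have H1 : 1 + m%:R^-1 <= (1 + x) ^+ 64.
  have x1 : -1 <= x by apply: le_trans x0; rewrite lerN10.
  apply: le_trans (@bernoulli R x 64 x1).
  by rewrite lerD2l /x invfM mulrCA divff ?mulr1 // pnatr_eq0.
apply: (@le_trans _ _ (((1 + x) ^+ m) ^+ 64)).
  rewrite -exprM mulnC exprM; apply: lerXn2r H1; rewrite nnegrE.
    by rewrite addr_ge0 // invr_ge0 ltW.
  by rewrite exprn_ge0 // addr_ge0.
apply: pow64; first by rewrite exprn_ge0 // addr_ge0.
apply: (le_trans (inv_bern x0 _)); rewrite mx; first by lra.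
by rewrite -[leRHS]invf_div lef_pV2 ?posrE; lra.
Qed.

(** Passing from [s] to [s + 1] multiplies the left side by [x * (s + 1) / s], at most
    [6 / 7 * 7 / 6]. *)
Lemma npow_le (x : R) s : (6 <= s)%N -> 0 <= x -> x <= 6 / 7 ->
  s%:R * x ^+ s.-1 <= 6 * x ^+ 5.
Proof.
move=> s6 x0 x1; rewrite -(subnK s6) addnS /=.
elim: (s - 6)%N => [|j IH]; first by rewrite add0n.
apply: le_trans IH; rewrite addSn exprS mulrA ler_wpM2r ?exprn_ge0 //.
have : 6 <= (j + 6)%:R :> R by rewrite ler_nat leq_addl.
by rewrite -[(j + 5).+2]addn1 -[(j+5).+1]addnS natrD; nra.
Qed.

Lemma pow_le6 (x : R) s : (6 <= s)%N -> 0 <= x -> x <= 1 -> x ^+ s <= x ^+ 6.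
Proof. by move=> s6 x0 x1; apply: ler_wiXn2l. Qed.

Lemma pow_le5 (x : R) s : (6 <= s)%N -> 0 <= x -> x <= 1 -> x ^+ s.-1 <= x ^+ 5.
Proof. by case: s => // s s6 x0 x1; apply: ler_wiXn2l. Qed.

(* [(s + 1) x (1 - x)^s] is maximal at [x = 1 / (s + 1)], with value [mean_max s]. *)
Definition mean_max s : R := (s%:R / s.+1%:R) ^+ s.

Lemma mean_max_ge s : (0 < s)%N -> 4 / 11 <= mean_max s.
Proof.
move=> s0; have s0' : 0 < s%:R :> R by rewrite ltr0n.
have e : (1 + s%:R^-1) * (s%:R / s.+1%:R) = 1 :> R.
  rewrite -natr1; field; lra.
have := euler_le s => H.
have H1 : (1 + s%:R^-1) ^+ s * mean_max s = 1 by rewrite -exprMn e expr1n.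
have b0 : 0 <= mean_max s by rewrite exprn_ge0 // divr_ge0.
nra.
Qed.

(* Slightly larger than [1 / (s + 1)], so that [(1 - cutoff s)^s] is smaller than
   [mean_max s] by a constant factor; see [cutoff_bb]. *)
Definition cutoff s : R := 11 / (10 * s.+1%:R).

Lemma cutoff_ge0 s : 0 <= cutoff s. Proof. by rewrite divr_ge0 // mulr_ge0. Qed.

Lemma cutoffE s : s.+1%:R * cutoff s = 11 / 10.
Proof.
rewrite /cutoff; have : 0 < s.+1%:R :> R by rewrite ltr0n.
by move: (s.+1%:R) => x x0; field; apply: lt0r_neq0.
Qed.

Lemma cutoff_le s : (6 <= s)%N -> cutoff s <= 11 / 70.
Proof.
move=> s6; rewrite /cutoff ler_pdivrMr; last by rewrite mulr_gt0 // ltr0n.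
have : 7 <= s.+1%:R :> R by rewrite ler_nat.
by move=> H; lra.
Qed.

(** [1 - cutoff s] is [s / (s + 1)] times [1 - 1 / (10 s)], and Bernoulli bounds the power of the
    second factor by [1 / (1 + 1 / 10)]. *)
Lemma cutoff_bb s : (6 <= s)%N -> (1 - cutoff s) ^+ s <= 10 / 11 * mean_max s.
Proof.
move=> s6; have s0 : 6 <= s%:R :> R by rewrite ler_nat.
have -> : 1 - cutoff s = (s%:R / s.+1%:R) * (1 - (10 * s%:R)^-1).
  by rewrite /cutoff -natr1; field; lra.
rewrite exprMn mulrC ler_wpM2r ?exprn_ge0 ?divr_ge0 //.
set x : R := (10 * s%:R)^-1.
have x0 : 0 <= x by rewrite invr_ge0; lra.
have sx : s%:R * x = 1 / 10 by rewrite /x; field; lra.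
have H := @bernoulli R x s ltac:(lra); rewrite sx in H.
have H2 : (1 + x) ^+ s * (1 - x) ^+ s <= 1.
  rewrite -exprMn; apply: exprn_ile1; nra.
have : 0 <= (1 - x) ^+ s by rewrite exprn_ge0 //; nra.
nra.
Qed.

(* [star_max k l] is the maximum of [x^k (1 - x)^l] on [0, 1]; [leaf_bound k l] bounds both
   [k x^(k-1) (1 - x)^l] and [l x^k (1 - x)^(l-1)]. *)
Definition star_max k l : R := (k%:R ^+ k * l%:R ^+ l) / (k + l)%:R ^+ (k + l).
Definition leaf_bound k l : R := (k%:R ^+ k * l%:R ^+ l) / (k + l).-1%:R ^+ (k + l).-1.

Lemma star_max_gt0 k l : (0 < k)%N -> (0 < l)%N -> 0 < star_max k l.
Proof.
move=> k0 l0; rewrite divr_gt0 ?mulr_gt0 ?exprn_gt0 ?ltr0n //.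
by rewrite addn_gt0 k0.
Qed.

Lemma leaf_bound_ge0 k l : 0 <= leaf_bound k l.
Proof. by rewrite divr_ge0 ?mulr_ge0 ?exprn_ge0. Qed.

Lemma star_max_le k l (x y : R) : 0 <= x -> 0 <= y ->
  x ^+ k * y ^+ l <= star_max k l * (x + y) ^+ (k + l).
Proof. exact: amgm. Qed.

Lemma predn_exp_le n : n%:R * n.-1%:R ^+ n.-1 <= n%:R ^+ n :> R.
Proof.
case: n => [|n]; first by rewrite mul0r expr0 ler01.
by rewrite exprS ler_wpM2l //; apply: lerXn2r; rewrite ?nnegrE // ler_nat.
Qed.

Lemma leaf_bound_out k l (x y : R) : (0 < k)%N -> 0 <= x -> 0 <= y ->
  k%:R * (x ^+ k.-1 * y ^+ l) <= leaf_bound k l * (x + y) ^+ (k + l).-1.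
Proof.
move=> k0 x0 y0; have e : (k.-1 + l = (k + l).-1)%N by case: k k0.
have := amgm k.-1 l x0 y0; rewrite e => /(ler_wpM2l (ler0n _ k)) H.
apply: (le_trans H); rewrite mulrA ler_wpM2r ?exprn_ge0 ?addr_ge0 //.
rewrite !mulrA ler_wpM2r ?invr_ge0 ?exprn_ge0 // ler_wpM2r ?exprn_ge0 //.
exact: predn_exp_le.
Qed.

Lemma leaf_bound_in k l (x y : R) : (0 < l)%N -> 0 <= x -> 0 <= y ->
  l%:R * (x ^+ k * y ^+ l.-1) <= leaf_bound k l * (x + y) ^+ (k + l).-1.
Proof.
move=> l0 x0 y0; have := leaf_bound_out k l0 y0 x0.
by rewrite /leaf_bound [(l + k)%N]addnC [y + x]addrC [x ^+ _ * _]mulrC [l%:R ^+ l * _]mulrC.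
Qed.

(** With [s = k + l], the ratio of the two constants is [s * (1 + 1 / (s - 1))^(s - 1)]. *)
Lemma leaf_bound_hh k l : (1 < k + l)%N -> leaf_bound k l <= 11 / 4 * (k + l)%:R * star_max k l.
Proof.
rewrite /leaf_bound /star_max; case: (k + l)%N => [//|[//|n]] _ /=; rewrite -/(n.+1).
set D : R := k%:R ^+ k * _; have D0 : 0 <= D by rewrite mulr_ge0 ?exprn_ge0.
have n0 : 0 < n.+1%:R :> R by rewrite ltr0n.
have n1 : 0 < n.+2%:R :> R by rewrite ltr0n.
have E := euler_le n.+1.
have -> : D / n.+1%:R ^+ n.+1 = (1 + n.+1%:R^-1) ^+ n.+1 * (n.+2%:R * (D / n.+2%:R ^+ n.+2)).
  have -> : 1 + n.+1%:R^-1 = n.+2%:R / n.+1%:R :> R.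
    by rewrite -[n.+2%:R]natr1 mulrDl divff ?lt0r_neq0 // mul1r.
  rewrite expr_div_n [n.+2%:R ^+ n.+2]exprS.
  move: n1 (exprn_gt0 n.+1 n1) (exprn_gt0 n.+1 n0).
  move: (n.+2%:R) (_ ^+ _) (_ ^+ _) => p q r p0 q0 r0; field.
  by rewrite !lt0r_neq0.
by rewrite -[leRHS]mulrA ler_wpM2r // !mulr_ge0 ?invr_ge0 ?exprn_ge0.
Qed.

(** The maximum of [x * y^(s-1)] on [x + y = 1] is exactly the ratio of [star_max] to
    [leaf_bound]. *)
Lemma leaf_bound_one k l (x y : R) : (0 < k + l)%N -> 0 <= x -> 0 <= y ->
  leaf_bound k l * (x * y ^+ (k + l).-1) <= star_max k l * (x + y) ^+ (k + l).
Proof.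
move=> kl x0 y0; have := amgm 1 (k + l).-1 x0 y0; rewrite expr1 add1n prednK //.
rewrite expr1n mul1r; set p := _.-1%:R ^+ _; set q := _%:R ^+ (k + l) => H.
have q0 : 0 < q by rewrite exprn_gt0 // ltr0n.
have p0 : 0 < p.
  rewrite /p; case: (k + l)%N kl => [//|[|n]] _; first by rewrite expr0 ltr01.
  by rewrite exprn_gt0 // ltr0n.
rewrite /leaf_bound /star_max -/p -/q; set D := _ * l%:R ^+ l.
apply: (@le_trans _ _ (D / p * (p / q * (x + y) ^+ (k + l)))).
  by rewrite ler_wpM2l // divr_ge0 ?mulr_ge0 ?exprn_ge0 // ltW.
have -> : D / p * (p / q * (x + y) ^+ (k + l)) = D / q * (x + y) ^+ (k + l).
  by field; rewrite !lt0r_neq0.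
exact: lexx.
Qed.

(* With [x = alpha (s + 1)], the ratio of [alpha (1 - alpha)^s] to its maximum. *)
Lemma mean_max_ratio s (x : R) : (0 < s)%N -> 0 <= x -> x <= 1 ->
  x * (1 - x / s.+1%:R) ^+ s <= mean_max s * (4 * x / (1 + x) ^+ 2).
Proof.
move=> s0 x0 x1; have s0' : 0 < s%:R :> R by rewrite ltr0n.
have -> : 1 - x / s.+1%:R = (s%:R / s.+1%:R) * (1 + (1 - x) / s%:R).
  by rewrite -natr1; field; lra.
rewrite exprMn -/(mean_max s) mulrCA ler_wpM2l //.
  by rewrite exprn_ge0 // divr_ge0.
(* Half of the increment: [inv_bern] for [(1 - x) / s] itself would give [1 / x] and lose the whole
   gain, whereas the square of [2 / (1 + x)] keeps it. *)
pose t : R := (1 - x) / (2 * s%:R).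
have t0 : 0 <= t by rewrite divr_ge0 // ?mulr_ge0 //; lra.
have st : s%:R * t = (1 - x) / 2 by rewrite /t; field; lra.
have H : (1 + t) ^+ s <= 2 / (1 + x).
  apply: (le_trans (inv_bern t0 _)); rewrite st; first by lra.
  have -> : 1 - (1 - x) / 2 = (1 + x) / 2 by field.
  by rewrite invf_div.
have H1 : (1 + (1 - x) / s%:R) ^+ s <= ((1 + t) ^+ s) ^+ 2.
  rewrite -exprM mulnC exprM; apply: lerXn2r; rewrite ?nnegrE ?sqr_ge0 //.
    by rewrite addr_ge0 // divr_ge0 //; lra.
  have -> : (1 - x) / s%:R = 2 * t by rewrite /t; field; lra.
  rewrite -subr_ge0; have -> : (1 + t) ^+ 2 - (1 + 2 * t) = t ^+ 2 by ring.
  exact: sqr_ge0.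
have H2 : ((1 + t) ^+ s) ^+ 2 <= (2 / (1 + x)) ^+ 2.
  by apply: lerXn2r; rewrite ?nnegrE ?exprn_ge0 ?divr_ge0 ?addr_ge0.
have -> : 4 * x / (1 + x) ^+ 2 = x * (2 / (1 + x)) ^+ 2 by field; lra.
by rewrite ler_wpM2l // (le_trans H1).
Qed.

(** [33 / 2] is [11 / 4 * 6], from [leaf_bound_hh] and [npow_le]. Stars through a leaf are thus
    measured in units of [star_max], with an exponent independent of [k + l]. *)
Lemma leaf_bound_pow k l (c x y : R) : (6 <= k + l)%N -> 0 <= c -> 0 <= x -> x <= y ->
  y <= 6 / 7 -> leaf_bound k l * (c * x ^+ (k + l).-1) <= star_max k l * (33 / 2 * c * y ^+ 5).
Proof.
move=> s6 c0 x0 xy y1; have y0 := le_trans x0 xy.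
have H1 : x ^+ (k + l).-1 <= y ^+ (k + l).-1 by apply: lerXn2r; rewrite ?nnegrE.
have H3 : (k + l)%:R * x ^+ (k + l).-1 <= 6 * y ^+ 5.
  by apply: le_trans (npow_le s6 y0 y1); rewrite ler_wpM2l.
have h0 : 0 <= star_max k l by rewrite divr_ge0 ?mulr_ge0 ?exprn_ge0.
have Kh := leaf_bound_hh (leq_trans (isT : 1 < 6)%N s6).
apply: (le_trans (ler_wpM2r _ Kh)); first by rewrite mulr_ge0 ?exprn_ge0.
have -> : 11 / 4 * (k + l)%:R * star_max k l * (c * x ^+ (k + l).-1) =
  star_max k l * (11 / 4 * c * ((k + l)%:R * x ^+ (k + l).-1)) by ring.
rewrite ler_wpM2l //.
have -> : 33 / 2 * c * y ^+ 5 = 11 / 4 * c * (6 * y ^+ 5) by field.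
by rewrite ler_wpM2l // mulr_ge0 //; lra.
Qed.

Lemma star_max_pow k l (x y : R) : (6 <= k + l)%N -> 0 <= x -> x <= y -> y <= 1 ->
  star_max k l * x ^+ (k + l) <= star_max k l * y ^+ 6.
Proof.
move=> s6 x0 xy y1; have y0 := le_trans x0 xy.
have h0 : 0 <= star_max k l by rewrite divr_ge0 ?mulr_ge0 ?exprn_ge0.
rewrite ler_wpM2l //; apply: le_trans (pow_le6 s6 y0 y1).
by apply: lerXn2r; rewrite ?nnegrE.
Qed.

(* The maximum of [x^(k-1) (1 - x)^l], which is the constant of the theorem. *)
Definition inner_max k l : R := (k.-1%:R ^+ k.-1 * l%:R ^+ l) / (k + l).-1%:R ^+ (k + l).-1.

Lemma inner_max_ge0 k l : 0 <= inner_max k l.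
Proof. by rewrite divr_ge0 ?mulr_ge0 ?exprn_ge0. Qed.

Lemma inner_max_le k l (x y : R) : (0 < k)%N -> 0 <= x -> 0 <= y ->
  x ^+ k.-1 * y ^+ l <= inner_max k l * (x + y) ^+ (k + l).-1.
Proof.
by case: k => // k _ x0 y0; have := amgm k l x0 y0; rewrite /inner_max addSn.
Qed.

(** [amgm] twice, for [x] and [y] and then for [z] and [x + y]; the powers of [k + l - 1] cancel. It
    yields the lower bound [i_ge] on in-weights. *)
Lemma star_max_le3 k l (z x y : R) : (0 < k)%N -> (0 < l)%N ->
  0 <= x -> 0 <= y -> 0 <= z -> z + x + y <= 1 ->
  z * (x ^+ k * y ^+ l.-1) <= star_max k l.
Proof.
move=> k0 l0 x0 y0 z0 xyz.
have e : (k + l.-1 = (k + l).-1)%N by case: l l0 => // l _; rewrite addnS.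
have e1 : (1 + (k + l).-1 = k + l)%N by rewrite add1n prednK // addn_gt0 k0.
have H1 := amgm k l.-1 x0 y0; rewrite e in H1.
have H2 := amgm 1 (k + l).-1 z0 (addr_ge0 x0 y0).
rewrite expr1 expr1n mul1r e1 in H2.
set n := (k + l)%N in e e1 H1 H2 *; set p := n.-1%:R ^+ n.-1 in H1 H2.
have p0 : 0 < p.
  rewrite /p; case: (n.-1) => [|m]; first by rewrite expr0 ltr01.
  by rewrite exprn_gt0 // ltr0n.
set D := _ * l.-1%:R ^+ _ in H1.
have D0 : 0 <= D by rewrite mulr_ge0 ?exprn_ge0.
have H3 : (z + (x + y)) ^+ n <= 1 by apply: exprn_ile1; rewrite ?addr_ge0 //; lra.
have q0 : 0 < n%:R ^+ n :> R by rewrite exprn_gt0 // ltr0n -e1.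
have {}H2 : z * (x + y) ^+ n.-1 <= p / n%:R ^+ n.
  by apply: (le_trans H2); rewrite -[leRHS]mulr1 ler_wpM2l // divr_ge0 // ltW.
apply: (@le_trans _ _ (z * (D / p * (x + y) ^+ n.-1))); first by rewrite ler_wpM2l.
rewrite mulrCA; apply: (@le_trans _ _ (D / p * (p / n%:R ^+ n))).
  by rewrite ler_wpM2l // divr_ge0 // ltW.
have -> : D / p * (p / n%:R ^+ n) = D / n%:R ^+ n by field; rewrite !lt0r_neq0.
rewrite /star_max -/n ler_wpM2r ?invr_ge0 ?(ltW q0) // ler_wpM2l ?exprn_ge0 //.
apply: (@le_trans _ _ (l%:R ^+ l.-1)).
  by apply: lerXn2r; rewrite ?nnegrE // ler_nat leq_pred.
case: l l0 {e e1 n H1 H2 p p0 D D0 H3 q0} => // l _ /=.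
by rewrite exprSr ler_peMr ?exprn_ge0 // ler1n.
Qed.

Lemma bern_hom (t e : R) n : 0 <= e -> e <= t ->
  (t - e) ^+ n * (t + n%:R * e) <= t ^+ n.+1.
Proof.
move=> e0 et; have t0 := le_trans e0 et; elim: n => [|n IH].
  by rewrite expr0 mul1r mul0r addr0 expr1.
rewrite [leRHS]exprS; apply: le_trans (ler_wpM2l t0 IH).
rewrite exprSr -mulrA [leRHS]mulrCA ler_wpM2l ?exprn_ge0 ?subr_ge0 //.
rewrite -subr_ge0 -natr1.
have -> : t * (t + n%:R * e) - (t - e) * (t + (n%:R + 1) * e) = (n%:R + 1) * e ^+ 2 by ring.
by rewrite mulr_ge0 ?sqr_ge0 // addr_ge0.
Qed.

(** The hypothesis [t <= n * j] says that the left side does not grow at [e = 0]. In the application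
    [e] is the weight of the neighbours of [u] inside [A]: the in-neighbours they may add are
    outweighed by the shrinking of [A :\: nb u]. *)
Lemma shift_pow (t e j : R) n : 0 < t -> 0 <= e -> e <= t -> 0 <= j -> t <= n%:R * j ->
  (j + e) * (t - e) ^+ n <= j * t ^+ n.
Proof.
move=> t0 e0 et j0 tj; rewrite -(ler_pM2l t0).
apply: (@le_trans _ _ (j * ((t - e) ^+ n * (t + n%:R * e)))).
  rewrite [leLHS]mulrA [leLHS]mulrC [leRHS]mulrCA ler_wpM2l ?exprn_ge0 ?subr_ge0 //.
  have : t * e <= n%:R * j * e by rewrite ler_wpM2r.
  by lra.
by rewrite [leRHS]mulrCA -exprS ler_wpM2l // bern_hom.
Qed.

Lemma exprD_ge (x y : R) n : 0 <= x -> 0 <= y ->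
  x ^+ n + n%:R * y * x ^+ n.-1 <= (x + y) ^+ n.
Proof.
move=> x0 y0; elim: n => [|n IH]; first by rewrite !mul0r addr0.
have xy0 := addr_ge0 x0 y0.
rewrite [leRHS]exprS; apply: le_trans (ler_wpM2l xy0 IH) => /=.
rewrite -natr1; case: n {IH} => [|n] /=; first by rewrite !expr0 expr1; lra.
rewrite -subr_ge0 -natr1.
have p0 : 0 <= x ^+ n by rewrite exprn_ge0.
have -> : (x + y) * (x ^+ n.+1 + (n%:R + 1) * y * x ^+ n) -
  (x ^+ n.+2 + (n%:R + 1 + 1) * y * x ^+ n.+1) = (n%:R + 1) * y ^+ 2 * x ^+ n.
  by rewrite !exprS; ring.
by rewrite mulr_ge0 // mulr_ge0 ?sqr_ge0 // addr_ge0.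
Qed.

Lemma star_max_ge_pow2 k l : 2^-1 ^+ (k + l) <= star_max k l.
Proof.
have := @star_max_le k l 2^-1 2^-1; rewrite -exprD.
have -> : 2^-1 + 2^-1 = 1 :> R by field.
by rewrite expr1n mulr1; apply; rewrite invr_ge0.
Qed.

(** The left side is the price of missing arcs in [tot_mix]. As [star_max] is at least [2^-s], only
    [s * (2 * cutoff s)^(s-1)] matters, and [npow_le] applies. *)
Lemma small_hh k l : (6 <= k + l)%N ->
  4 * (k + l).-1%:R * cutoff (k + l) ^+ (k + l).-1 <= 15 / 100 * star_max k l.
Proof.
move=> s6; apply: le_trans (_ : 15 / 100 * 2^-1 ^+ (k + l) <= _); last first.
  by rewrite ler_wpM2l ?star_max_ge_pow2 //; lra.
have a0 := cutoff_ge0 (k + l); have a1 := cutoff_le s6.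
have := @npow_le (2 * cutoff (k + l)) _ s6 ltac:(lra) ltac:(lra).
have : (2 * cutoff (k + l)) ^+ 5 <= (22 / 70) ^+ 5 by apply: lerXn2r; rewrite ?nnegrE; lra.
move=> H1; rewrite [_ ^+ _.-1]exprMn => H2.
set n := (k + l)%N in s6 H2 *; set p := 2 ^+ n.-1 in H2; set q := cutoff n ^+ n.-1 in H2 *.
have q0 : 0 <= q by rewrite exprn_ge0.
have p0 : 0 < p by rewrite exprn_gt0.
have -> : 2^-1 ^+ n = (2 * p)^-1 :> R.
  by rewrite exprVn /p -exprS prednK // (leq_trans _ s6).
rewrite ler_pdivlMr; last by rewrite mulr_gt0.
have nn : n.-1%:R * (p * q) <= n%:R * (p * q).
  by rewrite ler_wpM2r ?mulr_ge0 ?(ltW p0) // ler_nat leq_pred.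
have -> : 4 * n.-1%:R * q * (2 * p) = 8 * (n.-1%:R * (p * q)) by ring.
by lra.
Qed.

End Num.

(** * Estimates for stars with a single in-leaf *)

Section Num1.
Variable R : realFieldType.

Lemma binom2_ge (x : R) n : 0 <= x ->
  1 + n%:R * x + n%:R * (n%:R - 1) / 2 * x ^+ 2 <= (1 + x) ^+ n.
Proof.
move=> x0; elim: n => [|n IH]; first by rewrite expr0; lra.
rewrite [leRHS]exprS; have h : 0 <= 1 + x by lra.
apply: le_trans (ler_wpM2l h IH); rewrite -natr1 -subr_ge0.
have -> : (1 + x) * (1 + n%:R * x + n%:R * (n%:R - 1) / 2 * x ^+ 2) -
  (1 + (n%:R + 1) * x + (n%:R + 1) * (n%:R + 1 - 1) / 2 * x ^+ 2) =
  n%:R * (n%:R - 1) * x ^+ 3 / 2 by field.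
case: n {IH} => [|n]; first by rewrite !mul0r.
by rewrite divr_ge0 // !mulr_ge0 ?exprn_ge0 // subr_ge0 ler1n.
Qed.

Lemma pow_sub_le (x y : R) n : 0 <= y -> y <= x ->
  x ^+ n <= y ^+ n + n%:R * (x - y) * x ^+ n.-1.
Proof.
move=> y0 yx; have x0 := le_trans y0 yx.
elim: n => [|n IH]; first by rewrite !mul0r addr0.
rewrite [leLHS]exprS; apply: (le_trans (ler_wpM2l x0 IH)) => /=.
have yn : y ^+ n <= x ^+ n by apply: lerXn2r; rewrite ?nnegrE.
have e : n%:R * x ^+ n = n%:R * (x * x ^+ n.-1).
  by case: n {IH yn} => [|n]; rewrite ?mul0r // -exprS.
rewrite -natr1 [y ^+ n.+1]exprS.
have : (x - y) * y ^+ n <= (x - y) * x ^+ n by rewrite ler_wpM2l // subr_ge0.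
have : (x - y) * (n%:R * x ^+ n) = (x - y) * (n%:R * (x * x ^+ n.-1)) by rewrite e.
by lra.
Qed.

Lemma pow_tangent (x y : R) n : 0 <= x -> 0 <= y ->
  y ^+ n + n%:R * y ^+ n.-1 * (x - y) <= x ^+ n.
Proof.
move=> x0 y0; elim: n => [|n IH]; first by rewrite !mul0r addr0.
rewrite [leRHS]exprS; apply: le_trans (ler_wpM2l x0 IH) => /=.
rewrite -natr1; case: n {IH} => [|n] /=; first by rewrite !expr0 expr1; lra.
rewrite -subr_ge0 -natr1 !exprS.
have p0 : 0 <= y ^+ n by rewrite exprn_ge0.
set d := _ - _; have -> : d = (n%:R + 1) * (x - y) ^+ 2 * y ^+ n by rewrite /d; ring.
by rewrite mulr_ge0 // mulr_ge0 ?sqr_ge0 // addr_ge0.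
Qed.

(* The maximum of [x (1 - x)^(s-1)]. *)
Definition kap s : R := s.-1%:R ^+ s.-1 / s%:R ^+ s.

Lemma kap_ge0 s : 0 <= kap s. Proof. by rewrite divr_ge0 ?exprn_ge0. Qed.

Lemma kap_amgm s (x y : R) : (0 < s)%N -> 0 <= x -> 0 <= y ->
  x * y ^+ s.-1 <= kap s * (x + y) ^+ s.
Proof.
move=> s0 x0 y0; have := amgm 1 s.-1 x0 y0.
by rewrite expr1 add1n prednK // expr1n mul1r.
Qed.

Lemma kapE n : kap n.+2 = n.+2%:R^-1 * ((1 + n.+1%:R^-1) ^+ n.+1)^-1.
Proof.
have n0 : 0 < n.+1%:R :> R by rewrite ltr0n.
have n1 : 0 < n.+2%:R :> R by rewrite ltr0n.
have -> : 1 + n.+1%:R^-1 = n.+2%:R / n.+1%:R :> R.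
  by rewrite -[n.+2%:R]natr1 mulrDl divff ?lt0r_neq0 // mul1r.
rewrite /kap /= expr_div_n [n.+2%:R ^+ n.+2]exprS.
move: n1 (exprn_gt0 n.+1 n1) (exprn_gt0 n.+1 n0).
move: (n.+2%:R) (_ ^+ _) (_ ^+ _) => p q r p0 q0 r0; field.
by rewrite !lt0r_neq0.
Qed.

(** By its first three binomial terms, [(1 + 1 / m)^m >= 5 / 2 - 1 / (2 m) >= 12 / 5] for
    [m = s - 1 >= 5]. *)
Lemma kap_le s : (6 <= s)%N -> kap s <= 5 / 12 / s%:R.
Proof.
case: s => [//|[//|n]] s6; rewrite kapE mulrC ler_wpM2r ?invr_ge0 //.
have n5 : 5 <= n.+1%:R :> R by rewrite (ler_nat _ 5).
have H := @binom2_ge n.+1%:R^-1 n.+1 ltac:(by rewrite invr_ge0).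
rewrite -[leRHS]invf_div lef_pV2 ?posrE; [|by rewrite exprn_gt0 // addr_gt0 // invr_gt0 ltr0n|lra].
apply: le_trans H; move: n5; move: (n.+1%:R) => x x5.
have -> : 1 + x * x^-1 + x * (x - 1) / 2 * x^-1 ^+ 2 = 5 / 2 - 1 / (2 * x) by field; lra.
have : 1 / (2 * x) <= 1 / 10.
  by rewrite ler_pdivrMr; lra.
by lra.
Qed.

(** For [m = s - 1] the powers combine, as [(1 + 1 / s) / (1 + 1 / m) = 1 - 1 / s^2]; Bernoulli
    bounds the [m]-th power of this by [1 / (1 + m / s^2)], and a rational inequality remains. *)
Lemma kap_le2 s : (6 <= s)%N -> kap s * (1 + s%:R^-1) ^+ s <= 6 / 35.
Proof.
case: s => [//|[//|n]] s6; rewrite kapE.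
set m := n.+1; have m5 : 5 <= m%:R :> R by rewrite (ler_nat _ 5).
rewrite -[n.+2]/(m.+1) -[in m.+1%:R]natr1; move: m5.
rewrite exprS; set x : R := m%:R => m5.
have x10 : 6 <= x + 1 by lra.
have e : 1 + x^-1 = (x + 1) / x by rewrite mulrDl divff ?lt0r_neq0 ?mul1r //; lra.
have -> : (x + 1)^-1 * ((1 + x^-1) ^+ m)^-1 * ((1 + (x + 1)^-1) * (1 + (x + 1)^-1) ^+ m) =
   ((x + 1)^-1 * (1 + (x + 1)^-1)) * ((1 + (x + 1)^-1) / (1 + x^-1)) ^+ m.
  by rewrite expr_div_n; ring.
set y := (x + 1)^-1; have y0 : 0 < y by rewrite invr_gt0; lra.
have xy : (x + 1) * y = 1 by rewrite divff // lt0r_neq0; lra.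
have -> : (1 + y) / (1 + x^-1) = 1 - y ^+ 2.
  by rewrite e invf_div mulrC /y; field; apply: lt0r_neq0; apply: lt_le_trans x10; lra.
have H : (1 - y ^+ 2) ^+ m <= (1 + x * y ^+ 2)^-1.
  have y1 : y <= 1 by rewrite /y invf_le1; lra.
  have y2 : 0 <= y ^+ 2 by apply: sqr_ge0.
  have y21 : y ^+ 2 <= 1 by apply: exprn_ile1 => //; apply: ltW.
  move: (y ^+ 2) y2 y21 => z z0 z1.
  have G := @bernoulli R z m ltac:(lra).
  have G0 : 0 < 1 + x * z by rewrite ltr_wpDr // mulr_ge0 //; lra.
  rewrite -[leRHS]mul1r ler_pdivlMr //.
  apply: (@le_trans _ _ ((1 - z) ^+ m * (1 + z) ^+ m)).
    by rewrite ler_wpM2l // exprn_ge0 //; lra.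
  by rewrite -exprMn; apply: exprn_ile1; nra.
apply: (@le_trans _ _ (y * (1 + y) * (1 + x * y ^+ 2)^-1)).
  by rewrite ler_wpM2l // mulr_ge0 //; lra.
have -> : y * (1 + y) * (1 + x * y ^+ 2)^-1 = (x + 2) * (x + 1) / ((x + 1) * (x ^+ 2 + 3 * x + 1)).
  rewrite /y; field; apply/andP; split; apply: lt0r_neq0; nra.
rewrite ler_pdivrMr; last by apply: mulr_gt0; nra.
nra.
Qed.

Lemma inner_max1E k : inner_max R k 1 = kap k.
Proof. by rewrite /inner_max /kap expr1n mulr1 addn1. Qed.

Lemma star_max1E k : star_max R k 1 = kap k.+1.
Proof. by rewrite /star_max /kap expr1n mulr1 addn1. Qed.

Lemma kap_ge k : (1 < k)%N -> 4 / 11 <= k%:R * kap k.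
Proof.
case: k => [//|[//|n]] _; rewrite kapE mulrA divff ?pnatr_eq0 // mul1r.
have p0 : 0 < (1 + n.+1%:R^-1) ^+ n.+1 :> R.
  by rewrite exprn_gt0 // addr_gt0 // invr_gt0 ltr0n.
have q0 : 0 < 11 / 4 :> R by lra.
rewrite -[leLHS]invf_div lef_pV2 ?posrE //.
exact: euler_le.
Qed.

(** Amounts to [(k - 1) * (k + 1) <= k^2]. It compares [inner_max k 1] with [star_max k 1]. *)
Lemma kapS_le k : (1 < k)%N -> kap k <= kap k.+1 * (k.+1%:R / k%:R) ^+ 2.
Proof.
case: k => [//|[//|n]] _; rewrite /kap /=.
have p0 : 0 < n.+1%:R :> R by rewrite ltr0n.
have q0 : 0 < n.+2%:R :> R by rewrite ltr0n.
have r0 : 0 < n.+3%:R :> R by rewrite ltr0n.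
have H : (n.+1%:R * n.+3%:R) ^+ n.+1 <= (n.+2%:R ^+ 2) ^+ n.+1 :> R.
  apply: lerXn2r; rewrite ?nnegrE ?sqr_ge0 ?mulr_ge0 //.
  by rewrite -[n.+3%:R]natr1 -[n.+2%:R]natr1 -[n.+1%:R]natr1; lra.
rewrite exprMn -exprM mul2n -addnn exprD in H.
rewrite expr_div_n mulf_div ler_pdivrMr ?exprn_gt0 //.
rewrite mulrAC ler_pdivlMr; last by rewrite mulr_gt0 ?exprn_gt0.
rewrite [n.+3%:R ^+ n.+3]exprS [n.+3%:R ^+ n.+2]exprS [n.+2%:R ^+ n.+2]exprS.
move: H p0 q0 r0; set P := n.+1%:R ^+ _; set Q := n.+2%:R ^+ n.+1; set T := n.+3%:R ^+ n.+1.
move: (n.+2%:R) (n.+3%:R) => q r H p0 q0 r0.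
have : P * T * (r ^+ 2 * q ^+ 2) <= Q * Q * (r ^+ 2 * q ^+ 2).
  by rewrite ler_wpM2r // mulr_ge0 ?sqr_ge0.
by rewrite !expr2; lra.
Qed.

(** Concerns an edge of [W] with an end outside [Wm]: on the left the stars centred in [W] that it
    can create, on the right the stars centred in [A] that it destroys; see [totW_one]. *)
Lemma lossy_bound k (al : R) : (5 <= k)%N -> 7 / 10 <= al * (k + 1).+1%:R ->
  inner_max R k 1 * (k + 1).+1%:R * cutoff R (k + 1) ^+ (k + 1).-1
    <= 288 / 1000 * star_max R k 1 * (18 / (100 * k%:R) * al).
Proof.
move=> k5 al7; rewrite inner_max1E star_max1E.
have k5' : 5 <= k%:R :> R by rewrite (ler_nat _ 5).
have s6 : (6 <= k + 1)%N by rewrite addn1.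
have K0 : 0 <= kap k.+1 by apply: kap_ge0.
have a0 := cutoff_ge0 R (k + 1); have a1 := cutoff_le R s6.
have aE := cutoffE R (k + 1).
rewrite [in X in _ <= X]mulrA.
have H1 := kapS_le (leq_trans (isT : 1 < 5)%N k5).
set a := cutoff _ _ in a0 a1 aE *; set S := (k + 1).+1%:R in al7 aE *.
have S7 : S = k%:R + 2 by rewrite /S -addn1 -addnA natrD.
have -> : a ^+ (k + 1).-1 = a ^+ 2 * a ^+ (k + 1 - 3)%N.
  by rewrite -exprD; congr (_ ^+ _); lia.
have H2 : (k + 1)%:R * a ^+ (k + 1 - 3)%N <= 6 * (11 / 70) ^+ 3.
  have -> : (k + 1 - 3)%N = (k - 5 + 3)%N by lia.
  have -> : (k + 1 = k - 5 + 6)%N by lia.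
  elim: (k - 5)%N => [|j IH].
    by rewrite add0n ler_wpM2l // lerXn2r ?nnegrE //; lra.
  apply: le_trans IH; rewrite !addSn exprS mulrA ler_wpM2r ?exprn_ge0 //.
  have : 6 <= (j + 6)%:R :> R by rewrite (ler_nat _ 6) leq_addl.
  by rewrite -natr1; nra.
have kS : (k + 1)%:R = k%:R + 1 :> R by rewrite natrD.
set X := a ^+ _ in H2 *; have X0 : 0 <= X by rewrite exprn_ge0.
have S0 : 0 < S by lra.
rewrite -(ler_pM2l S0).
apply: (@le_trans _ _ (kap k.+1 * ((k%:R + 1) / k%:R) ^+ 2 * (S * a) ^+ 2 * X)).
  have -> : S * (kap k * S * (a ^+ 2 * X)) = kap k * ((S * a) ^+ 2 * X) by ring.
  rewrite -mulrA; apply: ler_wpM2r; first by rewrite mulr_ge0 ?sqr_ge0.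
  by move: H1; rewrite -natr1.
rewrite aE.
have -> : S * (288 / 1000 * kap k.+1 * (18 / (100 * k%:R)) * al) =
   kap k.+1 * (288 / 1000 * (18 / (100 * k%:R)) * (al * S)) by ring.
have -> : kap k.+1 * ((k%:R + 1) / k%:R) ^+ 2 * (11 / 10) ^+ 2 * X =
   kap k.+1 * ((k%:R + 1) / k%:R / k%:R * ((11 / 10) ^+ 2 * ((k + 1)%:R * X))).
  by rewrite kS; field; lra.
rewrite ler_wpM2l //.
have k0 : 0 < k%:R :> R by lra.
apply: (@le_trans _ _ (6 / 5 / k%:R * ((11 / 10) ^+ 2 * (6 * (11 / 70) ^+ 3)))).
  apply: ler_pM.
  - by rewrite !divr_ge0 ?addr_ge0.
  - by rewrite !mulr_ge0 //; lra.
  - by rewrite ler_wpM2r ?invr_ge0 // ler_pdivrMr //; lra.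
  by rewrite ler_wpM2l //; lra.
have -> : 18 / (100 * k%:R) = 18 / 100 / k%:R :> R by field; lra.
have -> : 6 / 5 / k%:R * ((11 / 10) ^+ 2 * (6 * (11 / 70) ^+ 3)) =
  (6 / 5 * ((11 / 10) ^+ 2 * (6 * (11 / 70) ^+ 3))) / k%:R :> R by ring.
have -> : 288 / 1000 * (18 / 100 / k%:R) * (al * S) = (288 / 1000 * (18 / 100 * (al * S))) / k%:R by ring.
by rewrite ler_wpM2r ?invr_ge0 //; lra.
Qed.

Lemma inner_max1_gap k : (1 < k)%N -> 18 / (100 * k%:R) <= inner_max R k 1 / 2.
Proof.
move=> k1; have H := kap_ge k1; rewrite inner_max1E.
have k0 : 0 < k%:R :> R by rewrite ltr0n ltnW.
rewrite ler_pdivrMr; last by rewrite mulr_gt0.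
by lra.
Qed.

(** [3 / 7 / 2] is the slack coefficient of [totA_one], and [1 + 1 / s] the threshold on
    [ms Wm / ms A] in [tot_le_one]. *)
Lemma slack_bound k : (5 <= k)%N -> kap (k + 1) * (1 + (k + 1)%:R^-1) ^+ (k + 1) <=
  3 / 7 / 2 * (1 - 18 / (100 * k%:R)).
Proof.
move=> k5; have s6 : (6 <= k + 1)%N by rewrite addn1.
apply: (le_trans (kap_le2 s6)).
have k5' : 5 <= k%:R :> R by rewrite (ler_nat _ 5).
have : 18 / (100 * k%:R) <= 18 / 500 :> R by rewrite ler_pdivrMr; lra.
by lra.
Qed.

(** Here [z] is the mean weight of the non-out-neighbours in [W] and [m] the weight of [Wm]. The
    terms on the left are at most 58 and 42 hundredths of the right side: [z] is at least almost
    [(1 + 1 / s) * al], and [m] is at most about [z]. *)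
Lemma swap_bound k (al z m : R) : (5 <= k)%N -> 0 <= al -> 7 / 10 <= al * (k + 1).+1%:R ->
  0 <= m -> z <= 45 / 100 ->
  (1 - 18 / (100 * k%:R)) * ((1 + (k + 1)%:R^-1) * al) <= z ->
  (1 - 18 / (100 * k%:R)) * m <= z ->
  al ^+ (k + 1) * z + kap (k + 1) * m ^+ (k + 1).+1 <= al * z ^+ (k + 1).
Proof.
move=> k5 al0 al7 m0 z45 Hz Hm.
have k5' : 5 <= k%:R :> R by rewrite (ler_nat _ 5).
have s6 : (6 <= k + 1)%N by rewrite addn1.
have sE : (k + 1)%:R = k%:R + 1 :> R by rewrite natrD.
set e : R := 18 / (100 * k%:R) in Hz Hm *.
have ke : k%:R * e = 18 / 100 by rewrite /e; field; lra.
have e0 : 0 <= e by rewrite divr_ge0 //; lra.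
have e1 : e <= 18 / 500 by rewrite /e ler_pdivrMr; lra.
clearbody e.
have nu0 : 0 <= 1 - e by lra.
have z0 : 0 <= z by apply: le_trans Hm; rewrite mulr_ge0.
have N1 : 82 / 100 <= (1 - e) ^+ k.
  by have := @bernoulli R (- e) k ltac:(lra); lra.
have N2 : 748 / 1000 <= (1 - e) ^+ (k + 1).+1.
  have := @bernoulli R (- e) (k + 1).+1 ltac:(lra); rewrite -natr1 sE; lra.
have G : 211 / 100 <= (1 + (k + 1)%:R^-1) ^+ k :> R.
  apply: le_trans (binom2_ge k _); last by rewrite invr_ge0.
  rewrite sE; set y := (k%:R + 1)^-1.
  have y0 : 0 < y by rewrite invr_gt0; lra.
  have ky : k%:R * y = 1 - y by rewrite /y; field; lra.
  have y6 : y <= 1 / 6 by rewrite /y -[leRHS]invf_div lef_pV2 ?posrE; lra.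
  have -> : k%:R * (k%:R - 1) / 2 * y ^+ 2 = (k%:R * y) * (k%:R * y - y) / 2 by ring.
  by rewrite ky; nra.
have sP : (k + 1).-1 = k by rewrite addn1.
have A1 : al ^+ k <= 58 / 100 * z ^+ k.
  have : ((1 - e) * ((1 + (k + 1)%:R^-1) * al)) ^+ k <= z ^+ k.
    apply: lerXn2r; rewrite ?nnegrE //; rewrite !mulr_ge0 //.
    by rewrite addr_ge0 // invr_ge0.
  rewrite !exprMn; set g := (1 + _) ^+ k in G *; set n := (1 - e) ^+ k in N1 *.
  have gn : 100 / 58 <= n * g.
    apply: (@le_trans _ _ (82 / 100 * (211 / 100))); first by lra.
    by apply: ler_pM => //; lra.
  have ak : 0 <= al ^+ k by rewrite exprn_ge0.
  have : 100 / 58 * al ^+ k <= n * g * al ^+ k by rewrite ler_wpM2r.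
  by rewrite mulrA; lra.
have A2 : al ^+ (k + 1) * z <= 58 / 100 * (al * z ^+ (k + 1)).
  rewrite addn1 !exprS; have := ler_wpM2l (mulr_ge0 al0 z0) A1; lra.
have zs0 : 0 <= z ^+ (k + 1) by rewrite exprn_ge0.
have A3 : kap (k + 1) * m ^+ (k + 1).+1 <= 42 / 100 * (al * z ^+ (k + 1)).
  have H : 748 / 1000 * m ^+ (k + 1).+1 <= 45 / 100 * z ^+ (k + 1).
    apply: (@le_trans _ _ (((1 - e) * m) ^+ (k + 1).+1)).
      by rewrite exprMn ler_wpM2r // exprn_ge0.
    apply: (@le_trans _ _ (z ^+ (k + 1).+1)).
      by apply: lerXn2r; rewrite ?nnegrE // mulr_ge0.
    by rewrite exprS ler_wpM2r.
  have s0 : 0 < (k + 1)%:R :> R by rewrite sE; lra.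
  have K := kap_le s6; rewrite ler_pdivlMr // in K.
  have K0 := kap_ge0 (k + 1).
  have al7' : 7 / 10 <= al * ((k + 1)%:R * (7 / 6)).
    apply: (le_trans al7); rewrite ler_wpM2l // -natr1 sE; lra.
  rewrite -(ler_pM2l s0).
  have M0 : 0 <= m ^+ (k + 1).+1 by rewrite exprn_ge0.
  apply: (@le_trans _ _ (5 / 12 * m ^+ (k + 1).+1)).
    by rewrite mulrA ler_wpM2r // mulrC.
  have := ler_wpM2r zs0 al7'; lra.
by lra.
Qed.

(** For larger [x] the weight [o] is too small for the product [o^k * x]. A bound below [1 / 2] lets
    [x] take the place of alpha in the maximand. *)
Lemma hat_le k (al o x : R) : (5 <= k)%N -> 0 <= al -> 7 / 10 <= al * (k + 1).+1%:R ->
  0 <= o -> 0 <= x -> al + o + x = 1 -> 36 / 100 * star_max R k 1 <= o ^+ k * x ->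
  x <= 45 / 100.
Proof.
move=> k5 al0 al7 o0 x0 E HP; rewrite leNgt; apply/negP => x45.
have s6 : (6 <= k + 1)%N by rewrite addn1.
have k5' : 5 <= k%:R :> R by rewrite (ler_nat _ 5).
have s0 : 0 < k.+1%:R :> R by rewrite ltr0n.
have Hh : 4 / 11 <= k.+1%:R * star_max R k 1 by rewrite star_max1E kap_ge // ltnS (leq_trans _ k5).
have {}HP : 36 / 100 * (4 / 11) <= k.+1%:R * (o ^+ k * x).
  apply: (@le_trans _ _ (36 / 100 * (k.+1%:R * star_max R k 1))); first by rewrite ler_wpM2l //; lra.
  by rewrite mulrCA ler_wpM2l.
have pw (y : R) : 0 <= y -> y <= 6 / 7 -> k.+1%:R * y ^+ k <= 6 * y ^+ 5.
  by move=> y0 y1; have := npow_le s6 y0 y1; rewrite addn1.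
case: (lerP x (6 / 10)) => x6; last first.
  have H := pw (4 / 10) ltac:(lra) ltac:(lra).
  have : o ^+ k * x <= (4 / 10) ^+ k * 1.
    apply: ler_pM; rewrite ?exprn_ge0 //; last by lra.
    by apply: lerXn2r; rewrite ?nnegrE; lra.
  by move=> /(ler_wpM2l (ltW s0)); lra.
have H := pw (55 / 100) ltac:(lra) ltac:(lra).
(* [14 / 11] is [(7 / 10) / (55 / 100)], so that [al >= 55 / 100 * y] and hence
   [o <= 55 / 100 * (1 - y)]. *)
pose y : R := (14 / 11) / (k + 1).+1%:R.
have S0 : 0 < (k + 1).+1%:R :> R by rewrite ltr0n.
have SE : (k + 1).+1%:R = k%:R + 2 :> R by rewrite -natr1 natrD; ring.
have y0 : 0 <= y by rewrite /y divr_ge0 ?(ltW S0) //; lra.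
have y1 : y <= 1 by rewrite /y ler_pdivrMr // SE; lra.
have ky : 10 / 11 <= k%:R * y by rewrite /y mulrA ler_pdivlMr // SE; lra.
have oy : o <= 55 / 100 * (1 - y).
  have : 7 / 10 / (k + 1).+1%:R <= al by rewrite ler_pdivrMr.
  have -> : 7 / 10 / (k + 1).+1%:R = 55 / 100 * y by rewrite /y mulrA; congr (_ / _); lra.
  by move: E x45; lra.
clearbody y.
have Hy : (1 - y) ^+ k <= 11 / 21.
  have G := @bernoulli R y k ltac:(lra).
  have : (1 - y) ^+ k * (1 + y) ^+ k <= 1 by rewrite -exprMn; apply: exprn_ile1; nra.
  have : 0 <= (1 - y) ^+ k by rewrite exprn_ge0 // subr_ge0.
  by nra.
have : o ^+ k * x <= ((55 / 100) ^+ k * (11 / 21)) * (6 / 10).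
  apply: ler_pM; rewrite ?exprn_ge0 //.
  apply: (@le_trans _ _ ((55 / 100 * (1 - y)) ^+ k)).
    by apply: lerXn2r; rewrite ?nnegrE //; apply: mulr_ge0; lra.
  by rewrite exprMn ler_wpM2l // exprn_ge0 //; lra.
move=> /(ler_wpM2l (ltW s0)); lra.
Qed.

End Num1.

(** * Weighted counts of independent tuples *)

Section Cnt.
Variables (R : realFieldType) (V : finType) (w : R) (nb : V -> {set V}).
Hypothesis w0 : 0 <= w.
Hypothesis nbC : forall x y, (x \in nb y) = (y \in nb x).
Implicit Types X Y Z : {set V}.

Definition ms X : R := locked (w * #|X|%:R).

Lemma msE X : ms X = w * #|X|%:R. Proof. by rewrite /ms -lock. Qed.

(* [cnt k l X Y] is the total weight of the tuples of [k] vertices of [X] and [l]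
   vertices of [Y] that are pairwise nonadjacent. An entry may repeat, as [x] is
   normally not in [nb x]. *)
Fixpoint cnt_in l Y : R :=
  if l is l'.+1 then \sum_(y in Y) w * cnt_in l' (Y :\: nb y) else 1.

Fixpoint cnt k l X Y : R :=
  if k is k'.+1 then \sum_(x in X) w * cnt k' l (X :\: nb x) (Y :\: nb x)
  else cnt_in l Y.

Lemma ms_ge0 X : 0 <= ms X. Proof. by rewrite msE mulr_ge0. Qed.

Lemma ms_sum X : \sum_(x in X) w = ms X.
Proof. by rewrite sumr_const msE mulr_natr. Qed.

Lemma ms_le X Y : X \subset Y -> ms X <= ms Y.
Proof. by move=> /subset_leq_card H; rewrite !msE ler_wpM2l // ler_nat. Qed.

Lemma msID X Y : ms X = ms (X :&: Y) + ms (X :\: Y).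
Proof. by rewrite !msE -mulrDr -natrD cardsID. Qed.

Lemma msU X Y : [disjoint X & Y] -> ms (X :|: Y) = ms X + ms Y.
Proof.
by move=> XY; rewrite !msE -mulrDr -natrD cardsU disjoint_setI0 // cards0 subn0.
Qed.

Lemma ms_sum_le X (F : V -> R) B : (forall x, x \in X -> F x <= B) ->
  \sum_(x in X) w * F x <= ms X * B.
Proof.
move=> H; rewrite -ms_sum mulr_suml; apply: ler_sum => x xX.
by rewrite ler_wpM2l ?H.
Qed.

Lemma cnt_in_ge0 l Y : 0 <= cnt_in l Y.
Proof.
elim: l Y => [|l IH] Y //=.
by apply: sumr_ge0 => y _; rewrite mulr_ge0.
Qed.

Lemma cnt_ge0 k l X Y : 0 <= cnt k l X Y.
Proof.
elim: k X Y => [|k IH] X Y /=; first exact: cnt_in_ge0.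
by apply: sumr_ge0 => y _; rewrite mulr_ge0.
Qed.

Lemma msX_le X Y n : X \subset Y -> ms X ^+ n <= ms Y ^+ n.
Proof. by move=> XY; apply: lerXn2r; rewrite ?nnegrE ?ms_ge0 ?ms_le. Qed.

Lemma sumw_mono X Y (F G : V -> R) : X \subset Y -> (forall x, 0 <= G x) ->
  (forall x, x \in X -> F x <= G x) ->
  \sum_(x in X) w * F x <= \sum_(x in Y) w * G x.
Proof.
move=> XY G0 FG; rewrite [leRHS](big_setID X) /= (setIidPr XY).
rewrite -[leLHS]addr0 lerD //; first by apply: ler_sum => x xX; rewrite ler_wpM2l ?FG.
by apply: sumr_ge0 => x _; rewrite mulr_ge0.
Qed.

Lemma cnt_le k l X Y : cnt k l X Y <= ms X ^+ k * ms Y ^+ l.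
Proof.
elim: k X Y => [|k IH] X Y /=.
  rewrite expr0 mul1r; elim: l Y => [|l IHl] Y //=.
  rewrite exprS; apply: ms_sum_le => y _; apply: (le_trans (IHl _)).
  by apply: lerXn2r; rewrite ?nnegrE ?ms_ge0 ?ms_le ?subsetDl.
rewrite exprS -mulrA; apply: ms_sum_le => x _; apply: (le_trans (IH _ _)).
by apply: ler_pM; rewrite ?exprn_ge0 ?ms_ge0 //;
  apply: lerXn2r; rewrite ?nnegrE ?ms_ge0 ?ms_le ?subsetDl.
Qed.

Lemma cnt_le_pow k l X Y B : ms X <= B -> ms Y <= B ->
  cnt k l X Y <= B ^+ (k + l).
Proof.
move=> XB YB; apply: (le_trans (cnt_le _ _ _ _)); rewrite exprD.
by apply: ler_pM; rewrite ?exprn_ge0 ?ms_ge0 //;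
  apply: lerXn2r; rewrite ?nnegrE ?ms_ge0 // (le_trans (ms_ge0 X)).
Qed.

Lemma sumw_exchange X Y (F : V -> V -> R) :
  \sum_(x in X) w * (\sum_(y in Y :\: nb x) w * F x y) =
  \sum_(y in Y) w * (\sum_(x in X :\: nb y) w * F x y).
Proof.
under eq_bigr do rewrite mulr_sumr.
under [RHS]eq_bigr do rewrite mulr_sumr.
rewrite (exchange_big_dep (mem Y)) /=; last by move=> x y _; rewrite inE => /andP[].
apply: eq_bigr => y yY; apply: eq_big => [x|x _]; last by rewrite mulrCA.
by rewrite !inE yY andbT nbC andbC.
Qed.

(** The recursion of [cnt] chooses out-leaves first; exchanging sums lets an in-leaf be chosen
    first. *)
Lemma cnt_inS k l X Y :
  cnt k l.+1 X Y = \sum_(y in Y) w * cnt k l (X :\: nb y) (Y :\: nb y).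
Proof.
elim: k X Y => [|k IH] X Y //=.
under eq_bigr do rewrite IH.
rewrite sumw_exchange; apply: eq_bigr => y _; congr (_ * _).
apply: eq_bigr => x _; congr (_ * _).
by rewrite !setDDl ![nb y :|: _]setUC.
Qed.

Lemma sumw_exchangeD X Z (F : V -> V -> R) :
  (forall x y, 0 <= F x y) ->
  \sum_(x in X :\: Z) w * (\sum_(z in (X :\: nb x) :&: Z) w * F x z) <=
  \sum_(z in X :&: Z) w * (\sum_(x in X :\: nb z) w * F x z).
Proof.
move=> F0.
have -> : \sum_(x in X :\: Z) w * (\sum_(z in (X :\: nb x) :&: Z) w * F x z)
  = \sum_(x in X :\: Z) w * (\sum_(z in (X :&: Z) :\: nb x) w * F x z).
  apply: eq_bigr => x _; congr (_ * _); apply: eq_bigl => z; rewrite !inE.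
  by rewrite andbA.
rewrite sumw_exchange; apply: ler_sum => z _; rewrite ler_wpM2l //.
apply: sumw_mono => //; first by rewrite setSD ?subsetDl.
Qed.

Lemma cnt_in_hit l Y Z :
  cnt_in l Y <= cnt_in l (Y :\: Z)
    + l%:R * (\sum_(z in Y :&: Z) w * cnt_in l.-1 (Y :\: nb z)).
Proof.
elim: l Y => [|l IH] Y /=; first by rewrite mul0r addr0.
rewrite (big_setID Z) /= -natr1 mulrDl mul1r.
set X := \sum_(z in Y :&: Z) _; rewrite [X + _]addrC addrA lerD2r.
pose F (x z : V) := cnt_in l.-1 ((Y :\: nb x) :\: nb z).
apply: (@le_trans _ _ (\sum_(y in Y :\: Z) (w * cnt_in l ((Y :\: Z) :\: nb y)
     + l%:R * (w * \sum_(z in (Y :\: nb y) :&: Z) w * F y z)))).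
  apply: ler_sum => y _; rewrite [l%:R * _]mulrCA -mulrDr ler_wpM2l //.
  by rewrite setDDl setUC -setDDl.
rewrite big_split /= lerD2l -mulr_sumr.
case: l {IH} @F @X => [|l] F X; first by rewrite !mul0r.
rewrite ler_wpM2l //.
apply: (le_trans (sumw_exchangeD _ _ _)) => [x y|]; first exact: cnt_in_ge0.
apply: ler_sum => z _; rewrite ler_wpM2l //=; apply: ler_sum => y _.
by rewrite /F /= !setDDl setUC.
Qed.

(* A tuple either avoids [Z] or has an entry in [Z]; the latter are bounded by
   a sum over positions. *)
Lemma cnt_hit k l X Y Z :
  cnt k l X Y <= cnt k l (X :\: Z) (Y :\: Z)
    + k%:R * (\sum_(z in X :&: Z) w * cnt k.-1 l (X :\: nb z) (Y :\: nb z))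
    + l%:R * (\sum_(z in Y :&: Z) w * cnt k l.-1 (X :\: nb z) (Y :\: nb z)).
Proof.
elim: k X Y => [|k IH] X Y.
  by rewrite mul0r addr0; apply: cnt_in_hit.
rewrite /= (big_setID Z) /= -natr1 mulrDl mul1r.
set U := \sum_(z in X :&: Z) _; set U' := \sum_(z in Y :&: Z) _.
rewrite [_ * U + U]addrC [X in _ <= X]addrAC ![_ + (U + _)]addrCA -!addrA lerD2l addrA.
pose F (x z : V) := cnt k.-1 l ((X :\: nb x) :\: nb z) ((Y :\: nb x) :\: nb z).
pose F' (x z : V) := cnt k l.-1 ((X :\: nb x) :\: nb z) ((Y :\: nb x) :\: nb z).
apply: (@le_trans _ _ (\sum_(x in X :\: Z)
     (w * cnt k l ((X :\: Z) :\: nb x) ((Y :\: Z) :\: nb x)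
     + k%:R * (w * \sum_(z in (X :\: nb x) :&: Z) w * F x z)
     + l%:R * (w * \sum_(z in (Y :\: nb x) :&: Z) w * F' x z)))).
  apply: ler_sum => x _.
  rewrite [k%:R * _]mulrCA [l%:R * _]mulrCA -!mulrDr ler_wpM2l //.
  by rewrite !(setDDl _ Z) ![Z :|: _]setUC -!(setDDl _ _ Z).
rewrite !big_split /= -!addrA lerD2l -!mulr_sumr addrC; apply: lerD.
  rewrite ler_wpM2l // mulr_sumr.
  apply: (@le_trans _ _ (\sum_(x in X) w * \sum_(z in (Y :&: Z) :\: nb x) w * F' x z)).
    apply: sumw_mono => [|x|x _]; rewrite ?subsetDl //.
      by apply: sumr_ge0 => z _; rewrite mulr_ge0 ?cnt_ge0.
    by rewrite (_ : (Y :&: Z) :\: nb x = (Y :\: nb x) :&: Z) //;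
      apply/setP=> z; rewrite !inE andbA.
  rewrite sumw_exchange; apply: ler_sum => z _; rewrite ler_wpM2l //.
  by apply: ler_sum => x _; rewrite /F' /= !setDDl ![nb z :|: _]setUC.
case: k {IH U'} @F {F'} @U => [|k] F U; first by rewrite !mul0r.
rewrite ler_wpM2l // mulr_sumr.
apply: (le_trans (sumw_exchangeD _ _ _)) => [x y|]; first exact: cnt_ge0.
apply: ler_sum => z _; rewrite ler_wpM2l //=; apply: ler_sum => y _.
by rewrite /F /= !setDDl ![nb z :|: _]setUC.
Qed.

(* Twice the weight of the edges inside [X] when [Y = X]. *)
Definition ed X Y : R := \sum_(x in X) w * ms (Y :&: nb x).

Lemma ed_ge0 X Y : 0 <= ed X Y.
Proof. by apply: sumr_ge0 => x _; rewrite mulr_ge0 ?ms_ge0. Qed.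

Lemma sumw_swap X Y (F : V -> V -> R) (r r' : V -> {set V}) :
  (forall x y, x \in X -> y \in Y -> (y \in r x) = (x \in r' y)) ->
  \sum_(x in X) w * (\sum_(y in Y :&: r x) w * F x y) =
  \sum_(y in Y) w * (\sum_(x in X :&: r' y) w * F x y).
Proof.
move=> rC.
under eq_bigr do rewrite mulr_sumr.
under [RHS]eq_bigr do rewrite mulr_sumr.
rewrite (exchange_big_dep (mem Y)) /=; last by move=> x y _; rewrite inE => /andP[].
apply: eq_bigr => y yY; apply: eq_big => [x|x _]; last by rewrite mulrCA.
by rewrite !inE yY /=; case: (boolP (x \in X)) => //= xX; rewrite rC.
Qed.

Lemma ms_sum1 X : \sum_(x in X) w * 1 = ms X.
Proof. by under eq_bigr do rewrite mulr1; rewrite ms_sum. Qed.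

Lemma edC X Y : ed X Y = ed Y X.
Proof.
have E X' Y' : ed X' Y' = \sum_(x in X') w * (\sum_(y in Y' :&: nb x) w * 1).
  by apply: eq_bigr => x _; rewrite ms_sum1.
by rewrite !E; apply: sumw_swap => x y _ _; apply: nbC.
Qed.

Lemma ms_sum_D X Y c :
  \sum_(x in X) w * (c * ms (Y :\: nb x)) = c * (ms X * ms Y - ed X Y).
Proof.
under eq_bigr do rewrite mulrCA; rewrite -mulr_sumr; congr (_ * _).
rewrite -ms_sum mulr_suml -sumrB; apply: eq_bigr => x _.
by rewrite -mulrBr (msID Y (nb x)) addrAC subrr add0r.
Qed.

(** Only the nonadjacency of one pair of out-leaf positions is kept; all other entries are bounded
    freely. *)
Lemma cnt_loss_out k l X Y :
  cnt k.+2 l X Y <= ms X ^+ k.+2 * ms Y ^+ l - ms X ^+ k * ms Y ^+ l * ed X X.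
Proof.
apply: (@le_trans _ _ (\sum_(y in X) w * (ms X ^+ k * ms Y ^+ l * ms (X :\: nb y)))).
  apply: ler_sum => y _; rewrite ler_wpM2l //.
  apply: (le_trans (cnt_le k.+1 l _ _)).
  rewrite exprSr -!mulrA [ms Y ^+ _ * _]mulrC.
  apply: ler_pM; rewrite ?mulr_ge0 ?exprn_ge0 ?ms_ge0 ?msX_le ?subsetDl //.
  by rewrite ler_wpM2l ?ms_ge0 ?msX_le ?subsetDl.
by rewrite ms_sum_D mulrBr !exprS le_eqVlt; apply/orP; left; apply/eqP; ring.
Qed.

Lemma cnt_loss_out_in k l X Y :
  cnt k.+1 l.+1 X Y <= ms X ^+ k.+1 * ms Y ^+ l.+1 - ms X ^+ k * ms Y ^+ l * ed X Y.
Proof.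
apply: (@le_trans _ _ (\sum_(y in X) w * (ms X ^+ k * ms Y ^+ l * ms (Y :\: nb y)))).
  apply: ler_sum => y _; rewrite ler_wpM2l //.
  apply: (le_trans (cnt_le k l.+1 _ _)).
  rewrite exprSr -!mulrA.
  apply: ler_pM; rewrite ?mulr_ge0 ?exprn_ge0 ?ms_ge0 ?msX_le ?subsetDl //.
  by rewrite ler_wpM2r ?ms_ge0 ?msX_le ?subsetDl.
by rewrite ms_sum_D mulrBr !exprS le_eqVlt; apply/orP; left; apply/eqP; ring.
Qed.

Lemma cnt_loss_in k l X Y :
  cnt k l.+2 X Y <= ms X ^+ k * ms Y ^+ l.+2 - ms X ^+ k * ms Y ^+ l * ed Y Y.
Proof.
rewrite cnt_inS.
apply: (@le_trans _ _ (\sum_(y in Y) w * (ms X ^+ k * ms Y ^+ l * ms (Y :\: nb y)))).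
  apply: ler_sum => y _; rewrite ler_wpM2l //.
  apply: (le_trans (cnt_le k l.+1 _ _)).
  rewrite exprSr -!mulrA.
  apply: ler_pM; rewrite ?mulr_ge0 ?exprn_ge0 ?ms_ge0 ?msX_le ?subsetDl //.
  by rewrite ler_wpM2r ?ms_ge0 ?msX_le ?subsetDl.
by rewrite ms_sum_D mulrBr !exprS le_eqVlt; apply/orP; left; apply/eqP; ring.
Qed.

Lemma ed_mono X Y X' Y' : X \subset X' -> Y \subset Y' -> ed X Y <= ed X' Y'.
Proof.
move=> XX YY; apply: sumw_mono => // [x|x xX]; first exact: ms_ge0.
by rewrite ms_le // setSI.
Qed.

Lemma edUl X Y Z : [disjoint X & Y] -> ed (X :|: Y) Z = ed X Z + ed Y Z.
Proof.
move=> XY; rewrite /ed (big_setID X) /=; congr (_ + _); apply: eq_bigl => x.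
  by rewrite !inE; case: (x \in X); rewrite ?andbF.
rewrite !inE; case: (boolP (x \in Y)) => [xY|]; last by rewrite orbF andNb.
by rewrite (disjointFl XY xY).
Qed.

Lemma edUr X Y Z : [disjoint X & Y] -> ed Z (X :|: Y) = ed Z X + ed Z Y.
Proof. by move=> XY; rewrite edC edUl // !(edC Z). Qed.

Lemma edU X Y : [disjoint X & Y] ->
  ed (X :|: Y) (X :|: Y) = ed X X + 2 * ed X Y + ed Y Y.
Proof. by move=> XY; rewrite edUl // !edUr // (edC Y X); ring. Qed.

(* Averages the losses on the three kinds of pairs of positions. *)
Lemma cnt_loss3 k l X Y c : [disjoint X & Y] -> ms X + ms Y <= c ->
  3 * c ^+ 2 * cnt k.+2 l.+2 X Y <=
  ms X ^+ k.+2 * ms Y ^+ l.+2 * (3 * c ^+ 2 - ed (X :|: Y) (X :|: Y)).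
Proof.
move=> XY xyc; rewrite edU //.
have := cnt_loss_out k l.+2 X Y; have := cnt_loss_out_in k.+1 l.+1 X Y.
have := cnt_loss_in k.+2 l X Y.
have := ed_ge0 X X; have := ed_ge0 X Y; have := ed_ge0 Y Y.
have := ms_ge0 X; have := ms_ge0 Y.
move: (cnt _ _ _ _) (ms X) (ms Y) (ed _ _) (ed X Y) (ed Y Y) xyc.
move=> N x y e1 e2 e3 xyc y0 x0 e30 e20 e10 H3 H2 H1.
have c2 : 0 <= c ^+ 2 by apply: sqr_ge0.
have q0 : 0 <= x ^+ k * y ^+ l by rewrite mulr_ge0 ?exprn_ge0.
have := ler_wpM2l c2 H1; have := ler_wpM2l c2 H2; have := ler_wpM2l c2 H3.
rewrite !exprS; move: q0; move: (x ^+ k) (y ^+ l) => p q q0 G3 G2 G1.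
have xc : x ^+ 2 <= c ^+ 2 by apply: lerXn2r; rewrite ?nnegrE; lra.
have yc : y ^+ 2 <= c ^+ 2 by apply: lerXn2r; rewrite ?nnegrE; lra.
have xy : 2 * (x * y) <= c ^+ 2.
  apply: (@le_trans _ _ ((x + y) ^+ 2)); last by apply: lerXn2r; rewrite ?nnegrE; lra.
  by rewrite -subr_ge0 (_ : _ - _ = x ^+ 2 + y ^+ 2); [rewrite addr_ge0 ?sqr_ge0|ring].
(* Edges between [X] and [Y] count twice in [ed (X :|: Y) (X :|: Y)]; this is why
   [2 * (x * y) <= c^2] is the bound needed for them. *)
have K1 : p * q * (y ^+ 2 * e1) * x ^+ 2 <= p * q * (y ^+ 2 * e1) * c ^+ 2.
  by rewrite ler_wpM2l // mulr_ge0 // mulr_ge0 ?sqr_ge0.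
have K2 : p * q * (x * y * e2) * (2 * (x * y)) <= p * q * (x * y * e2) * c ^+ 2.
  by rewrite ler_wpM2l // mulr_ge0 // mulr_ge0 // mulr_ge0.
have K3 : p * q * (x ^+ 2 * e3) * y ^+ 2 <= p * q * (x ^+ 2 * e3) * c ^+ 2.
  by rewrite ler_wpM2l // mulr_ge0 // mulr_ge0 ?sqr_ge0.
move: G1 G2 G3 K1 K2 K3; rewrite !expr2.
by lra.
Qed.

End Cnt.

(** * Weighted stars in a digraph *)

Section Digraph.
Variables (R : realFieldType) (V : finType) (arc : rel V).

Implicit Types (S Z : {set V}) (u v x y z : V).

(* A star uses an arc [xy] only when [yx] is not an arc, but every arc makes two
   vertices adjacent; hence [Out] and [In] versus [nbr]. *)
Definition outarc x y := arc x y && ~~ arc y x.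
Definition nbr x : {set V} := [set y | arc x y || arc y x].
Definition Out (S : {set V}) v : {set V} := [set x in S | outarc v x].
Definition In (S : {set V}) v : {set V} := [set x in S | outarc x v].

Lemma nbrC x y : (x \in nbr y) = (y \in nbr x).
Proof. by rewrite !inE orbC. Qed.

Lemma Out_nbr S v : Out S v \subset nbr v.
Proof. by apply/subsetP=> x; rewrite !inE => /andP[_ /andP[-> _]]. Qed.

Lemma In_nbr S v : In S v \subset nbr v.
Proof. by apply/subsetP=> x; rewrite !inE => /andP[_ /andP[-> _]]; rewrite orbT. Qed.

Lemma Out_sub S v : Out S v \subset S.
Proof. by apply/subsetP=> x; rewrite inE => /andP[]. Qed.

Lemma In_sub S v : In S v \subset S.
Proof. by apply/subsetP=> x; rewrite inE => /andP[]. Qed.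

Lemma Out_In S u v : u \in S -> v \in S -> (u \in Out S v) = (v \in In S u).
Proof. by rewrite !inE => -> ->. Qed.

Lemma disj_Out_In S v : [disjoint Out S v & In S v].
Proof.
rewrite -setI_eq0; apply/eqP/setP=> x; rewrite !inE /outarc.
by case: (arc v x); case: (arc x v); rewrite ?andbF.
Qed.

Variables (w : R) (k l : nat).
Hypothesis w0 : 0 <= w.

Notation ms := (ms w).
Notation cnt := (cnt w nbr).

Definition ctr S v := cnt k l (Out S v) (In S v).
Definition tot S := \sum_(v in S) w * ctr S v.
(* The weight of the stars, as tuples, in which [v] is a leaf. *)
Definition leaf S v :=
  \sum_(u in In S v) w * (k%:R * cnt k.-1 l (Out S u :\: nbr v) (In S u :\: nbr v))
  + \sum_(u in Out S v) w * (l%:R * cnt k l.-1 (Out S u :\: nbr v) (In S u :\: nbr v)).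

Lemma OutD S u Z : Out S u :\: Z = Out (S :\: Z) u.
Proof. by apply/setP=> x; rewrite !inE andbA. Qed.

Lemma InD S u Z : In S u :\: Z = In (S :\: Z) u.
Proof. by apply/setP=> x; rewrite !inE andbA. Qed.

(** Apply [cnt_hit] with [Z = [set v]] at every centre other than [v]; exchanging sums bounds the
    tuples that hit [v] by [w * leaf S v]. *)
Lemma tot_del S v : v \in S -> tot S <= tot (S :\ v) + w * (ctr S v + leaf S v).
Proof.
move=> vS; rewrite /tot (big_setD1 _ vS) /= mulrDr addrCA lerD2l.
pose c1 u := cnt k.-1 l (Out S u :\: nbr v) (In S u :\: nbr v).
pose c2 u := cnt k l.-1 (Out S u :\: nbr v) (In S u :\: nbr v).
pose g (r : V -> {set V}) n (c : V -> R) u :=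
  if v \in r u then w * (w * (n%:R * c u)) else 0.
have g0 r n (c : V -> R) u : (forall u, 0 <= c u) -> 0 <= g r n c u.
  by move=> c0; rewrite /g; case: ifP => // _; rewrite !mulr_ge0.
have single (X : {set V}) (F : V -> R) :
    \sum_(z in X :&: [set v]) w * F z = if v \in X then w * F v else 0.
  case: ifP => vX; last first.
    by rewrite big1 // => z; rewrite !inE => /andP[zX /eqP zv]; rewrite -zv zX in vX.
  rewrite (_ : X :&: [set v] = [set v]) ?big_set1 //.
  by apply/setP=> z; rewrite !inE; case: eqP => [->|]; rewrite ?vX ?andbF.
have gsum (r r' : V -> {set V}) n (c : V -> R) : (forall u, 0 <= c u) ->
    (forall u, u \in S -> (v \in r u) = (u \in r' v)) -> r' v \subset S ->
    \sum_(u in S :\ v) g r n c u <= w * (\sum_(u in r' v) w * (n%:R * c u)).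
  move=> c0 rr' r'S; apply: (@le_trans _ _ (\sum_(u in S) g r n c u)).
    by rewrite [leRHS](big_setD1 _ vS) lerDr g0.
  have -> : \sum_(u in S) g r n c u =
      \sum_(u in S | v \in r u) w * (w * (n%:R * c u)) by rewrite big_mkcondr.
  rewrite mulr_sumr le_eqVlt; apply/orP; left; apply/eqP.
  apply: eq_bigl => u; case: (boolP (u \in S)) => [uS|uS]; first by rewrite rr'.
  by apply/esym/negbTE; apply: contra uS => /(subsetP r'S).
apply: (@le_trans _ _ (\sum_(u in S :\ v) (w * ctr (S :\ v) u
    + g (Out S) k c1 u + g (In S) l c2 u))).
  apply: ler_sum => u uS.
  have := cnt_hit w0 nbrC k l (Out S u) (In S u) [set v].
  rewrite !single OutD InD => /(ler_wpM2l w0) H; apply: (le_trans H).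
  rewrite !mulrDr /g -!addrA lerD2l /c1 /c2.
  by apply: lerD; case: ifP => _; rewrite ?mulr0 // (mulrCA _ w).
rewrite !big_split /= -addrA lerD2l /leaf mulrDr; apply: lerD.
  apply: gsum; [by move=> u; apply: cnt_ge0| |exact: In_sub].
  by move=> u uS; rewrite Out_In.
apply: gsum; [by move=> u; apply: cnt_ge0| |exact: Out_sub].
by move=> u uS; rewrite -Out_In.
Qed.

End Digraph.

(** * Degrees are close to 0 or 1 *)

Section Structure.
Variables (R : realFieldType) (V : finType) (arc : rel V).
Variables (w : R) (k l : nat) (S : {set V}).
Hypotheses (w0 : 0 <= w) (S1 : ms w S = 1).
Hypotheses (l1 : (0 < l)%N) (lk : (l <= k)%N) (s6 : (6 <= k + l)%N).
Implicit Types (X Y Z : {set V}) (u v x y z : V).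

Notation s := (k + l)%N.
Notation h := (star_max R k l).
Notation K := (leaf_bound R k l).
Notation ms := (ms w).
Notation nb := (nbr arc).
Notation cnt := (cnt w nb).
Notation ctr := (ctr arc w k l S).
Notation leaf := (leaf arc w k l S).

(** Only these pure neighbours supply leaves; [deg] also counts two-way arcs, since they too forbid
    two vertices from being leaves of the same star. *)
Definition nbp v := Out arc S v :|: In arc S v.
Definition deg v := ms (S :&: nb v).

Let k1 : (0 < k)%N. Proof. exact: leq_trans lk. Qed.
Let h0 : 0 < h. Proof. exact: star_max_gt0. Qed.
Let K0 : 0 <= K. Proof. exact: leaf_bound_ge0. Qed.

Lemma nbp_nbr v : nbp v \subset S :&: nb v.
Proof. by rewrite subUset !subsetI Out_sub In_sub Out_nbr In_nbr. Qed.

Lemma deg_ge0 v : 0 <= deg v. Proof. exact: ms_ge0. Qed.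
Lemma nbp_deg v : ms (nbp v) <= deg v.
Proof. exact/ms_le/nbp_nbr. Qed.

Lemma ms_codeg v : ms (S :\: nb v) = 1 - deg v.
Proof. by rewrite -S1 (msID w S (nb v)) addrAC subrr add0r. Qed.

Lemma deg_le1 v : deg v <= 1.
Proof. by rewrite -S1 ms_le // subsetIl. Qed.

Lemma ms_D_codeg X v : X \subset S -> ms (X :\: nb v) <= 1 - deg v.
Proof. by move=> XS; rewrite -ms_codeg ms_le // setSD. Qed.

Lemma cnt_le_h X Y : [disjoint X & Y] -> cnt k l X Y <= h * ms (X :|: Y) ^+ s.
Proof.
move=> XY; rewrite (msU w XY).
by apply: (le_trans (cnt_le nb w0 _ _ _ _)); apply: star_max_le; apply: ms_ge0.
Qed.

Lemma ctr_le v : ctr v <= h * deg v ^+ s.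
Proof.
apply: (le_trans (cnt_le_h (disj_Out_In _ _ _))).
rewrite ler_wpM2l ?(ltW h0) //; apply: lerXn2r; rewrite ?nnegrE ?ms_ge0 //.
exact: nbp_deg.
Qed.

Lemma cnt_out_le_K X Y : [disjoint X & Y] ->
  k%:R * cnt k.-1 l X Y <= K * ms (X :|: Y) ^+ s.-1.
Proof.
move=> XY; rewrite (msU w XY).
apply: le_trans (leaf_bound_out l k1 (ms_ge0 w0 X) (ms_ge0 w0 Y)).
by rewrite ler_wpM2l ?ler0n // cnt_le.
Qed.

Lemma cnt_in_le_K X Y : [disjoint X & Y] ->
  l%:R * cnt k l.-1 X Y <= K * ms (X :|: Y) ^+ s.-1.
Proof.
move=> XY; rewrite (msU w XY).
apply: le_trans (leaf_bound_in k l1 (ms_ge0 w0 X) (ms_ge0 w0 Y)).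
by rewrite ler_wpM2l ?ler0n // cnt_le.
Qed.

Lemma disjD X Y Z : [disjoint X & Y] -> [disjoint X :\: Z & Y :\: Z].
Proof.
by apply: disjointWl (subsetDl _ _) _ || idtac; move=> XY;
  apply: disjointWl (subsetDl _ _) (disjointWr (subsetDl _ _) XY).
Qed.

Lemma big_setU_disj (F : V -> R) X Y : [disjoint X & Y] ->
  \sum_(x in X :|: Y) F x = \sum_(x in X) F x + \sum_(x in Y) F x.
Proof.
move=> XY; rewrite (big_setID Y) /= addrC setIC (setIidPl (subsetUr _ _)).
congr (_ + _); apply: eq_bigl => x; rewrite !inE.
case: (boolP (x \in X)) => [xX|]; last by case: (x \in Y).
by rewrite (disjointFr XY xX).
Qed.

Lemma leaf_nbp v :
  leaf v <= \sum_(u in nbp v) w * (K * ms (nbp u :\: nb v) ^+ s.-1).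
Proof.
rewrite big_setU_disj ?disj_Out_In // addrC; apply: lerD; apply: ler_sum => u _;
  by rewrite ler_wpM2l // /nbp setDUl ?cnt_out_le_K ?cnt_in_le_K // disjD // disj_Out_In.
Qed.

(** In a star with leaf [v] and centre [u] the other leaves lie in [nbp u :\: nb v]. With [Z = A]
    this set is small because of [v] when [u] is in [A], and because of [u] otherwise. *)
Lemma leaf_split v Z B1 B2 :
  (forall u, u \in nbp v -> u \in Z -> ms (nbp u :\: nb v) <= B1) ->
  (forall u, u \in nbp v -> u \notin Z -> ms (nbp u :\: nb v) <= B2) ->
  leaf v <= K * (ms (nbp v :&: Z) * B1 ^+ s.-1 + ms (nbp v :\: Z) * B2 ^+ s.-1).
Proof.
move=> H1 H2; apply: (le_trans (leaf_nbp v)); rewrite (big_setID Z) /= mulrDr.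
have pw B u : ms (nbp u :\: nb v) <= B -> K * ms (nbp u :\: nb v) ^+ s.-1 <= K * B ^+ s.-1.
  move=> uB; rewrite ler_wpM2l //; apply: lerXn2r; rewrite ?nnegrE ?ms_ge0 //.
  exact: le_trans (ms_ge0 w0 _) uB.
apply: lerD; rewrite [leRHS]mulrCA; apply: ms_sum_le => // u.
  by rewrite inE => /andP[un uZ]; apply/pw/H1.
by rewrite inE => /andP[uZ un]; apply/pw/H2.
Qed.

Lemma leaf_le v B : (forall u, u \in nbp v -> ms (nbp u :\: nb v) <= B) ->
  leaf v <= K * (ms (nbp v) * B ^+ s.-1).
Proof.
move=> H; apply: (le_trans (@leaf_split v setT B B _ _)) => [u|u|]; try by move=> /H.
by rewrite setIT setDT (_ : ms set0 = 0) ?mul0r ?addr0 // msE cards0 mulr0.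
Qed.

Lemma cnt_hit_le X Y Z B : [disjoint X & Y] -> 0 <= B ->
  (forall z, z \in X :|: Y -> z \in Z -> ms ((X :|: Y) :\: nb z) <= B) ->
  cnt k l X Y <= cnt k l (X :\: Z) (Y :\: Z)
    + K * (ms ((X :|: Y) :&: Z) * B ^+ s.-1).
Proof.
move=> XY B0 H; apply: (le_trans (cnt_hit w0 (nbrC arc) k l X Y Z)).
rewrite setIUl msU; last first.
  by apply: disjointWl (subsetIl _ _) (disjointWr (subsetIl _ _) XY).
have pw z : z \in X :|: Y -> z \in Z ->
    K * ms ((X :|: Y) :\: nb z) ^+ s.-1 <= K * B ^+ s.-1.
  by move=> zn zZ; rewrite ler_wpM2l //; apply: lerXn2r; rewrite ?nnegrE ?ms_ge0 // H.
rewrite -addrA lerD2l mulrDl mulrDr; apply: lerD.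
  rewrite mulr_sumr [leRHS]mulrCA.
  under eq_bigr do rewrite mulrCA.
  apply: ms_sum_le => // z; rewrite inE => /andP[zX zZ].
  apply: le_trans (pw z _ zZ); last by rewrite inE zX.
  by rewrite setDUl cnt_out_le_K // disjD.
rewrite mulr_sumr [leRHS]mulrCA.
under eq_bigr do rewrite mulrCA.
apply: ms_sum_le => // z; rewrite inE => /andP[zX zZ].
apply: le_trans (pw z _ zZ); last by rewrite inE zX orbT.
by rewrite setDUl cnt_in_le_K // disjD.
Qed.

End Structure.

(** * The gap between large and small degrees *)

Section Closeness.
Variables (R : realFieldType) (V : finType) (arc : rel V).
Variables (w : R) (k l : nat) (S : {set V}).
Hypotheses (w0 : 0 <= w) (S1 : ms w S = 1).
Hypotheses (l1 : (0 < l)%N) (lk : (l <= k)%N) (s6 : (6 <= k + l)%N).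
Implicit Types (X Y Z : {set V}) (u v x y z : V).

Notation s := (k + l)%N.
Notation h := (star_max R k l).
Notation K := (leaf_bound R k l).
Notation b := (mean_max R s).
Notation a := (cutoff R s).
Notation ms := (ms w).
Notation nb := (nbr arc).
Notation cnt := (cnt w nb).
Notation ctr := (ctr arc w k l S).
Notation leaf := (leaf arc w k l S).
Notation Out := (Out arc S).
Notation In := (In arc S).
Notation nbp := (nbp arc S).
Notation deg := (deg arc w S).

Hypothesis f_ge : forall v, v \in S -> 999 / 1000 * b * h <= ctr v + leaf v.
Hypothesis T_ge : b * h <= s.+1%:R * tot arc w k l S.

Definition bigdeg := [set v in S | 8 / 10 <= deg v].
Notation A := bigdeg.
Definition smalldeg := S :\: bigdeg.
Notation W := smalldeg.

Let k1 : (0 < k)%N. Proof. exact: leq_trans lk. Qed.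
Let h0 : 0 < h. Proof. exact: star_max_gt0. Qed.
Let K0 : 0 <= K. Proof. exact: leaf_bound_ge0. Qed.

Let b0 : 4 / 11 <= b. Proof. by apply: mean_max_ge; apply: leq_trans s6. Qed.
Let a0 : 0 <= a. Proof. exact: cutoff_ge0. Qed.
Let a1 : a <= 11 / 70. Proof. exact: cutoff_le. Qed.

Let Kpow (c x y : R) : 0 <= c -> 0 <= x -> x <= y -> y <= 6 / 7 ->
  K * (c * x ^+ s.-1) <= h * (33 / 2 * c * y ^+ 5).
Proof. exact: leaf_bound_pow. Qed.

Let pterm (x y d : R) : x <= y -> 0 <= d -> 33 / 2 * x * d ^+ 5 <= 33 / 2 * y * d ^+ 5.
Proof. by move=> xy d0; apply: ler_wpM2r; [rewrite exprn_ge0|lra]. Qed.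

Let hterm (x y d : R) : x <= y -> 0 <= d ->
  h * (33 / 2 * x * d ^+ 5) <= h * (33 / 2 * y * d ^+ 5).
Proof. by move=> xy d0; rewrite ler_wpM2l ?(ltW h0) // pterm. Qed.

Let e70 : 0 <= 11 / 70 :> R. Proof. by lra. Qed.
Let e36 : 0 <= 36 / 100 :> R. Proof. by lra. Qed.

Let hpow (x y : R) : 0 <= x -> x <= y -> y <= 1 -> h * x ^+ s <= h * y ^+ 6.
Proof. exact: star_max_pow. Qed.

Let nbpS v : nbp v \subset S.
Proof. by apply: subset_trans (nbp_nbr _ _ _) (subsetIl _ _). Qed.

Lemma leaf_deg v : leaf v <= K * (deg v * (1 - deg v) ^+ s.-1).
Proof.
apply: (le_trans (@leaf_le _ _ _ _ _ _ _ w0 l1 lk v (1 - deg v) _)) => [u _|].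
  exact: ms_D_codeg.
rewrite ler_wpM2l // ler_wpM2r ?nbp_deg //.
by rewrite exprn_ge0 // subr_ge0 deg_le1.
Qed.

(* A vertex of degree [d] is the centre of at most [h d^s] and a leaf of at most
   [K d (1 - d)^(s-1)] stars, which is too little on a middle range of [d]. *)
Let excl v (lo hi : R) : v \in S -> lo <= deg v -> deg v <= hi -> 1 / 7 <= lo -> hi <= 1 ->
  hi ^+ 6 + 33 / 2 * hi * (1 - lo) ^+ 5 < 999 / 1000 * (4 / 11) -> False.
Proof.
move=> vS vlo vhi lo1 hi1 H.
have d0 := deg_ge0 arc S w0 v.
have := f_ge vS; have := ctr_le arc S w0 l1 lk v; have := leaf_deg v.
have := hpow d0 vhi hi1.
have := @Kpow (deg v) (1 - deg v) (1 - lo) d0 ltac:(lra) ltac:(lra) ltac:(lra).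
have : h * (33 / 2 * deg v * (1 - lo) ^+ 5) <= h * (33 / 2 * hi * (1 - lo) ^+ 5).
  by apply: hterm => //; lra.
have : h * (hi ^+ 6 + 33 / 2 * hi * (1 - lo) ^+ 5) < h * (999 / 1000 * (4 / 11)).
  by rewrite ltr_pM2l.
have : h * (4 / 11) <= h * b by rewrite ler_wpM2l ?(ltW h0).
rewrite mulrDr; lra.
Qed.

Lemma deg_small v : v \in W -> deg v <= 47 / 100.
Proof.
rewrite !inE => /andP[+ vS]; rewrite vS /= -ltNge => d8.
case: (lerP (deg v) (47 / 100)) => // d1; exfalso.
(* [excl] takes the power in the centre bound at the upper end and that in the leaf bound at the
   lower end, so the range is cut into four short intervals. *)
case: (lerP (deg v) (50 / 100)) => d2.
  by apply: (excl vS (ltW d1) d2); lra.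
case: (lerP (deg v) (55 / 100)) => d3.
  by apply: (excl vS (ltW d2) d3); lra.
case: (lerP (deg v) (65 / 100)) => d4.
  by apply: (excl vS (ltW d3) d4); lra.
by apply: (excl vS (ltW d4) (ltW d8)); lra.
Qed.

(** Below degree [1 - cutoff] the centre term drops to [10 / 11] of [b * h] by [cutoff_bb], and the
    leaf term, of order [(2 / 10)^5], cannot fill the gap. *)
Lemma codeg_big u : u \in A -> 1 - deg u <= a.
Proof.
rewrite inE => /andP[uS d8].
case: (lerP (1 - deg u) a) => // H; exfalso.
have d0 := deg_ge0 arc S w0 u.
have := f_ge uS; have := ctr_le arc S w0 l1 lk u; have := leaf_deg u.
have d1 := deg_le1 arc w0 S1 u.
have := @Kpow (deg u) (1 - deg u) (2 / 10) d0 ltac:(lra) ltac:(lra) ltac:(lra).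
have : deg u ^+ s <= 10 / 11 * b.
  apply: le_trans (cutoff_bb _ s6); apply: lerXn2r; rewrite ?nnegrE //; lra.
move=> /(ler_wpM2l (ltW h0)).
have : h * (4 / 11) <= h * b by rewrite ler_wpM2l ?(ltW h0).
have : h * (33 / 2 * deg u * (2 / 10) ^+ 5) <= h * (33 / 2 * 1 * (2 / 10) ^+ 5).
  rewrite ler_wpM2l ?(ltW h0) // ler_wpM2r ?exprn_ge0; lra.
by move: h0; lra.
Qed.

Lemma ms_A_W : ms A + ms W = 1.
Proof.
rewrite -S1 (msID w S A); congr (ms _ + _).
by apply/esym/setIidPr/subsetP=> x; rewrite inE => /andP[].
Qed.

Lemma nbp_D_A v : nbp v :\: A \subset W :&: nb v.
Proof.
apply/subsetP=> x; rewrite in_setD => /andP[xA /(subsetP (nbp_nbr _ _ _))].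
by case/setIP=> xS xn; rewrite in_setI in_setD xA xS.
Qed.

(* Leaves in [A] are rare, because their non-neighbourhoods are small. *)
Lemma cnt_hit_A v : ctr v <=
  cnt k l (Out v :\: A) (In v :\: A) + K * (ms (nbp v :&: A) * a ^+ s.-1).
Proof.
apply: cnt_hit_le => // [|z zn zA]; first exact: disj_Out_In.
apply: le_trans (codeg_big zA); apply: ms_D_codeg => //.
exact: nbpS.
Qed.

Lemma cnt_D_A v : cnt k l (Out v :\: A) (In v :\: A) <= h * ms (nbp v :\: A) ^+ s.
Proof.
apply: (le_trans (cnt_le_h arc k l w0 _)).
  by apply: disjD; apply: disj_Out_In.
by rewrite -setDUl.
Qed.

Let KA c : 0 <= c -> c <= 1 -> K * (c * a ^+ s.-1) <= h * (33 / 2 * c * (11 / 70) ^+ 5).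
Proof. by move=> c0 c1; apply: Kpow => //; lra. Qed.

Lemma A_neq0 : exists u, u \in A.
Proof.
apply/set0Pn/eqP=> A0.
have WS : W = S by rewrite /smalldeg A0 setD0.
have : tot arc w k l S <= 1 * (h * (47 / 100) ^+ s).
  rewrite -[X in _ <= X * _]S1; apply: ms_sum_le => // v vS; apply: (le_trans (ctr_le arc S w0 l1 lk v)).
  rewrite ler_wpM2l ?(ltW h0) //; apply: lerXn2r; rewrite ?nnegrE ?deg_ge0 //; first by lra.
  by apply: deg_small; rewrite WS.
move=> /(ler_wpM2l (ler0n R s.+1)) H.
have := npow_le s6 (_ : 0 <= 47 / 100 :> R) ltac:(lra) => /(_ ltac:(lra)) H1.
have H2 := pow_le6 s6 (_ : 0 <= 47 / 100 :> R) ltac:(lra).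
have {}H2 := H2 ltac:(lra).
have e : (47 / 100) ^+ s = (47 / 100) * (47 / 100) ^+ s.-1 :> R.
  by rewrite -exprS prednK // (leq_trans _ s6).
have : s.+1%:R * (47 / 100) ^+ s <= 36 / 100 :> R.
  rewrite -natr1 mulrDl {1}e mulrCA; lra.
move=> /(ler_wpM2l (ltW h0)); have := T_ge; have : h * (4 / 11) <= h * b by rewrite ler_wpM2l ?(ltW h0).
move: H h0; rewrite mul1r; set t := _ ^+ s; lra.
Qed.

(** Otherwise [W] weighs less than [1 - cutoff]. Nearly all stars centred at a vertex of [A] have
    their leaves in [W], so by [cutoff_bb] this vertex lies in too few stars. *)
Lemma ms_A_le : ms A <= a.
Proof.
have [u uA] := A_neq0; have uS : u \in S by move: uA; rewrite inE => /andP[].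
case: (lerP (ms A) a) => // H; exfalso.
have n0 : 0 <= ms (nbp u :&: A) by apply: ms_ge0.
have n1 : ms (nbp u :&: A) <= 1.
  by rewrite -S1 ms_le // (subset_trans (subsetIl _ _)).
have m0 : 0 <= ms (nbp u) by apply: ms_ge0.
have m1 : ms (nbp u) <= 1 by rewrite -S1 ms_le.
have H1 := cnt_hit_A u; have H2 := cnt_D_A u; have H3 := KA n0 n1.
have H4 : leaf u <= K * (ms (nbp u) * a ^+ s.-1).
  apply: leaf_le => // v vn; apply: (@le_trans _ _ (1 - deg u)); last exact: codeg_big.
  exact: ms_D_codeg.
have H5 := KA m0 m1.
have H6 : ms (nbp u :\: A) ^+ s <= 10 / 11 * b.
  apply: le_trans (cutoff_bb _ s6); apply: lerXn2r; rewrite ?nnegrE ?ms_ge0 //.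
    by move: a1; lra.
  apply: (@le_trans _ _ (ms W)); last by have := ms_A_W; lra.
  by apply: ms_le => //; apply: subset_trans (nbp_D_A u) (subsetIl _ _).
have H7 := f_ge uS.
have : h * (4 / 11) <= h * b by rewrite ler_wpM2l ?(ltW h0).
have : h * (33 / 2 * ms (nbp u) * (11 / 70) ^+ 5) <= h * (33 / 2 * 1 * (11 / 70) ^+ 5).
  exact: hterm.
have : h * (33 / 2 * ms (nbp u :&: A) * (11 / 70) ^+ 5) <= h * (33 / 2 * 1 * (11 / 70) ^+ 5).
  exact: hterm.
move: H6 => /(ler_wpM2l (ltW h0)).
by move: h0; lra.
Qed.

Lemma ms_D_A v : ms (nbp v :&: A) <= a.
Proof. by apply: le_trans ms_A_le; rewrite ms_le // subsetIr. Qed.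

(** Bootstrapping: a star with leaf [z] has its centre in [A], which weighs at most [cutoff], or in
    [W], where the centre has degree at most [D]. If [deg z] exceeds [D'], then both kinds and the
    stars centred at [z] are too few. *)
Let deg_step D D' : (forall z, z \in W -> deg z <= D) -> 1 / 7 <= D' -> D' <= D -> D <= 1 / 2 ->
  33 / 2 * (11 / 70) * (1 - D') ^+ 5 + (33 / 2 + 1) * D ^+ 6 < 999 / 1000 * (4 / 11) ->
  forall z, z \in W -> deg z <= D'.
Proof.
move=> HD D'0 D'D D1 H z zW.
have [E0 E1 D0 D2] : [/\ 0 <= 1 - D', 1 - D' <= 6 / 7, 0 <= D & D <= 6 / 7] by split; lra.
have zS : z \in S by move: zW; rewrite inE => /andP[].
case: (lerP (deg z) D') => // dz; exfalso.
have d0 := deg_ge0 arc S w0 z; have dD := HD _ zW.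
have H1 := ctr_le arc S w0 l1 lk z; have H2 := hpow d0 dD ltac:(lra).
have H3 : leaf z <= K * (ms (nbp z :&: A) * (1 - D') ^+ s.-1 + ms (nbp z :\: A) * D ^+ s.-1).
  apply: leaf_split => // u un uA.
    by apply: (@le_trans _ _ (1 - deg z)); [apply: ms_D_codeg|lra].
  apply: (@le_trans _ _ (deg u)); first by apply: le_trans (nbp_deg arc S w0 u); rewrite ms_le ?subsetDl.
  by apply: HD; rewrite in_setD uA (subsetP (nbpS z)).
have n0 : 0 <= ms (nbp z :&: A) by apply: ms_ge0.
have n1 := ms_D_A z; have m0 : 0 <= ms (nbp z :\: A) by apply: ms_ge0.
have m1 : ms (nbp z :\: A) <= D.
  by apply: le_trans dD; apply: le_trans (nbp_deg arc S w0 z); rewrite ms_le ?subsetDl.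
have H4 := @Kpow (ms (nbp z :&: A)) (1 - D') (1 - D') n0 E0 (lexx _) E1.
have H5 := @Kpow (ms (nbp z :\: A)) D D m0 D0 (lexx _) D2.
have H6 : 33 / 2 * ms (nbp z :&: A) * (1 - D') ^+ 5 <= 33 / 2 * (11 / 70) * (1 - D') ^+ 5.
  by apply: pterm E0; apply: le_trans n1 a1.
have H7 : 33 / 2 * ms (nbp z :\: A) * D ^+ 5 <= 33 / 2 * D ^+ 6.
  have -> : 33 / 2 * D ^+ 6 = 33 / 2 * D * D ^+ 5 by ring.
  exact: pterm.
move: H3; rewrite mulrDr => H3.
have H8 := f_ge zS.
have : h * (4 / 11) <= h * b by rewrite ler_wpM2l ?(ltW h0).
move: H; rewrite -(ltr_pM2l h0).
move: H6 => /(ler_wpM2l (ltW h0)); move: H7 => /(ler_wpM2l (ltW h0)).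
by lra.
Qed.

Lemma deg_W z : z \in W -> deg z <= 36 / 100.
Proof.
have H43 x : x \in W -> deg x <= 43 / 100 by apply: (deg_step deg_small); lra.
have H39 x : x \in W -> deg x <= 39 / 100 by apply: (deg_step H43); lra.
by apply: (deg_step H39); lra.
Qed.

Lemma W_sub z : z \in W -> z \in S.
Proof. by rewrite in_setD => /andP[]. Qed.

Lemma A_sub u : u \in A -> u \in S.
Proof. by rewrite inE => /andP[]. Qed.

Lemma deg_split z : deg z = ms (S :&: nb z :&: A) + ms (W :&: nb z).
Proof.
rewrite /deg (msID w (S :&: nb z) A); congr (_ + ms _).
by apply/setP=> x; rewrite !in_setD !in_setI in_setD andbA.
Qed.

Let D36 : 36 / 100 <= 1 :> R. Proof. by lra. Qed.

(** The neighbours of [z] in [A] and its non-neighbours together weigh [1 - r], so [leaf_bound_one]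
    turns the stars centred in [A] into [h * (1 - r)^s]. Centres in [W] have degree at most
    [36 / 100]. *)
Lemma leaf_rW z : z \in W ->
  leaf z <= h * (1 - ms (W :&: nb z)) ^+ s + K * (ms (W :&: nb z) * (36 / 100) ^+ s.-1).
Proof.
move=> zW; set r := ms (W :&: nb z).
have r0 : 0 <= r by apply: ms_ge0.
have H : leaf z <= K * (ms (nbp z :&: A) * (1 - deg z) ^+ s.-1
     + ms (nbp z :\: A) * (36 / 100) ^+ s.-1).
  apply: leaf_split => // u un uA; first exact: ms_D_codeg.
  apply: (@le_trans _ _ (deg u)).
    by apply: le_trans (nbp_deg arc S w0 u); rewrite ms_le ?subsetDl.
  by apply: (deg_W); rewrite in_setD uA (subsetP (nbpS z)).
set dA := ms (S :&: nb z :&: A).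
have dA0 : 0 <= dA by apply: ms_ge0.
have dz : deg z = dA + r by exact: deg_split.
have d1 := deg_le1 arc w0 S1 z.
have H1 : ms (nbp z :&: A) <= dA by apply: ms_le => //; apply: setSI; apply: nbp_nbr.
have H2 : ms (nbp z :\: A) <= r by apply: ms_le => //; apply: nbp_D_A.
apply: (le_trans H); rewrite mulrDr; apply: lerD; last first.
  by rewrite ler_wpM2l // ler_wpM2r // exprn_ge0 //; lra.
have y0 : 0 <= 1 - deg z by lra.
apply: (@le_trans _ _ (K * (dA * (1 - deg z) ^+ s.-1))).
  by rewrite ler_wpM2l // ler_wpM2r // exprn_ge0.
have := leaf_bound_one (leq_trans (isT : 0 < 6)%N s6) dA0 y0.
by have -> : dA + (1 - deg z) = 1 - r by rewrite dz; ring.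
Qed.

Lemma rW_le z : z \in W -> ms (W :&: nb z) <= a.
Proof.
move=> zW; have zS := W_sub zW; have H := leaf_rW zW; have H0 := f_ge zS.
set r := ms (W :&: nb z) in H *.
have r0 : 0 <= r by apply: ms_ge0.
have d36 := deg_W zW.
have rd : r <= 36 / 100.
  by apply: le_trans d36; rewrite deg_split lerDr ms_ge0.
have H1 := ctr_le arc S w0 l1 lk z; have H2 := hpow (deg_ge0 arc S w0 z) d36 D36.
have H3 := @Kpow r (36 / 100) (36 / 100) r0 e36 (lexx _) ltac:(lra).
have hb : h * (4 / 11) <= h * b by rewrite ler_wpM2l ?(ltW h0).
case: (lerP r a) => // ra; exfalso.
case: (lerP r (1 / 4)) => r4.
  have H4 : (1 - r) ^+ s <= 10 / 11 * b.
    apply: le_trans (cutoff_bb _ s6); apply: lerXn2r; rewrite ?nnegrE ?lerD2l ?lerN2 ?ltW //.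
    - by rewrite subr_gt0; apply: le_lt_trans rd _; lra.
    by rewrite subr_gt0; apply: le_lt_trans a1 _; lra.
  have : h * (33 / 2 * r * (36 / 100) ^+ 5) <= h * (33 / 2 * (1 / 4) * (36 / 100) ^+ 5).
    exact: hterm.
  by move: H4 => /(ler_wpM2l (ltW h0)); move: h0; lra.
have : h * (33 / 2 * r * (36 / 100) ^+ 5) <= h * (33 / 2 * (36 / 100) * (36 / 100) ^+ 5).
  exact: hterm.
have := @hpow (1 - r) (3 / 4) ltac:(lra) ltac:(lra) ltac:(lra).
by move: h0; lra.
Qed.

Lemma deg_W_aa z : z \in W -> deg z <= 2 * a.
Proof.
move=> zW; rewrite deg_split; have := rW_le zW.
have : ms (S :&: nb z :&: A) <= a.
  by apply: le_trans (ms_A_le); rewrite ms_le ?subsetIr.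
lra.
Qed.

Lemma ctr_A u : u \in A -> ctr u <= h * ms W ^+ s + K * a ^+ s.
Proof.
move=> uA; apply: (le_trans (cnt_hit_A u)); apply: lerD.
  apply: (le_trans (cnt_D_A _)); rewrite ler_wpM2l ?(ltW h0) //.
  apply: msX_le => //; apply: subset_trans (nbp_D_A _) (subsetIl _ _).
have -> : a ^+ s = a * a ^+ s.-1 by rewrite -exprS prednK // (leq_trans _ s6).
rewrite ler_wpM2l // ler_wpM2r ?exprn_ge0 //.
exact: ms_D_A.
Qed.

Lemma ctr_W z : z \in W -> ctr z <= (h + K) * a ^+ s.
Proof.
move=> zW; apply: (le_trans (cnt_hit_A z)); rewrite mulrDl.
apply: lerD.
  apply: (le_trans (cnt_D_A _)); rewrite ler_wpM2l ?(ltW h0) //.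
  apply: lerXn2r; rewrite ?nnegrE ?ms_ge0 //.
  by apply: le_trans (rW_le zW); apply: ms_le => //; apply: nbp_D_A.
have -> : a ^+ s = a * a ^+ s.-1 by rewrite -exprS prednK // (leq_trans _ s6).
rewrite ler_wpM2l // ler_wpM2r ?exprn_ge0 //.
exact: ms_D_A.
Qed.

Lemma tot_le_crude : tot arc w k l S <= h * (ms A * ms W ^+ s) + (h + K) * a ^+ s.
Proof.
rewrite /tot (big_setID A) /=.
have -> : S :&: A = A by apply/setIidPr/subsetP=> u /A_sub.
have HA : \sum_(u in A) w * ctr u <= ms A * (h * ms W ^+ s + K * a ^+ s).
  by apply: ms_sum_le => // u uA; apply: ctr_A.
have HW : \sum_(z in W) w * ctr z <= ms W * ((h + K) * a ^+ s).
  by apply: ms_sum_le => // z zW; apply: ctr_W.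
apply: (le_trans (lerD HA HW)).
have A0 := ms_ge0 w0 A; have W0 := ms_ge0 w0 W; have AW := ms_A_W.
have as0 : 0 <= a ^+ s by rewrite exprn_ge0.
have e : ms W = 1 - ms A by lra.
have : 0 <= ms A * (h * a ^+ s) by apply: mulr_ge0 => //; apply: mulr_ge0 => //; apply: ltW.
rewrite e -subr_ge0 => H.
rewrite -subr_ge0; set p := (1 - ms A) ^+ s.
suff -> : h * (ms A * p) + (h + K) * a ^+ s -
   (ms A * (h * p + K * a ^+ s) + (1 - ms A) * ((h + K) * a ^+ s)) = ms A * (h * a ^+ s).
  by move: H; rewrite subr0.
by ring.
Qed.

(** With [x = (s + 1) * ms A], the crude bound on [(s + 1) * tot] is [h * b * 4 x / (1 + x)^2] plus
    a tiny error, and the factor is below [97 / 100] for [x <= 7 / 10], contradicting [T_ge]. *)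
Lemma ms_A_ge : 7 / 10 <= ms A * s.+1%:R.
Proof.
set x := ms A * _; case: (lerP (7 / 10) x) => // x7; exfalso.
have x0 : 0 <= x by rewrite mulr_ge0 ?ms_ge0.
have s1 : 0 < s.+1%:R :> R by rewrite ltr0n.
have := T_ge; have := tot_le_crude => /(ler_wpM2l (ltW s1)) H /le_trans/(_ H) {H}.
have e : ms W = 1 - x / s.+1%:R.
  by rewrite /x mulfK ?lt0r_neq0 // -(ms_A_W) addrAC subrr add0r.
have H := @mean_max_ratio R s x (leq_trans (isT : 0 < 6)%N s6) x0 ltac:(lra).
have -> : s.+1%:R * (h * (ms A * ms W ^+ s) + (h + K) * a ^+ s) =
   h * (x * (1 - x / s.+1%:R) ^+ s) + (s.+1%:R * a) * ((h + K) * a ^+ s.-1).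
  have -> : a ^+ s = a * a ^+ s.-1 by rewrite -exprS prednK // (leq_trans _ s6).
  by rewrite -e /x; ring.
rewrite cutoffE.
have Ha : (h + K) * a ^+ s.-1 <= h * ((33 / 2 + 1) * (11 / 70) ^+ 5).
  have := @Kpow 1 a (11 / 70) ler01 a0 a1 ltac:(lra); rewrite mul1r mulr1.
  have : h * a ^+ s.-1 <= h * (11 / 70) ^+ 5.
    rewrite ler_wpM2l ?(ltW h0) //; apply: le_trans (pow_le5 s6 _ _); try lra.
    by apply: lerXn2r; rewrite ?nnegrE //; lra.
  by lra.
have q : 4 * x / (1 + x) ^+ 2 <= 97 / 100.
  rewrite ler_pdivrMr; last by rewrite exprn_gt0 //; lra.
  by rewrite -subr_ge0; nra.
have : h * (b * (4 * x / (1 + x) ^+ 2)) <= h * (b * (97 / 100)).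
  by rewrite ler_wpM2l ?(ltW h0) // ler_wpM2l //; move: b0; lra.
move: H => /(ler_wpM2l (ltW h0)).
have hb : h * (4 / 11) <= h * b by rewrite ler_wpM2l ?(ltW h0).
move=> H1 H2 H3; move: hb h0 Ha (le_trans H1 H2) H3.
set t1 := h * (x * _); set t2 := (h + K) * _; clearbody t1 t2.
by lra.
Qed.

(** [36 / 100] is what remains of [999 / 1000 * (4 / 11)] after removing the stars centred at [u]
    with a leaf in [A] and the stars in which [u] is a leaf. *)
Lemma P_ge u : u \in A ->
  36 / 100 * h <= ms (Out u :\: A) ^+ k * ms (In u :\: A) ^+ l.
Proof.
move=> uA; have uS := A_sub uA.
apply: le_trans (cnt_le nb w0 k l _ _).
have H1 := cnt_hit_A u.
have H2 : leaf u <= K * (1 * a ^+ s.-1).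
  apply: (@le_trans _ _ (K * (ms (nbp u) * a ^+ s.-1))).
    apply: leaf_le => // v vn.
    apply: (@le_trans _ _ (1 - deg u)); last exact: codeg_big uA.
    exact: ms_D_codeg.
  by rewrite ler_wpM2l // ler_wpM2r ?exprn_ge0 // -S1 ms_le.
have H3 : K * (ms (nbp u :&: A) * a ^+ s.-1) <= K * (1 * a ^+ s.-1).
  by rewrite ler_wpM2l // ler_wpM2r ?exprn_ge0 // -S1 ms_le // (subset_trans (subsetIl _ _)).
have H4 := @Kpow 1 a (11 / 70) ler01 a0 a1 ltac:(lra).
have H5 := f_ge uS.
have hb : h * (4 / 11) <= h * b by rewrite ler_wpM2l ?(ltW h0).
by move: h0; lra.
Qed.

End Closeness.

(** * Counting stars across the partition *)

Section Mix.
Variables (R : realFieldType) (V : finType) (w : R) (nb : V -> {set V}).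
Hypothesis w0 : 0 <= w.
Hypothesis nbC : forall x y, (x \in nb y) = (y \in nb x).
Implicit Types X Y Z : {set V}.
Notation ms := (ms w).
Notation cnt := (cnt w nb).

Lemma cnt_hit_pow k l X Y Z (B : R) : [disjoint X & Y] -> 0 <= B ->
  (forall z, z \in X :|: Y -> z \in Z -> ms ((X :|: Y) :\: nb z) <= B) ->
  cnt k l X Y <= cnt k l (X :\: Z) (Y :\: Z)
    + (k + l)%:R * (B ^+ (k + l).-1 * ms ((X :|: Y) :&: Z)).
Proof.
move=> XY B0 HB; apply: (le_trans (cnt_hit w0 nbC k l X Y Z)).
have BX z : z \in X -> z \in Z -> (ms (X :\: nb z) <= B) && (ms (Y :\: nb z) <= B).
  move=> zX zZ; have := HB z; rewrite inE zX => /(_ isT zZ) H.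
  by apply/andP; split; apply: le_trans H; rewrite ms_le // setSD ?subsetUl ?subsetUr.
have BY z : z \in Y -> z \in Z -> (ms (X :\: nb z) <= B) && (ms (Y :\: nb z) <= B).
  move=> zX zZ; have := HB z; rewrite inE zX orbT => /(_ isT zZ) H.
  by apply/andP; split; apply: le_trans H; rewrite ms_le // setSD ?subsetUl ?subsetUr.
rewrite setIUl msU; last first.
  by apply: disjointWl (subsetIl _ _) (disjointWr (subsetIl _ _) XY).
rewrite -addrA lerD2l natrD mulrDl; apply: lerD.
  case: k => [|k]; first by rewrite !mul0r.
  rewrite ler_wpM2l // addSn /= mulrDr -[leLHS]addr0; apply: lerD; last first.
    by rewrite mulr_ge0 ?exprn_ge0 ?ms_ge0.
  rewrite mulrC; apply: ms_sum_le => // z /setIP[zX zZ].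
  by have /andP[? ?] := BX z zX zZ; apply: cnt_le_pow.
case: l => [|l]; first by rewrite !mul0r.
rewrite ler_wpM2l // addnS /= mulrDr -[leLHS]add0r; apply: lerD.
  by rewrite mulr_ge0 ?exprn_ge0 ?ms_ge0.
rewrite mulrC; apply: ms_sum_le => // z /setIP[zY zZ].
by have /andP[? ?] := BY z zY zZ; apply: cnt_le_pow.
Qed.

(* A tuple with entries both in [A] and outside [A] contains a nonadjacent pair
   [u] in [A], [z] outside [A], and all its other entries avoid [nb u]. *)
Lemma cnt_mix k l X Y (A : {set V}) (B : R) : [disjoint X & Y] -> 0 <= B ->
  (forall u, u \in A -> ms ((X :|: Y) :\: nb u) <= B) ->
  cnt k.+1 l X Y <= cnt k.+1 l (X :&: A) (Y :&: A) + cnt k.+1 l (X :\: A) (Y :\: A)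
    + 2 * ((k + l)%:R * B ^+ (k + l).-1) *
      (\sum_(u in (X :|: Y) :&: A) w * ms (((X :|: Y) :\: A) :\: nb u)).
Proof.
move=> XY B0 HB; set N := X :|: Y; set D := (k + l)%:R * B ^+ _.
have D0 : 0 <= D by rewrite mulr_ge0 ?exprn_ge0.
have dj x : [disjoint X :\: nb x & Y :\: nb x] by apply: disjD.
have Nx x : (X :\: nb x) :|: (Y :\: nb x) = N :\: nb x by rewrite -setDUl.
have swapD (T U : {set V}) x : (T :\: nb x) :\: U = (T :\: U) :\: nb x.
  by rewrite !setDDl setUC.
have swapI (T U : {set V}) x : (T :\: nb x) :&: U = (T :&: U) :\: nb x.
  by apply/setP=> z; rewrite !inE andbA.
have DC (T U : {set V}) : T :\: ~: U = T :&: U by rewrite setDE setCK.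
have IC (T U : {set V}) : T :&: ~: U = T :\: U by rewrite -setDE.
rewrite /= (big_setID A) /=.
have H1 : \sum_(x in X :&: A) w * cnt k l (X :\: nb x) (Y :\: nb x) <=
    \sum_(x in X :&: A) w * cnt k l ((X :&: A) :\: nb x) ((Y :&: A) :\: nb x)
    + D * (\sum_(u in N :&: A) w * ms ((N :\: A) :\: nb u)).
  apply: (@le_trans _ _ (\sum_(x in X :&: A) (w * cnt k l ((X :&: A) :\: nb x) ((Y :&: A) :\: nb x)
     + D * (w * ms ((N :\: A) :\: nb x))))).
    apply: ler_sum => x /setIP[xX xA]; rewrite [D * _]mulrCA -mulrDr ler_wpM2l //.
    have HB' z : z \in (X :\: nb x) :|: (Y :\: nb x) -> z \in ~: A ->
        ms (((X :\: nb x) :|: (Y :\: nb x)) :\: nb z) <= B.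
      by move=> _ _; rewrite Nx; apply: le_trans (HB x xA); rewrite ms_le ?subsetDl.
    have := cnt_hit_pow k l (dj x) B0 HB'.
    by rewrite !DC IC Nx swapD !swapI mulrA.
  rewrite big_split /= lerD2l -mulr_sumr ler_wpM2l //.
  apply: sumw_mono => // [|u]; last exact: ms_ge0.
  by rewrite setSI // subsetUl.
have H2 : \sum_(x in X :\: A) w * cnt k l (X :\: nb x) (Y :\: nb x) <=
    \sum_(x in X :\: A) w * cnt k l ((X :\: A) :\: nb x) ((Y :\: A) :\: nb x)
    + D * (\sum_(u in N :&: A) w * ms ((N :\: A) :\: nb u)).
  have -> : \sum_(u in N :&: A) w * ms ((N :\: A) :\: nb u) =
     \sum_(x in N :\: A) w * ms ((N :&: A) :\: nb x).
    under eq_bigr do rewrite -ms_sum1.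
    under [RHS]eq_bigr do rewrite -ms_sum1.
    exact: sumw_exchange.
  apply: (@le_trans _ _ (\sum_(x in X :\: A) (w * cnt k l ((X :\: A) :\: nb x) ((Y :\: A) :\: nb x)
     + D * (w * ms ((N :&: A) :\: nb x))))).
    apply: ler_sum => x _; rewrite [D * _]mulrCA -mulrDr ler_wpM2l //.
    have HB' z : z \in (X :\: nb x) :|: (Y :\: nb x) -> z \in A ->
        ms (((X :\: nb x) :|: (Y :\: nb x)) :\: nb z) <= B.
      move=> _ zA; rewrite Nx; apply: le_trans (HB z zA); rewrite ms_le //.
      by rewrite setSD ?subsetDl.
    have := cnt_hit_pow k l (dj x) B0 HB'.
    by rewrite Nx !swapD swapI mulrA.
  rewrite big_split /= lerD2l -mulr_sumr ler_wpM2l //.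
  apply: sumw_mono => // [|u]; last exact: ms_ge0.
  by rewrite setSD // subsetUl.
apply: (le_trans (lerD H1 H2)); rewrite addrACA lerD2l.
by rewrite -/D -mulrDl mulr_natl mulr2n.
Qed.

End Mix.

Section Count.
Variables (R : realFieldType) (V : finType) (arc : rel V).
Variables (w : R) (k l : nat) (S A : {set V}).
Hypotheses (w0 : 0 <= w) (S1 : ms w S = 1).
Hypotheses (l1 : (0 < l)%N) (lk : (l <= k)%N) (s6 : (6 <= k + l)%N).
Implicit Types (X Y Z : {set V}) (u v x y z : V).

Notation s := (k + l)%N.
Notation a := (cutoff R s).
Notation ms := (ms w).
Notation nb := (nbr arc).
Notation cnt := (cnt w nb).
Notation ctr := (ctr arc w k l S).
Notation tot := (tot arc w k l S).
Notation Out := (Out arc S).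
Notation In := (In arc S).
Notation nbp := (nbp arc S).
Notation deg := (deg arc w S).
Notation ed := (ed w nb).
Notation W := (S :\: A).

Hypothesis AS : A \subset S.
Hypothesis HA : forall u, u \in A -> 1 - deg u <= a.
Hypothesis HW : forall z, z \in W -> ms (W :&: nb z) <= a.
Hypothesis HD : forall z, z \in W -> deg z <= 2 * a.

Let k1 : (0 < k)%N. Proof. exact: leq_trans lk. Qed.

Let a0 : 0 <= a. Proof. exact: cutoff_ge0. Qed.

Definition pn v : {set V} := [set x | outarc arc v x || outarc arc x v].
(** Two-way arcs count as missing too, as they cannot be used by a star. *)
Definition miss u := ms (W :\: pn u).
Definition MS := \sum_(u in A) w * miss u.

Lemma pnC x y : (x \in pn y) = (y \in pn x).
Proof. by rewrite !inE orbC. Qed.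

Lemma nbpE v : nbp v = S :&: pn v.
Proof. by apply/setP=> x; rewrite !inE -andb_orr. Qed.

Lemma pn_nb v : pn v \subset nb v.
Proof. by apply/subsetP=> x; rewrite !inE => /orP[]/andP[-> _]; rewrite ?orbT. Qed.

Lemma miss_ge0 u : 0 <= miss u. Proof. exact: ms_ge0. Qed.
Lemma missE u : miss u = ms (W :\: pn u). Proof. by []. Qed.
Lemma MS_sum : MS = \sum_(u in A) w * miss u. Proof. by []. Qed.
Lemma MS_ge0 : 0 <= MS.
Proof. by apply: sumr_ge0 => u _; rewrite mulr_ge0 ?miss_ge0. Qed.

Lemma A_W : ms A + ms W = 1.
Proof. by rewrite -S1 (msID w S A) (setIidPr AS). Qed.

Lemma nbp_D v : nbp v :\: A = (Out v :\: A) :|: (In v :\: A).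
Proof. by rewrite -setDUl. Qed.

Lemma dj_D v : [disjoint Out v :\: A & In v :\: A].
Proof. exact/disjD/disj_Out_In. Qed.

Lemma dj_I v : [disjoint Out v :&: A & In v :&: A].
Proof.
by apply: disjointWl (subsetIl _ _) (disjointWr (subsetIl _ _) (disj_Out_In _ _ _)).
Qed.

Lemma W_pn v : nbp v :\: A = W :&: pn v.
Proof. by rewrite nbpE; apply/setP=> x; rewrite !inE andbA. Qed.

Lemma o_i_miss v : ms (Out v :\: A) + ms (In v :\: A) + miss v = ms W.
Proof. by rewrite -msU ?dj_D // -nbp_D W_pn -msID. Qed.

Lemma codeg_A u X : u \in A -> X \subset S -> ms (X :\: nb u) <= a.
Proof. by move=> uA XS; apply: le_trans (HA uA); apply: ms_D_codeg. Qed.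

Definition cntA v := cnt k l (Out v :&: A) (In v :&: A).
Definition cntW v := cnt k l (Out v :\: A) (In v :\: A).

Lemma cntAE v : cntA v = cnt k l (Out v :&: A) (In v :&: A). Proof. by []. Qed.
Lemma cntWE v : cntW v = cnt k l (Out v :\: A) (In v :\: A). Proof. by []. Qed.

Lemma ctr_mix v : ctr v <= cntA v + cntW v + 2 * (s.-1%:R * a ^+ s.-2) *
   (\sum_(u in A :&: pn v) w * ms ((W :\: nb u) :&: pn v)).
Proof.
have := @cnt_mix R V w nb w0 (nbrC arc) k.-1 l (Out v) (In v) A a (disj_Out_In _ _ _) a0 _.
have e : (k.-1 + l = s.-1)%N by case: k k1.
rewrite prednK // e -/(nbp v) => H.
apply: (le_trans (H _)) => [u uA|].
  by apply: codeg_A => //; rewrite nbpE subsetIl.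
rewrite lerD2l; apply: ler_wpM2l; first by rewrite !mulr_ge0 ?exprn_ge0.
apply: sumw_mono => // [|u|u _]; last first.
- rewrite ms_le // W_pn; apply/subsetP=> z; rewrite !(inE, in_setD).
  by case/andP=> -> /andP[/andP[-> ->] ->].
- exact: ms_ge0.
by rewrite nbpE setIC setIS ?subsetIr.
Qed.

(** Counts nonadjacent pairs [u] in [A], [z] in [W] with a common pure neighbour [v]: the pairs
    weigh at most [MS], and [v] is adjacent to [z], of degree at most [2 * a]. *)
Lemma mix_sum : \sum_(v in S) w * (\sum_(u in A :&: pn v)
    w * ms ((W :\: nb u) :&: pn v)) <= 2 * a * MS.
Proof.
rewrite (@sumw_swap _ _ w S A (fun v u => ms ((W :\: nb u) :&: pn v)) _ pn); last first.
  by move=> v u _ _; rewrite pnC.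
rewrite /MS mulr_sumr; apply: ler_sum => u uA; rewrite [leRHS]mulrCA ler_wpM2l //.
apply: (@le_trans _ _ (\sum_(v in S) w * ms ((W :\: nb u) :&: pn v))).
  by apply: sumw_mono => // [|v]; [exact: subsetIl | exact: ms_ge0].
under eq_bigr do rewrite -ms_sum1.
rewrite (@sumw_swap _ _ w S (W :\: nb u) (fun _ _ => 1) _ pn); last first.
  by move=> v x _ _; rewrite pnC.
rewrite [leRHS]mulrC /miss.
apply: (@le_trans _ _ (ms (W :\: nb u) * (2 * a))).
  apply: ms_sum_le => // z; rewrite in_setD => /andP[_ zW].
  rewrite /= ms_sum1; apply: le_trans (HD zW); rewrite /deg ms_le //.
  by rewrite setIS // pn_nb.
apply: ler_wpM2r; first by rewrite mulr_ge0.
by rewrite ms_le // setDS // pn_nb.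
Qed.

Lemma tot_mix : tot <= \sum_(v in S) w * cntA v + \sum_(v in S) w * cntW v
  + 4 * s.-1%:R * a ^+ s.-1 * MS.
Proof.
set D := 2 * (s.-1%:R * a ^+ s.-2).
have D0 : 0 <= D by rewrite !mulr_ge0 ?exprn_ge0.
apply: (@le_trans _ _ (\sum_(v in S) (w * cntA v + w * cntW v +
    D * (w * (\sum_(u in A :&: pn v) w * ms ((W :\: nb u) :&: pn v)))))).
  apply: ler_sum => v _; rewrite [D * _]mulrCA -!mulrDr ler_wpM2l //.
  exact: ctr_mix.
rewrite !big_split /= lerD2l -mulr_sumr.
apply: (le_trans (ler_wpM2l D0 mix_sum)).
have -> : a ^+ s.-1 = a * a ^+ s.-2 by rewrite -exprS; case: s s6 => [|[]].
by rewrite /D le_eqVlt; apply/orP; left; apply/eqP; ring.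
Qed.

(* The pure neighbours of [u] cover all of [W] except a part of weight [miss u]. *)
Lemma ed_W_pn u : ed W W <= ed (W :&: pn u) (W :&: pn u) + 2 * a * miss u.
Proof.
have HM : ed (W :\: pn u) W <= a * miss u.
  by rewrite [leRHS]mulrC; apply: ms_sum_le => // x; rewrite in_setD => /andP[_]; apply: HW.
have dj : [disjoint W :&: pn u & W :\: pn u].
  by rewrite -setI_eq0; apply/eqP/setP=> x; rewrite !inE; case: (_ || _); rewrite ?andbF.
set N := W :&: pn u in dj *; set M := W :\: pn u in HM dj *.
have E : N :|: M = W by exact: setID.
have := edU w (nbrC arc) dj; rewrite E => ->.
have := edUr w (nbrC arc) M dj; rewrite E edC; last exact: nbrC.
rewrite [ed M N]edC; last exact: nbrC.
rewrite edC in HM; last exact: nbrC.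
have := @ed_ge0 R V w nb w0 M M.
by lra.
Qed.

End Count.

Lemma diag_gt1 k l : (6 <= k + l)%N -> k = l -> (1 < l)%N.
Proof. by lia. Qed.

Lemma big_gt2 k l : (6 <= k + l)%N -> (l <= k)%N -> (2 < k)%N.
Proof. by lia. Qed.

(** * Exact counts, mainly for at least two in-leaves *)

Section Count2.
Variables (R : realFieldType) (V : finType) (arc : rel V).
Variables (w : R) (k l : nat) (S A : {set V}).
Hypotheses (w0 : 0 <= w) (S1 : ms w S = 1).
Hypotheses (l1 : (0 < l)%N) (lk : (l <= k)%N) (s6 : (6 <= k + l)%N).
Implicit Types (X Y Z : {set V}) (u v x y z : V).

Notation s := (k + l)%N.
Notation h := (star_max R k l).
Notation c := (inner_max R k l).
Notation a := (cutoff R s).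
Notation ms := (ms w).
Notation nb := (nbr arc).
Notation cnt := (cnt w nb).
Notation ctr := (ctr arc w k l S).
Notation tot := (tot arc w k l S).
Notation Out := (Out arc S).
Notation In := (In arc S).
Notation nbp := (nbp arc S).
Notation deg := (deg arc w S).
Notation ed := (ed w nb).
Notation W := (S :\: A).
Notation pn := (pn arc).
Notation miss := (miss arc w S A).
Notation MS := (MS arc w S A).
Notation cntA := (cntA arc w k l S A).
Notation cntW := (cntW arc w k l S A).
Notation o u := (ms (Out u :\: A)).
Notation i u := (ms (In u :\: A)).

Hypothesis AS : A \subset S.
Hypothesis HA : forall u, u \in A -> 1 - deg u <= a.
Hypothesis A_le : ms A <= a.
Hypothesis A_ge : 7 / 10 <= ms A * s.+1%:R.
Hypothesis HW : forall z, z \in W -> ms (W :&: nb z) <= a.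
Hypothesis HD : forall z, z \in W -> deg z <= 2 * a.
Hypothesis HP : forall u, u \in A ->
  36 / 100 * h <= ms (Out u :\: A) ^+ k * ms (In u :\: A) ^+ l.

Let k1 : (0 < k)%N. Proof. exact: leq_trans lk. Qed.
Let h0 : 0 < h. Proof. exact: star_max_gt0. Qed.
Let c0 : 0 <= c. Proof. exact: inner_max_ge0. Qed.
Let a0 : 0 <= a. Proof. exact: cutoff_ge0. Qed.
Let a1 : a <= 11 / 70. Proof. exact: cutoff_le. Qed.
Let s0 : (0 < s)%N. Proof. exact: leq_trans s6. Qed.
Let al0 : 0 < ms A.
Proof.
rewrite -(@pmulr_lgt0 _ s.+1%:R) ?ltr0n //.
by apply: lt_le_trans A_ge; lra.
Qed.

Lemma OutIn_le1 u : o u + i u + ms A + miss u = 1.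
Proof. by rewrite addrAC (o_i_miss arc) addrC (A_W S1 AS). Qed.

(** Multiply [HP] by [ms A]: by [star_max_le3] the product [ms A * o^k * i^(l-1)] is at most [h],
    and one factor [i u] is left. *)
Lemma i_ge u : u \in A -> 36 / 100 * ms A <= i u.
Proof.
move=> uA; have H := HP uA; have E := OutIn_le1 u.
have i0 := ms_ge0 w0 (In u :\: A); have o0 := ms_ge0 w0 (Out u :\: A).
have m0 := miss_ge0 arc S A w0 u; have A0 := ms_ge0 w0 A.
have G := @star_max_le3 R k l (ms A) (o u) (i u) k1 l1 o0 i0 A0 ltac:(lra).
have e : i u ^+ l = i u * i u ^+ l.-1 by rewrite -exprS prednK.
rewrite -(ler_pM2l h0); apply: (@le_trans _ _ (ms A * (o u ^+ k * i u ^+ l))).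
  by have := ler_wpM2l A0 H; lra.
rewrite e; have := ler_wpM2r i0 G; lra.
Qed.

Lemma a_pow_le : a ^+ s.-1 <= 12 / 100 * ms A.
Proof.
have s1 : 0 < s.+1%:R :> R by rewrite ltr0n.
have -> : a ^+ s.-1 = a * a ^+ s.-2 by rewrite -exprS; case: s s6 => [|[]].
have H : a ^+ s.-2 <= (11 / 70) ^+ 4.
  apply: (@le_trans _ _ (a ^+ 4)).
    by apply: ler_wiXn2l => //; [by move: a1; lra | case: s s6 => [|[]]].
  by apply: lerXn2r; rewrite ?nnegrE; move: a0 a1; lra.
rewrite -(ler_pM2l s1) mulrA cutoffE; apply: (@le_trans _ _ (12 / 100 * (7 / 10))).
  by lra.
by have := A_ge; lra.
Qed.

Lemma cntW_W z : z \in W -> cntW z <= h * a ^+ s.-1 * ms (W :&: nb z).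
Proof.
move=> zW; apply: (le_trans (cnt_le_h arc k l w0 (dj_D _ _ _ _))).
rewrite -nbp_D W_pn -mulrA ler_wpM2l ?(ltW h0) //.
rewrite -{1}(prednK s0) exprSr; apply: ler_pM; rewrite ?exprn_ge0 ?ms_ge0 //.
  apply: lerXn2r; rewrite ?nnegrE ?ms_ge0 //; apply: le_trans (HW zW).
  by rewrite ms_le // setIS // pn_nb.
by rewrite ms_le // setIS // pn_nb.
Qed.

Lemma cntW_A u : (1 < l)%N -> u \in A ->
  cntW u <= o u ^+ k * i u ^+ l - 12 / 100 * h * (ed W W - 2 * a * miss u).
Proof.
move=> l2 uA; have E := OutIn_le1 u.
have m0 := miss_ge0 arc S A w0 u; have A0 := ms_ge0 w0 A.
have k2 : (1 < k)%N by apply: leq_trans lk.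
have := @cnt_loss3 R V w nb w0 (nbrC arc) k.-2 l.-2 _ _ 1 (dj_D arc S A u) ltac:(lra).
have -> : (k.-2.+2 = k)%N by case: (k) k2 => [|[]].
have -> : (l.-2.+2 = l)%N by case: (l) l2 => [|[]].
rewrite -nbp_D W_pn -/(cntW u).
have := ed_W_pn w0 HW u; have := HP uA.
have := @ed_ge0 R V w nb w0 (W :&: pn u) (W :&: pn u).
set EE := ed _ _; set P := _ * i u ^+ l => EE0 HP' HE.
have : 36 / 100 * h * EE <= P * EE by rewrite ler_wpM2r.
have : h * (ed W W) <= h * (EE + 2 * a * miss u) by rewrite ler_wpM2l ?(ltW h0).
by rewrite expr1n; lra.
Qed.

(** Edges inside [W] create at most [h * a^(s-1) * ed W W] centred in [W] and, up to missing arcs,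
    destroy [12 / 100 * h * ms A * ed W W] centred in [A]; [12 / 100] is [36 / 100] divided by the 3
    of [cnt_loss3], and [a_pow_le] compares. *)
Lemma totW_ge2 : (1 < l)%N -> \sum_(v in S) w * cntW v <=
  \sum_(u in A) w * (o u ^+ k * i u ^+ l + 24 / 100 * a * h * miss u).
Proof.
move=> l2; rewrite (big_setID A) /= (setIidPr AS).
have H1 : \sum_(z in W) w * cntW z <= h * a ^+ s.-1 * ed W W.
  rewrite /ed mulr_sumr; apply: ler_sum => z zW; rewrite [leRHS]mulrCA ler_wpM2l //.
  exact: cntW_W.
have H2 : \sum_(u in A) w * cntW u <=
    \sum_(u in A) (w * (o u ^+ k * i u ^+ l + 24 / 100 * a * h * miss u)
      - w * (12 / 100 * h * ed W W)).
  apply: ler_sum => u uA; rewrite -mulrBr ler_wpM2l //.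
  by have := cntW_A l2 uA; lra.
have H3 := lerD H2 H1; apply: (le_trans H3).
rewrite big_split /= -addrA -[leRHS]addr0 lerD2l sumrN -mulr_suml ms_sum.
have E0 := @ed_ge0 R V w nb w0 W W.
have := a_pow_le => /(ler_wpM2l (ltW h0))/(ler_wpM2r E0).
by lra.
Qed.

(** Turning the missing vertices into out-neighbours gains [k * miss * o^(k-1) * i^l], whence
    [108 / 100 = 3 * 36 / 100]. This pays for all errors due to missing arcs. *)
Lemma P_miss u : (2 < k)%N -> u \in A ->
  o u ^+ k * i u ^+ l + 108 / 100 * h * miss u <= (ms W - i u) ^+ k * i u ^+ l.
Proof.
move=> k3 uA; have m0 := miss_ge0 arc S A w0 u.
have i0 := ms_ge0 w0 (In u :\: A); have o0 := ms_ge0 w0 (Out u :\: A).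
have E := OutIn_le1 u; have A0 := ms_ge0 w0 A.
have -> : ms W - i u = o u + miss u by rewrite -(o_i_miss arc w S A u); ring.
have H := exprD_ge k o0 m0; have il0 : 0 <= i u ^+ l by rewrite exprn_ge0.
apply: le_trans (ler_wpM2r il0 H); rewrite [leRHS]mulrDl lerD2l.
have p0 : 0 <= o u ^+ k.-1 by rewrite exprn_ge0.
have H1 : o u ^+ k <= o u ^+ k.-1.
  by rewrite -{1}(prednK k1) exprS ler_piMl //; lra.
have H2 := le_trans (HP uA) (ler_wpM2r il0 H1).
apply: (@le_trans _ _ (3 * miss u * (o u ^+ k.-1 * i u ^+ l))).
  by have := ler_wpM2l m0 H2; lra.
rewrite mulrA ler_wpM2r // ler_wpM2r // ler_wpM2r //.
by rewrite (ler_nat _ 3).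
Qed.

Lemma tot_ge2 : (1 < l)%N -> tot <= \sum_(v in S) w * cntA v
   + \sum_(u in A) w * ((ms W - i u) ^+ k * i u ^+ l).
Proof.
move=> l2; apply: (le_trans (tot_mix w0 S1 l1 lk s6 HA HD)).
rewrite -addrA lerD2l.
have k3 := big_gt2 s6 lk.
apply: (@le_trans _ _ (\sum_(u in A) w * (o u ^+ k * i u ^+ l + 24 / 100 * a * h * miss u)
   + h * MS)).
  apply: lerD; first exact: totW_ge2.
  rewrite ler_wpM2r ?MS_ge0 //; have := small_hh R s6; move: h0; lra.
rewrite /MS mulr_sumr -big_split /=; apply: ler_sum => u uA.
rewrite [h * (w * _)]mulrCA -mulrDr ler_wpM2l //.
apply: le_trans (P_miss k3 uA).
have m0 := miss_ge0 arc S A w0 u.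
have : a * (h * miss u) <= 11 / 70 * (h * miss u) :> R.
  by rewrite ler_wpM2r // mulr_ge0 // ltW.
have : 0 <= h * miss u by rewrite mulr_ge0 // ltW.
by lra.
Qed.

(** Fixing the first out-leaf [u] leaves exponents [k - 1] and [l], the origin of the constant
    [inner_max]. Summing over centres then weights each [u] by its in-weight, which couples these
    stars to those centred at [u]. *)
Lemma cntA_out v : cntA v <= \sum_(u in A :&: Out v) w * (c * ms (A :\: nb u) ^+ s.-1).
Proof.
rewrite cntAE setIC -{1}(prednK k1) /=; apply: ler_sum => u /setIP[uA _].
rewrite ler_wpM2l //; apply: (le_trans (cnt_le nb w0 _ _ _ _)).
apply: (le_trans (inner_max_le l k1 (ms_ge0 w0 _) (ms_ge0 w0 _))).
rewrite ler_wpM2l //; apply: lerXn2r; rewrite ?nnegrE ?addr_ge0 ?ms_ge0 //.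
rewrite -msU; last by apply: disjD; rewrite setIC; apply: dj_I.
by rewrite ms_le // -setDUl setSD // subUset subsetIl subsetIr.
Qed.

Lemma sum_A_Out X (F : V -> R) : X \subset S ->
  \sum_(v in X) w * (\sum_(u in A :&: Out v) w * F u) =
  \sum_(u in A) w * (ms (X :&: In u) * F u).
Proof.
move=> XS; rewrite (@sumw_swap _ _ w X A (fun _ => F) Out In).
  by apply: eq_bigr => u _; congr (_ * _); rewrite -mulr_suml ms_sum.
by move=> v u vX uA; apply: Out_In; [apply: (subsetP AS) | apply: (subsetP XS)].
Qed.

(** Edges inside [A] may raise the in-weight of [u] by [ms (A :&: nb u)] but remove the same weight
    from [A :\: nb u]; [shift_pow] applies since [5 * 36 / 100 >= 1]. *)
Lemma totA_gt : \sum_(v in S) w * cntA v <=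
  c * ms A ^+ s.-1 * \sum_(u in A) w * i u.
Proof.
apply: (@le_trans _ _ (\sum_(v in S) w * \sum_(u in A :&: Out v) w * (c * ms (A :\: nb u) ^+ s.-1))).
  by apply: ler_sum => v _; rewrite ler_wpM2l // cntA_out.
rewrite sum_A_Out // mulr_sumr; apply: ler_sum => u uA; rewrite [leRHS]mulrCA ler_wpM2l //.
rewrite [leLHS]mulrCA -[leRHS]mulrA ler_wpM2l //.
have -> : S :&: In u = In u by apply/setIidPr/In_sub.
have e : ms (A :\: nb u) = ms A - ms (A :&: nb u) by rewrite (msID w A (nb u)); ring.
have H : ms (In u) <= i u + ms (A :&: nb u).
  rewrite (msID w (In u) A) addrC lerD2l ms_le // setIC setIS //; exact: In_nbr.
rewrite e [leRHS]mulrC.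
apply: (@le_trans _ _ ((i u + ms (A :&: nb u)) * (ms A - ms (A :&: nb u)) ^+ s.-1)).
  by rewrite ler_wpM2r // exprn_ge0 // -e ms_ge0.
apply: shift_pow; rewrite ?ms_ge0 ?ms_le ?subsetIl //.
have H1 := i_ge uA; have A0 := ms_ge0 w0 A.
have s5 : 5 <= s.-1%:R :> R by rewrite (ler_nat _ 5) -ltnS prednK.
apply: (@le_trans _ _ (5 * (36 / 100 * ms A))); first by lra.
by apply: ler_pM => //; lra.
Qed.

Let al1 : 3 * ms A <= ms W.
Proof. by have := A_W S1 AS; move: A_le a1; lra. Qed.

Lemma ed_A_pn z : ed A A <= ed (A :&: pn z) (A :&: pn z) + 2 * ms A * ms (A :\: pn z).
Proof.
have HM : ed (A :\: pn z) A <= ms A * ms (A :\: pn z).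
  by rewrite [leRHS]mulrC; apply: ms_sum_le => // x _; rewrite ms_le // subsetIl.
have dj : [disjoint A :&: pn z & A :\: pn z].
  by rewrite -setI_eq0; apply/eqP/setP=> x; rewrite !inE; case: (_ || _); rewrite ?andbF.
set N := A :&: pn z in dj *; set M := A :\: pn z in HM dj *.
have E : N :|: M = A by exact: setID.
have := edU w (nbrC arc) dj; rewrite E => ->.
have := edUr w (nbrC arc) M dj; rewrite E edC; last exact: nbrC.
rewrite [ed M N]edC; last exact: nbrC.
rewrite edC in HM; last exact: nbrC.
have := @ed_ge0 R V w nb w0 M M.
by lra.
Qed.

Lemma ed_le X : ed X X <= ms X ^+ 2.
Proof. by rewrite expr2; apply: ms_sum_le => // x _; rewrite ms_le // subsetIl. Qed.

Lemma nbp_I v : (Out v :&: A) :|: (In v :&: A) = A :&: pn v.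
Proof.
rewrite -setIUl -/(nbp v) nbpE setIAC; apply/setP=> x; rewrite !inE.
by case: (boolP (x \in A)) => [/(subsetP AS) ->|]; rewrite ?andbF ?andbT.
Qed.

Lemma cntA_W z : (1 < l)%N ->
  cntA z <= h * ms A ^+ s.-1 * (ms A - ed A A / (3 * ms A)).
Proof.
move=> l2; set al := ms A; set m := ms (A :\: pn z).
have m0 : 0 <= m by apply: ms_ge0.
have k2 : (1 < k)%N by apply: leq_trans lk.
have oi : ms (Out z :&: A) + ms (In z :&: A) = al - m.
  by rewrite -msU ?dj_I // nbp_I /al (msID w A (pn z)) -/m addrK.
have := @cnt_loss3 R V w nb w0 (nbrC arc) k.-2 l.-2 _ _ al (dj_I arc S A z) ltac:(lra).
have -> : (k.-2.+2 = k)%N by case: (k) k2 => [|[]].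
have -> : (l.-2.+2 = l)%N by case: (l) l2 => [|[]].
rewrite nbp_I -/(cntA z).
have := ed_A_pn z; rewrite -/m -/al.
have := ed_le (A :&: pn z).
have EE0 := @ed_ge0 R V w nb w0 (A :&: pn z) (A :&: pn z).
have mN : ms (A :&: pn z) = al - m by rewrite /al (msID w A (pn z)) -/m addrK.
have N0 : 0 <= al - m by rewrite -mN ms_ge0.
rewrite mN; move: EE0; set EE := ed _ _; set E := ed A A => EE0 H1 H2 H3.
have Hh := star_max_le k l (ms_ge0 w0 (Out z :&: A)) (ms_ge0 w0 (In z :&: A)).
rewrite oi in Hh.
have Hp : (al - m) ^+ s <= al ^+ s.-1 * (al - m).
  rewrite -{1}(prednK s0) exprSr ler_wpM2r //; apply: lerXn2r; rewrite ?nnegrE //; lra.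
have al0' : 0 < al by exact: al0.
have f0 : 0 <= 3 * al ^+ 2 - EE.
  have : (al - m) ^+ 2 <= al ^+ 2 by apply: lerXn2r; rewrite ?nnegrE; lra.
  have : 0 <= al ^+ 2 by apply: sqr_ge0.
  by lra.
have HP' : ms (Out z :&: A) ^+ k * ms (In z :&: A) ^+ l <= h * (al ^+ s.-1 * (al - m)).
  by apply: (le_trans Hh); rewrite ler_wpM2l // ltW.
have H4 := le_trans H3 (ler_wpM2r f0 HP').
have q0 : 0 < 3 * al ^+ 2 by rewrite mulr_gt0 // exprn_gt0.
rewrite -(ler_pM2l q0); apply: (le_trans H4).
have hA0 : 0 <= h * al ^+ s.-1 by rewrite mulr_ge0 ?exprn_ge0 ?(ltW h0) // ltW.
have -> : 3 * al ^+ 2 * (h * al ^+ s.-1 * (al - E / (3 * al))) =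
   h * al ^+ s.-1 * (al * (3 * al ^+ 2 - E)).
  by field; apply: lt0r_neq0.
rewrite [h * (_ * _)]mulrA -[leLHS]mulrA ler_wpM2l //.
apply: (@le_trans _ _ ((al - m) * (3 * al ^+ 2 - (E - 2 * al * m)))).
  by rewrite ler_wpM2l //; lra.
have E2 : E <= al ^+ 2 by apply: ed_le.
have mE : m * E <= m * al ^+ 2 by rewrite ler_wpM2l.
have : 0 <= al * m ^+ 2 by rewrite mulr_ge0 ?sqr_ge0 // ltW.
by move: mE; rewrite !expr2; lra.
Qed.

(** Edges inside [A] gain a multiple of [ed A A] for centres in [A] and lose [ms W / (3 * ms A)]
    times as much for centres in [W]; this factor is at least 1. *)
Lemma totA_eq : (1 < l)%N ->
  \sum_(v in S) w * cntA v <= ms W * (h * ms A ^+ s).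
Proof.
move=> l2; rewrite (big_setID A) /= (setIidPr AS).
have hA0 : 0 <= h * ms A ^+ s.-1 by rewrite mulr_ge0 ?exprn_ge0 ?ms_ge0 // ltW.
have H1 : \sum_(z in W) w * cntA z <=
    ms W * (h * ms A ^+ s.-1 * (ms A - ed A A / (3 * ms A))).
  by apply: ms_sum_le => // z _; apply: cntA_W.
have H2 : \sum_(u in A) w * cntA u <= h * ms A ^+ s.-1 * ed A A.
  rewrite /ed mulr_sumr; apply: ler_sum => u uA; rewrite [leRHS]mulrCA ler_wpM2l //.
  apply: (le_trans (cnt_le_h arc k l w0 (dj_I _ _ _ _))).
  rewrite nbp_I -[leRHS]mulrA ler_wpM2l ?(ltW h0) // -{1}(prednK s0) exprSr.
  have sub : ms (A :&: pn u) <= ms (A :&: nb u) by rewrite ms_le // setIS // pn_nb.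
  apply: ler_pM => //; rewrite ?exprn_ge0 ?ms_ge0 //.
  by rewrite msX_le // subsetIl.
apply: (le_trans (lerD H2 H1)).
have -> : ms A ^+ s = ms A ^+ s.-1 * ms A by rewrite -exprSr prednK.
have E0 := @ed_ge0 R V w nb w0 A A.
have : ed A A <= ms W * (ed A A / (3 * ms A)).
  have -> : ms W * (ed A A / (3 * ms A)) = ms W / (3 * ms A) * ed A A by ring.
  rewrite ler_peMl // ler_pdivlMr; last by rewrite mulr_gt0.
  by rewrite mul1r; exact: al1.
by move=> /(ler_wpM2l hA0); lra.
Qed.

Lemma tot_le_gt M : (1 < l)%N ->
  (forall x y z : R, 0 <= x -> 0 <= y -> 0 <= z -> x + y + z = 1 -> x <= 1 / 2 ->
     x * (y ^+ k * z ^+ l + c * x ^+ s.-1 * z) <= M) ->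
  tot <= M.
Proof.
move=> l2 HM; apply: (le_trans (tot_ge2 l2)).
apply: (le_trans (lerD (totA_gt) (lexx _))).
rewrite mulr_sumr -big_split /=.
apply: (@le_trans _ _ (\sum_(u in A) w * (M / ms A))); last first.
  by rewrite -mulr_suml ms_sum mulrC divfK ?lt0r_neq0.
(* Each [u] receives the share [M / ms A], by [HM] at its own point [(ms A, ms W - i u, i u)]. *)
apply: ler_sum => u uA; rewrite mulrCA -mulrDr ler_wpM2l //.
rewrite ler_pdivlMr // mulrC addrC.
have i0 := ms_ge0 w0 (In u :\: A); have o0 := ms_ge0 w0 (Out u :\: A).
have m0 := miss_ge0 arc S A w0 u.
have E1 := o_i_miss arc w S A u; have E2 := A_W S1 AS.
apply: HM; move: A_le a1 (ltW al0); lra.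
Qed.

Lemma tot_le_eq M : k = l ->
  (forall x : R, 0 <= x -> x <= 1 -> h * (x * (1 - x) ^+ s + (1 - x) * x ^+ s) <= M) ->
  tot <= M.
Proof.
move=> kl HM; have l2 := diag_gt1 s6 kl.
apply: (le_trans (tot_ge2 l2)).
apply: (le_trans (lerD (totA_eq l2) (lexx _))).
have E2 := A_W S1 AS; have W0 := ms_ge0 w0 W.
have H : \sum_(u in A) w * ((ms W - i u) ^+ k * i u ^+ l) <= ms A * (h * ms W ^+ s).
  apply: ms_sum_le => // u uA.
  have i0 := ms_ge0 w0 (In u :\: A); have o0 := ms_ge0 w0 (Out u :\: A).
  have m0 := miss_ge0 arc S A w0 u; have E1 := o_i_miss arc w S A u.
  have := @star_max_le R k l (ms W - i u) (i u) ltac:(lra) i0.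
  by rewrite subrK.
apply: (le_trans (lerD (lexx _) H)).
have e : ms W = 1 - ms A by lra.
have := HM (ms A) (ltW al0) ltac:(lra); rewrite -e.
by apply: le_trans; rewrite le_eqVlt; apply/orP; left; apply/eqP; ring.
Qed.

End Count2.

(** * Stars with a single in-leaf *)

Section CountOne.
Variables (R : realFieldType) (V : finType) (arc : rel V).
Variables (w : R) (k : nat) (S A : {set V}).
Hypotheses (w0 : 0 <= w) (S1 : ms w S = 1).
Hypothesis k5 : (5 <= k)%N.
Implicit Types (X Y Z : {set V}) (u v x y z : V).

Notation l := 1%N.
Notation s := (k + 1)%N.
Notation h := (star_max R k l).
Notation c := (inner_max R k l).
Notation a := (cutoff R s).
Notation ms := (ms w).
Notation nb := (nbr arc).
Notation cnt := (cnt w nb).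
Notation ctr := (ctr arc w k l S).
Notation tot := (tot arc w k l S).
Notation Out := (Out arc S).
Notation In := (In arc S).
Notation nbp := (nbp arc S).
Notation deg := (deg arc w S).
Notation ed := (ed w nb).
Notation W := (S :\: A).
Notation pn := (pn arc).
Notation miss := (miss arc w S A).
Notation MS := (MS arc w S A).
Notation cntA := (cntA arc w k l S A).
Notation cntW := (cntW arc w k l S A).
Notation o u := (ms (Out u :\: A)).
Notation i u := (ms (In u :\: A)).

Hypothesis AS : A \subset S.
Hypothesis HA : forall u, u \in A -> 1 - deg u <= a.
Hypothesis A_le : ms A <= a.
Hypothesis A_ge : 7 / 10 <= ms A * s.+1%:R.
Hypothesis HW : forall z, z \in W -> ms (W :&: nb z) <= a.
Hypothesis HD : forall z, z \in W -> deg z <= 2 * a.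
Hypothesis HP : forall u, u \in A ->
  36 / 100 * h <= ms (Out u :\: A) ^+ k * ms (In u :\: A) ^+ l.

Let s6 : (6 <= s)%N. Proof. by rewrite addn1. Qed.
Let k1 : (0 < k)%N. Proof. exact: leq_trans k5. Qed.
Let sP : s.-1 = k. Proof. by rewrite addn1. Qed.
Let h0 : 0 < h. Proof. exact: star_max_gt0. Qed.
Let c0 : 0 <= c. Proof. exact: inner_max_ge0. Qed.
Let a0 : 0 <= a. Proof. exact: cutoff_ge0. Qed.
Let a1 : a <= 11 / 70. Proof. exact: cutoff_le. Qed.
Let al0 : 0 < ms A.
Proof.
rewrite -(@pmulr_lgt0 _ s.+1%:R) ?ltr0n //.
by apply: lt_le_trans A_ge; lra.
Qed.

Definition inn z := ms (In z :&: A).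
(** Just below [2 / (11 k)], hence below [inner_max k 1 / 2] by [kap_ge]: in [cntA_Wm], centres in
    [Wm] then reach at most half of the generic bound on stars with leaves in [A]. *)
Definition eta : R := 18 / (100 * k%:R).
(* Vertices receiving almost no arcs from [A]: edges among them cost (almost)
   no star centred in [A], since such a star has a single in-leaf. *)
Definition Wm := [set z in W | inn z <= eta * ms A].
Notation Wp := (W :\: Wm).

Let nbC := nbrC arc.

Lemma ed_W_pn1 u X : X \subset W -> ed X W <= ed X (W :&: pn u) + a * miss u.
Proof.
move=> XW; rewrite -{1}(setID W (pn u)) edUr //; last first.
  by rewrite -setI_eq0; apply/eqP/setP=> x; rewrite !inE; case: (_ || _); rewrite ?andbF.
rewrite lerD2l edC // [leRHS]mulrC; apply: ms_sum_le => // x.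
rewrite in_setD => /andP[_ xW]; apply: le_trans (HW xW).
by rewrite ms_le // setSI.
Qed.

Lemma cntW_A1 u : u \in A -> cntW u <= o u ^+ k * i u
   - 288 / 1000 * h * (ed (Out u :&: Wp) W - a * miss u).
Proof.
move=> uA; have E := OutIn_le1 arc S1 AS u.
have m0 := miss_ge0 arc S A w0 u; have A0 := ms_ge0 w0 A.
have i0 := ms_ge0 w0 (In u :\: A); have o0 := ms_ge0 w0 (Out u :\: A).
have k2 : (1 < k)%N by apply: leq_trans k5.
have H1 := @cnt_loss_out R V w nb w0 k.-2 1 (Out u :\: A) (In u :\: A).
have H2 := @cnt_loss_out_in R V w nb w0 k.-1 0 (Out u :\: A) (In u :\: A).
have e2 : (k.-2.+2 = k)%N by case: (k) k2 => [|[]].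
have e1 : (k.-1.+1 = k)%N by case: (k) k1.
rewrite e2 expr1 -/(cntW u) in H1; rewrite e1 expr1 expr0 mulr1 -/(cntW u) in H2.
have HP' := HP uA; rewrite expr1 in HP'.
set O := Out u :\: A in o0 E H1 H2 HP' *; set I := In u :\: A in i0 E H1 H2 HP' *.
have p0 : 0 <= ms O ^+ k.-2 by rewrite exprn_ge0.
have eO : ms O ^+ k = ms O ^+ k.-2 * (ms O * ms O) by rewrite -{1}e2 !exprSr mulrA.
have eO1 : ms O ^+ k.-1 = ms O ^+ k.-2 * ms O by rewrite -{1}e2 /= exprSr.
have OO0 := ed_ge0 nb w0 O O; have OI0 := ed_ge0 nb w0 O I.
have Q1 : 36 / 100 * h <= ms O ^+ k.-2 * ms I.
  apply: (le_trans HP'); have -> : ms O ^+ k * ms I = ms O ^+ k.-2 * ms I * (ms O * ms O).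
    by rewrite eO; ring.
  by rewrite ler_piMr ?mulr_ge0 //; apply: mulr_ile1; lra.
have Q2 : 4 * (36 / 100 * h) <= ms O ^+ k.-1.
  have oi : 4 * (ms O * ms I) <= 1.
    have : (ms O + ms I) ^+ 2 <= 1 by apply: exprn_ile1; lra.
    have := sqr_ge0 (ms O - ms I); lra.
  have -> : ms O ^+ k.-1 = ms O ^+ k.-1 * 1 by rewrite mulr1.
  have p1 : 0 <= ms O ^+ k.-1 by rewrite exprn_ge0.
  apply: le_trans (ler_wpM2l p1 oi).
  have -> : ms O ^+ k.-1 * (4 * (ms O * ms I)) = 4 * (ms O ^+ k * ms I).
    by rewrite eO1 eO; ring.
  by rewrite ler_wpM2l.
(* Averaging [H1] and [H2] with weights [4 / 5] and [1 / 5] gives [ed O O] and [ed O I] the same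
   coefficient [4 / 5 * 36 / 100 = 288 / 1000]. *)
have G1 := ler_wpM2r OO0 Q1; have G2 := ler_wpM2r OI0 Q2.
have G3 : ed (Out u :&: Wp) W <= ed O O + ed O I + a * miss u.
  have sub : Out u :&: Wp \subset W.
    by apply: subset_trans (subsetIr _ _) (subsetDl _ _).
  apply: (le_trans (ed_W_pn1 u sub)); rewrite lerD2r -edUr ?dj_D // -nbp_D W_pn.
  apply: ed_mono => //; apply/subsetP=> x; rewrite in_setI => /andP[xO].
  by rewrite in_setD in_setD => /andP[_ /andP[xA _]]; rewrite in_setD xA.
have := ler_wpM2l (ltW h0) G3.
by lra.
Qed.

Lemma thr_le : eta * ms A <= ms A.
Proof.
rewrite ler_piMl ?(ltW al0) // /eta ler_pdivrMr; last by rewrite mulr_gt0 // ltr0n.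
by have : 5 <= k%:R :> R by [rewrite (ler_nat _ 5)]; lra.
Qed.

Lemma Wp_inn x : x \in Wp -> eta * ms A <= inn x.
Proof. by rewrite in_setD inE => /andP[+ xW]; rewrite xW /= -ltNge => /ltW. Qed.

Lemma Wm_sub : Wm \subset W.
Proof. by apply/subsetP=> x; rewrite inE => /andP[]. Qed.

Lemma Wm_inn x : x \in Wm -> inn x <= eta * ms A.
Proof. by rewrite inE => /andP[]. Qed.

Lemma sum_ed_Wp : eta * ms A * ed Wp W <= \sum_(u in A) w * ed (Out u :&: Wp) W.
Proof.
have -> : \sum_(u in A) w * ed (Out u :&: Wp) W =
    \sum_(x in Wp) w * (inn x * ms (W :&: nb x)).
  under eq_bigr do rewrite setIC.
  rewrite (@sumw_swap _ _ w A Wp (fun _ x => ms (W :&: nb x)) Out In).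
    apply: eq_bigr => x _; congr (_ * _); rewrite -mulr_suml ms_sum setIC.
    by [].
  move=> u x uA; rewrite in_setD => /andP[_ /setDP[xS _]].
  by apply: Out_In => //; apply: (subsetP AS).
rewrite mulr_sumr; apply: ler_sum => x xW; rewrite mulrCA ler_wpM2l //.
by rewrite ler_wpM2r ?ms_ge0 // Wp_inn.
Qed.

Lemma cntW_sum v : cntW v <=
  \sum_(x in Out v :\: A) w * (c * ms ((W :&: pn v) :\: nb x) ^+ s.-1).
Proof.
rewrite cntWE -{1}(prednK k1) /=; apply: ler_sum => x _.
rewrite ler_wpM2l //; apply: (le_trans (cnt_le nb w0 _ _ _ _)).
apply: (le_trans (inner_max_le l k1 (ms_ge0 w0 _) (ms_ge0 w0 _))).
rewrite ler_wpM2l //; apply: lerXn2r; rewrite ?nnegrE ?addr_ge0 ?ms_ge0 //.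
rewrite -msU; last by apply: disjD; apply: dj_D.
by rewrite -setDUl -nbp_D W_pn.
Qed.

Let Npn_le z x : z \in W -> ms ((W :&: pn z) :\: nb x) <= a.
Proof.
move=> zW; apply: le_trans (HW zW); rewrite ms_le //.
by apply: subset_trans (subsetDl _ _) _; rewrite setIS // pn_nb.
Qed.

Let cpow (x : R) : 0 <= x -> x <= a -> c * x ^+ s.-1 <= c * a ^+ s.-1.
Proof.
by move=> x0 xa; rewrite ler_wpM2l //; apply: lerXn2r; rewrite ?nnegrE.
Qed.

Let ca0 : 0 <= c * a ^+ s.-1. Proof. by rewrite mulr_ge0 ?exprn_ge0. Qed.

Let OutW_nb z : Out z :\: A \subset W :&: nb z.
Proof.
by apply/subsetP=> x /setDP[xO xA]; rewrite in_setI in_setD xA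
  (subsetP (Out_sub arc S z)) // (subsetP (Out_nbr arc S z)).
Qed.

Lemma cntW_Wp z : z \in Wp -> cntW z <= c * a ^+ s.-1 * ms (W :&: nb z).
Proof.
rewrite in_setD => /andP[_ zW]; apply: (le_trans (cntW_sum z)); rewrite [leRHS]mulrC.
apply: (@le_trans _ _ (ms (Out z :\: A) * (c * a ^+ s.-1))).
  by apply: ms_sum_le => // x _; apply: cpow; rewrite ?ms_ge0 // Npn_le.
by rewrite ler_wpM2r // ms_le.
Qed.

(** Discarding [Wp] from the neighbourhood of [z] costs a multiple of the weight of edges from [z]
    to [Wp], by [pow_sub_le]; stars inside [Wm] remain. *)
Lemma cntW_Wm z : z \in Wm -> cntW z <=
  \sum_(x in Wm :&: Out z) w * (c * ms (Wm :\: nb x) ^+ s.-1)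
  + c * s%:R * a ^+ s.-1 * ms (Wp :&: nb z).
Proof.
move=> zm; have zW := subsetP Wm_sub _ zm.
apply: (le_trans (cntW_sum z)); rewrite (big_setID Wm) /=.
set ro := ms (Wp :&: nb z).
have ro0 : 0 <= ro by apply: ms_ge0.
have H1 : \sum_(x in (Out z :\: A) :\: Wm) w * (c * ms ((W :&: pn z) :\: nb x) ^+ s.-1)
    <= c * a ^+ s.-1 * ro.
  apply: (@le_trans _ _ (ms ((Out z :\: A) :\: Wm) * (c * a ^+ s.-1))).
    by apply: ms_sum_le => // x _; apply: cpow; rewrite ?ms_ge0 // Npn_le.
  rewrite [leRHS]mulrC ler_wpM2r // ms_le //.
  apply: subset_trans (setSD _ (OutW_nb z)) _.
  by apply/subsetP=> x; rewrite !(in_setD, in_setI) => /and3P[-> -> ->].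
have H2 x : c * ms ((W :&: pn z) :\: nb x) ^+ s.-1 <=
    c * ms (Wm :\: nb x) ^+ s.-1 + c * (s.-1%:R * ro * a ^+ s.-2).
  rewrite -mulrDr ler_wpM2l //; set N := (W :&: pn z) :\: nb x.
  have N0 := ms_ge0 w0 N; have Na : ms N <= a by apply: Npn_le.
  have Nm := ms_ge0 w0 (N :&: Wm).
  have NE := msID w N Wm; have Nr := ms_ge0 w0 (N :\: Wm).
  have Nro : ms (N :\: Wm) <= ro.
    rewrite ms_le //; apply/subsetP=> y; rewrite !(in_setD, in_setI).
    by move=> /and3P[-> _ /andP[/andP[-> ->] /(subsetP (pn_nb arc z)) ->]].
  have := @pow_sub_le R (ms N) (ms (N :&: Wm)) s.-1 Nm ltac:(lra).
  move=> /le_trans; apply; apply: lerD.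
    apply: msX_le => //; apply/subsetP=> y; rewrite !(in_setD, in_setI).
    by move=> /andP[/andP[-> _] ->].
  rewrite sP; apply: ler_pM; rewrite ?mulr_ge0 ?exprn_ge0 //; first by lra.
    by rewrite ler_wpM2l //; lra.
  by apply: lerXn2r; rewrite ?nnegrE.
have H3 : \sum_(x in (Out z :\: A) :&: Wm) w * (c * ms ((W :&: pn z) :\: nb x) ^+ s.-1)
   <= \sum_(x in Wm :&: Out z) w * (c * ms (Wm :\: nb x) ^+ s.-1)
     + c * s.-1%:R * a ^+ s.-1 * ro.
  apply: (@le_trans _ _ (\sum_(x in (Out z :\: A) :&: Wm)
     (w * (c * ms (Wm :\: nb x) ^+ s.-1) + w * (c * (s.-1%:R * ro * a ^+ s.-2))))).
    by apply: ler_sum => x _; rewrite -mulrDr ler_wpM2l.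
  rewrite big_split /=; apply: lerD.
    apply: sumw_mono => // [|x]; last by rewrite mulr_ge0 ?exprn_ge0 ?ms_ge0.
    by rewrite setIC setIS // subsetDl.
  rewrite -mulr_suml ms_sum.
  have Oa : ms ((Out z :\: A) :&: Wm) <= a.
    apply: le_trans (HW zW); rewrite ms_le //.
    by apply: subset_trans (subsetIl _ _) (OutW_nb z).
  have -> : c * s.-1%:R * a ^+ s.-1 * ro = a * (c * (s.-1%:R * ro * a ^+ s.-2)).
    have e : a ^+ k = a * a ^+ k.-1 by rewrite -exprS prednK.
    by rewrite sP e; ring.
  by rewrite ler_wpM2r // mulr_ge0 // mulr_ge0 ?exprn_ge0 // mulr_ge0.
apply: (le_trans (lerD H3 H1)); rewrite -addrA lerD2l.
have -> : s%:R = s.-1%:R + 1 :> R by rewrite natr1 sP addn1.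
by rewrite le_eqVlt; apply/orP; left; apply/eqP; ring.
Qed.

Notation mm := (ms Wm).

(** In a star inside [Wm] with first out-leaf [x], the centre lies in [Wm :&: nb x] and the other
    leaves in [Wm :\: nb x]; [kap] bounds the product. Everything that meets [Wp] is charged to
    [ed Wp W]. *)
Lemma totW_W : \sum_(z in W) w * cntW z <=
  c * kap R s * mm ^+ s.+1 + c * s.+1%:R * a ^+ s.-1 * ed Wp W.
Proof.
rewrite (big_setID Wm) /= (setIidPr Wm_sub).
have H1 : \sum_(z in Wp) w * cntW z <= c * a ^+ s.-1 * ed Wp W.
  rewrite /ed mulr_sumr; apply: ler_sum => z zW; rewrite [leRHS]mulrCA ler_wpM2l //.
  exact: cntW_Wp.
have H2 : \sum_(z in Wm) w * cntW z <=
   \sum_(z in Wm) w * (\sum_(x in Wm :&: Out z) w * (c * ms (Wm :\: nb x) ^+ s.-1))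
   + c * s%:R * a ^+ s.-1 * ed Wm Wp.
  rewrite /ed mulr_sumr -big_split /=; apply: ler_sum => z zm.
  by rewrite [X in _ + X]mulrCA -mulrDr ler_wpM2l // cntW_Wm.
have H3 : \sum_(z in Wm) w * (\sum_(x in Wm :&: Out z) w * (c * ms (Wm :\: nb x) ^+ s.-1))
   <= c * kap R s * mm ^+ s.+1.
  rewrite (@sumw_swap _ _ w Wm Wm (fun _ x => c * ms (Wm :\: nb x) ^+ s.-1) Out In); last first.
    move=> u x /(subsetP Wm_sub)/setDP[uS _] /(subsetP Wm_sub)/setDP[xS _].
    exact: Out_In.
  have -> : c * kap R s * mm ^+ s.+1 = mm * (c * (kap R s * mm ^+ s)) by rewrite exprS; ring.
  apply: ms_sum_le => // x xm; rewrite -mulr_suml ms_sum mulrCA ler_wpM2l //.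
  apply: (@le_trans _ _ (ms (Wm :&: nb x) * ms (Wm :\: nb x) ^+ s.-1)).
    rewrite ler_wpM2r ?exprn_ge0 ?ms_ge0 // ms_le // setIS //; exact: In_nbr.
  have := @kap_amgm R s (ms (Wm :&: nb x)) (ms (Wm :\: nb x)) (leq_trans (isT : 0 < 6)%N s6)
    (ms_ge0 w0 _) (ms_ge0 w0 _).
  by rewrite -msID.
have H4 : ed Wm Wp <= ed Wp W by rewrite edC //; apply: ed_mono => //; apply: Wm_sub.
have q0 : 0 <= c * s%:R * a ^+ s.-1 by rewrite mulr_ge0 ?exprn_ge0 // mulr_ge0.
have := ler_wpM2l q0 H4; rewrite -natr1; lra.
Qed.

Lemma totW_one : \sum_(v in S) w * cntW v <=
  \sum_(u in A) w * (o u ^+ k * i u + 288 / 1000 * h * a * miss u)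
  + c * kap R s * mm ^+ s.+1.
Proof.
rewrite (big_setID A) /= (setIidPr AS).
have H1 : \sum_(u in A) w * cntW u <=
    \sum_(u in A) (w * (o u ^+ k * i u + 288 / 1000 * h * a * miss u)
      - 288 / 1000 * h * (w * ed (Out u :&: Wp) W)).
  apply: ler_sum => u uA; rewrite [_ * (w * _)]mulrCA -mulrBr ler_wpM2l //.
  by have := cntW_A1 uA; lra.
have H2 := totW_W; have H3 := sum_ed_Wp.
apply: (le_trans (lerD H1 H2)); rewrite sumrB.
rewrite -[X in _ - X + _ <= _]mulr_sumr.
have E0 := ed_ge0 nb w0 Wp W.
have := lossy_bound k5 A_ge; rewrite -/eta => /(ler_wpM2r E0).
have hh0 : 0 <= 288 / 1000 * h by rewrite mulr_ge0 ?(ltW h0) //; lra.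
have := ler_wpM2l hh0 H3.
by lra.
Qed.

Definition outA z := ms (Out z :&: A).

Lemma outA_inn z : outA z + inn z + ms (A :\: pn z) = ms A.
Proof.
have H : Out z :&: A :|: In z :&: A = A :&: pn z by apply: nbp_I.
by rewrite /outA /inn -msU ?dj_I // H -msID.
Qed.

Lemma outA_ge0 z : 0 <= outA z. Proof. exact: ms_ge0. Qed.

Lemma cntA_Wm z : z \in Wm -> cntA z <= c / 2 * ms A ^+ s.-1 * outA z.
Proof.
move=> zm; apply: (le_trans (cnt_le nb w0 _ _ _ _)); rewrite expr1.
have H := Wm_inn zm; have i0 : 0 <= inn z by apply: ms_ge0.
have O0 := outA_ge0 z; have OA : outA z <= ms A by rewrite ms_le // subsetIr.
have A0 := ms_ge0 w0 A.
apply: (@le_trans _ _ ((outA z * ms A ^+ k.-1) * (c / 2 * ms A))).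
  apply: ler_pM; rewrite ?exprn_ge0 ?ms_ge0 //.
    rewrite -{1}(prednK k1) exprS ler_wpM2l //.
    by apply: lerXn2r; rewrite ?nnegrE.
  apply: (le_trans H); rewrite ler_wpM2r //.
  by apply: inner_max1_gap; apply: leq_trans k5.
have -> : ms A ^+ s.-1 = ms A * ms A ^+ k.-1 by rewrite sP -exprS prednK.
by rewrite le_eqVlt; apply/orP; left; apply/eqP; ring.
Qed.

Notation g u := (c * ms (A :\: nb u) ^+ s.-1).
(** The share [4 / 7] still absorbs the edges inside [A] through [shift_pow], as
    [5 * 4 / 7 * 36 / 100 >= 1]; the share [3 / 7] ignores them and keeps the slack of the centres
    in [Wm]. *)
Notation G u := (c * (4 / 7 * ms (A :\: nb u) ^+ s.-1 + 3 / 7 * ms A ^+ s.-1)).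

Let g_le u : g u <= G u.
Proof.
rewrite ler_wpM2l //; have : ms (A :\: nb u) ^+ s.-1 <= ms A ^+ s.-1.
  by rewrite msX_le // subsetDl.
by lra.
Qed.

Lemma cntA_G v : cntA v <= \sum_(u in A :&: Out v) w * G u.
Proof.
apply: (le_trans (cntA_out arc S A w0 (leqnn 1) k1 v)) => //.
by apply: ler_sum => u _; rewrite ler_wpM2l.
Qed.

Lemma cntA_Wm_G z : z \in Wm -> cntA z <=
  \sum_(u in A :&: Out z) w * G u - 3 / 7 * (c / 2 * ms A ^+ s.-1 * outA z).
Proof.
move=> zm; have H1 := cntA_Wm zm.
have H2 : cntA z <= \sum_(u in A :&: Out z) w * g u by apply: cntA_out.
have -> : \sum_(u in A :&: Out z) w * G u =
    4 / 7 * (\sum_(u in A :&: Out z) w * g u) + 3 / 7 * (c * ms A ^+ s.-1 * outA z).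
  rewrite /outA (setIC (Out z) A) -(ms_sum w (A :&: Out z)) !mulr_sumr -big_split /=; apply: eq_bigr => u _.
  by ring.
by lra.
Qed.

Lemma totA_one : \sum_(v in S) w * cntA v <= c * ms A ^+ s.-1 * (\sum_(u in A) w * i u)
  - 3 / 7 * (c / 2 * ms A ^+ s.-1 * (\sum_(z in Wm) w * outA z)).
Proof.
rewrite (big_setID A) /= (setIidPr AS).
have H1 : \sum_(v in A) w * cntA v <= \sum_(u in A) w * (ms (A :&: In u) * g u).
  rewrite -sum_A_Out //; apply: ler_sum => v _; rewrite ler_wpM2l //.
  exact: cntA_out.
have H2 : \sum_(v in W) w * cntA v <= \sum_(u in A) w * (ms (W :&: In u) * G u)
    - 3 / 7 * (c / 2 * ms A ^+ s.-1 * (\sum_(z in Wm) w * outA z)).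
  rewrite -sum_A_Out ?subsetDl // [leLHS](big_setID Wm) [X in X - _](big_setID Wm) /=.
  rewrite (setIidPr Wm_sub) addrAC; apply: lerD; last first.
    by apply: ler_sum => v _; rewrite ler_wpM2l // cntA_G.
  rewrite !mulr_sumr -sumrB; apply: ler_sum => z zm.
  have := ler_wpM2l w0 (cntA_Wm_G zm); rewrite mulrBr mulr_sumr; lra.
apply: (le_trans (lerD H1 H2)); rewrite addrA lerD2r -big_split mulr_sumr /=.
apply: ler_sum => u uA; rewrite -mulrDr [leRHS]mulrCA ler_wpM2l //.
have -> : W :&: In u = In u :\: A.
  by apply/setP=> x; rewrite !(in_setI, in_setD) !inE; case: (x \in S); rewrite ?andbF ?andbT.
set e := ms (A :&: In u); set q := ms A - ms (A :&: nb u).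
have eE : ms (A :\: nb u) = q by rewrite /q (msID w A (nb u)); ring.
have H : e <= ms (A :&: nb u) by rewrite ms_le // setIS //; apply: In_nbr.
have q0 : 0 <= q ^+ s.-1 by rewrite exprn_ge0 // -eE ms_ge0.
have A0 := ms_ge0 w0 A; have i0 := ms_ge0 w0 (In u :\: A).
have Hi := i_ge w0 S1 (leqnn 1) k1 AS HP uA.
have k5' : 5 <= k%:R :> R by rewrite (ler_nat _ 5).
have := @shift_pow R (ms A) (ms (A :&: nb u)) (4 / 7 * i u) s.-1 al0 (ms_ge0 w0 _) _ _ _.
rewrite -/q eE => X.
have {}X : (4 / 7 * i u + ms (A :&: nb u)) * q ^+ s.-1 <= 4 / 7 * i u * ms A ^+ s.-1.
  apply: X; [by rewrite ms_le // subsetIl|by rewrite mulr_ge0 //; lra|].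
  rewrite sP; apply: (@le_trans _ _ (5 * (4 / 7 * (36 / 100 * ms A)))); first by lra.
  apply: ler_pM => //; [by lra|by rewrite ler_wpM2l //; lra].
have := ler_wpM2l c0 X; have := ler_wpM2l c0 (ler_wpM2r q0 H); lra.
Qed.

(** Here missing arcs are filled as in-arcs of [u]: the gain in [o^k * hat] pays for the errors of
    [tot_mix] and [totW_one], and the gain in [c * ms A^(s-1) * hat] for the term [MS] of
    [sum_outA]. *)
Notation hat u := (ms W - o u).

Lemma hatE u : hat u = i u + miss u.
Proof. by rewrite -(o_i_miss arc w S A u); ring. Qed.

Lemma sum_outA : mm * (ms A - eta * ms A) - MS <= \sum_(z in Wm) w * outA z.
Proof.
have H : MS = \sum_(z in W) w * ms (A :\: pn z).
  rewrite MS_sum.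
  under eq_bigr do rewrite missE -ms_sum1; under [RHS]eq_bigr do rewrite -ms_sum1.
  by apply: sumw_exchange => x y; apply: pnC.
have H1 : \sum_(z in Wm) w * ms (A :\: pn z) <= MS.
  rewrite H; apply: sumw_mono => // [|z]; last exact: ms_ge0.
  exact: Wm_sub.
have : \sum_(z in Wm) w * (ms A - eta * ms A) <=
    \sum_(z in Wm) (w * outA z + w * ms (A :\: pn z)).
  apply: ler_sum => z zm; rewrite -mulrDr ler_wpM2l //.
  by have := Wm_inn zm; have := outA_inn z; lra.
rewrite -mulr_suml ms_sum big_split /=; lra.
Qed.

Lemma tot_one : tot <= \sum_(u in A) w * (o u ^+ k * hat u + c * ms A ^+ s.-1 * hat u)
  + c * kap R s * mm ^+ s.+1
  - 3 / 7 * (c / 2 * ms A ^+ s.-1 * (mm * (ms A - eta * ms A))).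
Proof.
have T1 := tot_mix w0 S1 (leqnn 1) k1 s6 HA HD.
have T2 := totA_one; have T3 := totW_one.
have T4 := sum_outA; have M0 := MS_ge0 arc S A w0.
have T5 := small_hh R s6.
have T5' := ler_wpM2r M0 T5.
have A0 := ms_ge0 w0 A.
have p0 : 0 <= c * ms A ^+ s.-1 by rewrite mulr_ge0 ?exprn_ge0.
have T4' := ler_wpM2l p0 T4.
have T6 : \sum_(u in A) w * (o u ^+ k * i u + 288 / 1000 * h * a * miss u)
   + c * ms A ^+ s.-1 * (\sum_(u in A) w * i u) <=
   \sum_(u in A) w * (o u ^+ k * hat u + c * ms A ^+ s.-1 * hat u)
     - (15 / 100 * h + c * ms A ^+ s.-1) * MS.
  rewrite MS_sum !mulr_sumr -big_split -sumrB /=; apply: ler_sum => u uA.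
  rewrite hatE.
  have m0 := miss_ge0 arc S A w0 u; have i0 := ms_ge0 w0 (In u :\: A).
  have o0 := ms_ge0 w0 (Out u :\: A).
  have E := OutIn_le1 arc S1 AS u.
  have HP' := HP uA; rewrite expr1 in HP'.
  have oo : 36 / 100 * h <= o u ^+ k.
    by apply: (le_trans HP'); rewrite ler_piMr ?exprn_ge0 //; lra.
  have Q := ler_wpM2l w0 (ler_wpM2r m0 oo).
  have wm : 0 <= h * (w * miss u) by rewrite mulr_ge0 ?(ltW h0) // mulr_ge0.
  have := ler_wpM2l wm a1.
  by lra.
have c20 : 0 <= c * ms A ^+ s.-1 * MS by rewrite mulr_ge0.
by lra.
Qed.

Lemma tot_le_one M :
  (forall x y z : R, 0 <= x -> 0 <= y -> 0 <= z -> x + y + z = 1 -> x <= 1 / 2 ->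
     x * (y ^+ k * z ^+ l + c * x ^+ s.-1 * z) <= M) ->
  tot <= M.
Proof.
move=> HM; have T := tot_one.
have A0 := ms_ge0 w0 A; have AW := A_W S1 AS; have m0 := ms_ge0 w0 Wm.
have hat_bd u : u \in A -> [/\ 0 <= hat u, 0 <= o u, ms A + o u + hat u = 1 & hat u <= 45 / 100].
  move=> uA; have o0 := ms_ge0 w0 (Out u :\: A); have i0 := ms_ge0 w0 (In u :\: A).
  have mi0 := miss_ge0 arc S A w0 u.
  have hE := hatE u; have h00 : 0 <= hat u by lra.
  have E : ms A + o u + hat u = 1 by lra.
  split => //; apply: (hat_le k5 A0 A_ge o0 h00 E).
  have := HP uA; rewrite expr1 => /le_trans; apply.
  by rewrite ler_wpM2l ?exprn_ge0 //; lra.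
have etaE : 1 - eta = 1 - 18 / (100 * k%:R) by [].
have p0 : 0 <= c * ms A ^+ s.-1 by rewrite mulr_ge0 ?exprn_ge0.
(* Divided by [c * mm], the stars inside [Wm] are [kap s * mm^s] and the slack is
   [3 / 7 / 2 * (1 - eta) * ms A^s]; below the threshold [slack_bound] compares them. *)
case: (lerP mm ((1 + s%:R^-1) * ms A)) => Hm.
  apply: (@le_trans _ _ (\sum_(u in A) w * (M / ms A))); last first.
    by rewrite -mulr_suml ms_sum mulrC divfK ?lt0r_neq0.
  apply: (@le_trans _ _ (\sum_(u in A) w * (o u ^+ k * hat u + c * ms A ^+ s.-1 * hat u))).
    have S2 := slack_bound R k5.
    have mp : mm ^+ s <= (1 + s%:R^-1) ^+ s * ms A ^+ s.
      by rewrite -exprMn; apply: lerXn2r; rewrite ?nnegrE // mulr_ge0 // addr_ge0 // invr_ge0.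
    have q0 : 0 <= kap R s := kap_ge0 R s.
    have X1 := ler_wpM2l q0 mp.
    have as0 : 0 <= ms A ^+ s by rewrite exprn_ge0.
    have X2 := ler_wpM2r as0 S2.
    have cm0 : 0 <= c * mm by rewrite mulr_ge0.
    have X3 := ler_wpM2l cm0 (le_trans X1 (_ : _ <= 3 / 7 / 2 * (1 - eta) * ms A ^+ s)).
    have {}X3 := X3 ltac:(by rewrite mulrA).
    have e1 : mm ^+ s.+1 = mm * mm ^+ s by rewrite exprS.
    have e2 : ms A ^+ s = ms A * ms A ^+ s.-1 by rewrite -exprS prednK // (leq_trans _ s6).
    move: T X3; rewrite e1 e2; lra.
  apply: ler_sum => u uA; rewrite ler_wpM2l // ler_pdivlMr // mulrC.
  have [h1 h2 h3 _] := hat_bd u uA.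
  by have := HM (ms A) (o u) (hat u) A0 h2 h1 h3; rewrite expr1; apply; move: A_le a1; lra.
pose Sm := \sum_(u in A) w * hat u.
pose zt := Sm / ms A.
have SmE : Sm = ms A * zt by rewrite /zt mulrC divfK ?lt0r_neq0.
(* By double counting [Sm] is the sum of [ms A - inn z] over [W], to which each vertex of [Wm]
   contributes almost [ms A]. *)
have HS1 : (1 - eta) * (mm * ms A) <= Sm.
  have -> : Sm = \sum_(z in W) w * (ms A - inn z).
    have e1 : \sum_(u in A) w * o u = \sum_(z in W) w * inn z.
      have := @sumw_swap _ _ w A W (fun _ _ => 1) Out In.
      move=> X; transitivity (\sum_(u in A) w * (\sum_(z in W :&: Out u) w * 1)).
        apply: eq_bigr => u _; congr (_ * _); rewrite ms_sum1; congr (ms _).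
        apply/setP=> x; rewrite !(in_setI, in_setD) !inE.
        by case: (x \in S); rewrite ?andbF ?andbT.
      rewrite X; last first.
        by move=> u x uA /setDP[xS _]; apply: Out_In => //; apply: (subsetP AS).
      by apply: eq_bigr => z _; rewrite ms_sum1 /inn setIC.
    rewrite /Sm; under eq_bigr do rewrite mulrBr; under [RHS]eq_bigr do rewrite mulrBr.
    by rewrite !sumrB e1 -!mulr_suml !ms_sum mulrC.
  apply: (@le_trans _ _ (\sum_(z in Wm) w * (ms A - inn z))).
    apply: (@le_trans _ _ (\sum_(z in Wm) w * ((1 - eta) * ms A))).
      by rewrite -mulr_suml ms_sum; lra.
    by apply: ler_sum => z zm; rewrite ler_wpM2l //; have := Wm_inn zm; lra.
  rewrite [leRHS](big_setID Wm) /= (setIidPr Wm_sub) lerDl.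
  apply: sumr_ge0 => z _; rewrite mulr_ge0 // subr_ge0.
  by have := outA_inn z; have := outA_ge0 z; have := ms_ge0 w0 (A :\: pn z); lra.
have Hz45 : zt <= 45 / 100.
  rewrite /zt ler_pdivrMr // mulrC; apply: ms_sum_le => // u uA.
  by have [] := hat_bd u uA.
have zt0 : 0 <= zt.
  rewrite /zt divr_ge0 //; apply: sumr_ge0 => u uA; rewrite mulr_ge0 //.
  by have [] := hat_bd u uA.
have Hzm : (1 - eta) * mm <= zt.
  by rewrite -(ler_pM2l al0) -SmE mulrCA [ms A * mm]mulrC.
have eta1 : 0 <= 1 - eta.
  by have := thr_le; rewrite -{2}[ms A]mul1r ler_pM2r // subr_ge0.
have Hza : (1 - eta) * ((1 + s%:R^-1) * ms A) <= zt.
  by apply: le_trans Hzm; rewrite ler_wpM2l // ltW.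
have SB := swap_bound k5 A0 A_ge m0 Hz45 Hza Hzm.
(* Jensen's inequality: the tangent at the mean [zt] has a linear term that sums to 0. *)
have PM : ms A * zt ^+ s <= \sum_(u in A) w * hat u ^+ s.
  apply: (@le_trans _ _ (\sum_(u in A) w * (zt ^+ s + s%:R * zt ^+ s.-1 * (hat u - zt)))).
    under eq_bigr do rewrite mulrDr.
    rewrite big_split /= -mulr_suml ms_sum lerDl.
    have -> : \sum_(u in A) w * (s%:R * zt ^+ s.-1 * (hat u - zt)) =
        s%:R * zt ^+ s.-1 * (Sm - ms A * zt).
      rewrite /Sm -(ms_sum w A) mulr_suml -sumrB mulr_sumr; apply: eq_bigr => u _; ring.
    by rewrite SmE subrr mulr0.
  apply: ler_sum => u uA; rewrite ler_wpM2l //; apply: pow_tangent => //.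
  by have [] := hat_bd u uA.
(* [HM] with the roles of [ms A] and [hat u] exchanged; as [l = 1], the factor [ms A] splits off
   both terms. *)
have HM' : ms A * (\sum_(u in A) w * (o u ^+ k * hat u + c * hat u ^+ s)) <= ms A * M.
  rewrite mulr_sumr; apply: (@le_trans _ _ (\sum_(u in A) w * M)).
    apply: ler_sum => u uA; rewrite mulrCA ler_wpM2l //.
    have [h1 h2 h3 h4] := hat_bd u uA.
    have := HM (hat u) (o u) (ms A) h1 h2 A0 ltac:(lra) ltac:(lra).
    have -> : hat u ^+ s = hat u * hat u ^+ s.-1 by rewrite -exprS prednK // (leq_trans _ s6).
    by rewrite expr1; lra.
  by rewrite -mulr_suml ms_sum.
rewrite ler_pM2l // in HM'.
apply: le_trans HM'; apply: (le_trans T).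
have e1 : \sum_(u in A) w * (o u ^+ k * hat u + c * ms A ^+ s.-1 * hat u) =
    \sum_(u in A) w * (o u ^+ k * hat u) + c * ms A ^+ s.-1 * Sm.
  by rewrite /Sm mulr_sumr -big_split /=; apply: eq_bigr => u _; ring.
have e2 : \sum_(u in A) w * (o u ^+ k * hat u + c * hat u ^+ s) =
    \sum_(u in A) w * (o u ^+ k * hat u) + c * (\sum_(u in A) w * hat u ^+ s).
  by rewrite mulr_sumr -big_split /=; apply: eq_bigr => u _; ring.
have nn : 0 <= c / 2 * ms A ^+ s.-1 * (mm * (ms A - eta * ms A)).
  have -> : c / 2 * ms A ^+ s.-1 * (mm * (ms A - eta * ms A)) =
     (c * ms A ^+ s.-1) * (mm * ((1 - eta) * ms A)) / 2 by ring.
  by rewrite divr_ge0 // mulr_ge0 // mulr_ge0 // mulr_ge0.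
have e3 : ms A ^+ s = ms A * ms A ^+ s.-1 by rewrite -exprS prednK // (leq_trans _ s6).
rewrite e1 e2 SmE; have := ler_wpM2l c0 (le_trans SB PM); rewrite e3; lra.
Qed.

End CountOne.

(** * The upper bound for tuples *)

Section Induction.
Variables (R : realFieldType) (k l : nat) (M : R).
Hypotheses (l1 : (0 < l)%N) (lk : (l <= k)%N) (s6 : (6 <= k + l)%N).

Notation s := (k + l)%N.
Notation h := (star_max R k l).
Notation c := (inner_max R k l).
Notation b := (mean_max R s).

Hypothesis M_eq : k = l -> forall x : R, 0 <= x -> x <= 1 ->
  h * (x * (1 - x) ^+ s + (1 - x) * x ^+ s) <= M.
Hypothesis M_gt : (l < k)%N -> forall x y z : R, 0 <= x -> 0 <= y -> 0 <= z ->
  x + y + z = 1 -> x <= 1 / 2 -> x * (y ^+ k * z ^+ l + c * x ^+ s.-1 * z) <= M.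

Let k1 : (0 < k)%N. Proof. exact: leq_trans lk. Qed.
Let h0 : 0 < h. Proof. exact: star_max_gt0. Qed.
Let s0 : (0 < s)%N. Proof. exact: leq_trans s6. Qed.

(** Tests the hypotheses at [x = 1 / (s + 1)], with [y : z = k : l] when [k > l], and drops the
    second term. *)
Lemma M_ge : b * h <= s.+1%:R * M.
Proof.
have S0 : 0 < s.+1%:R :> R by rewrite ltr0n.
have sS : s%:R + 1 = s.+1%:R :> R by rewrite natr1.
have s6' : 6 <= s%:R :> R by rewrite (ler_nat _ 6).
have inv0 : 0 <= s.+1%:R^-1 :> R by rewrite invr_ge0 ltW.
have inv1 : s.+1%:R^-1 <= 1 / 2 :> R.
  by rewrite -[leRHS]invf_div lef_pV2 ?posrE ?divr_gt0 // -sS; lra.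
have inv2 : s.+1%:R^-1 <= 1 :> R by apply: le_trans inv1 _; lra.
have inv3 : 0 <= 1 - s.+1%:R^-1 :> R by rewrite subr_ge0.
have -> : b * h = s.+1%:R * (h * (s.+1%:R^-1 * b)).
  by move: S0; move: (s.+1%:R) => p p0; field; apply: lt0r_neq0.
rewrite ler_wpM2l ?(ltW S0) //.
have bE : b = (1 - s.+1%:R^-1) ^+ s.
  have e : s%:R = s.+1%:R - 1 :> R by rewrite -sS addrK.
  by rewrite /mean_max {1}e mulrBl divff ?lt0r_neq0 // mul1r.
have [kl|lk'] := leqP k l.
  have {}kl : k = l by apply/eqP; rewrite eqn_leq kl lk.
  apply: le_trans (M_eq kl inv0 inv2).
  by rewrite ler_wpM2l ?(ltW h0) // -bE lerDl mulr_ge0 ?exprn_ge0.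
have k0' : 0 <= k%:R / s.+1%:R :> R by rewrite divr_ge0.
have l0' : 0 <= l%:R / s.+1%:R :> R by rewrite divr_ge0.
have E : s.+1%:R^-1 + k%:R / s.+1%:R + l%:R / s.+1%:R = 1 :> R.
  by rewrite -[X in X + _ + _]mul1r -!mulrDl -addrA -natrD addrC sS divff // lt0r_neq0.
apply: le_trans (M_gt lk' inv0 k0' l0' E inv1).
have -> : h * (s.+1%:R^-1 * b) = s.+1%:R^-1 * ((k%:R / s.+1%:R) ^+ k * (l%:R / s.+1%:R) ^+ l).
  rewrite /star_max /mean_max !expr_div_n.
  have -> : s.+1%:R ^+ s = s.+1%:R ^+ k * s.+1%:R ^+ l :> R by rewrite exprD.
  have : 0 < s%:R ^+ s :> R by rewrite exprn_gt0 // ltr0n.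
  have : 0 < s.+1%:R ^+ k :> R by rewrite exprn_gt0.
  have : 0 < s.+1%:R ^+ l :> R by rewrite exprn_gt0.
  move: S0; move: (s.+1%:R) (s%:R ^+ s) (_ ^+ k) (_ ^+ l) => p q x y.
  move: (_ ^+ k) (_ ^+ l) => u v p0 y0 x0 q0; field.
  by rewrite !lt0r_neq0.
rewrite ler_wpM2l // lerDl mulr_ge0 // mulr_ge0 ?exprn_ge0 //.
exact: inner_max_ge0.
Qed.

Section Regular.
Variables (V : finType) (arc : rel V) (w : R) (S : {set V}).
Hypotheses (w0 : 0 <= w) (S1 : ms w S = 1).

Lemma tot_regular :
  (forall v, v \in S -> 999 / 1000 * b * h <= ctr arc w k l S v + leaf arc w k l S v) ->
  tot arc w k l S <= M.
Proof.
(* The assumption [M < tot] provides [T_ge], on which the bounds on [A] rest. *)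
move=> f_ge; rewrite leNgt; apply/negP => TM.
have S0 : 0 < s.+1%:R :> R by rewrite ltr0n.
have T_ge : b * h <= s.+1%:R * tot arc w k l S.
  by apply: (le_trans M_ge); rewrite ler_wpM2l // ltW.
have AS : bigdeg arc w S \subset S by apply/subsetP=> x; rewrite inE => /andP[].
have HA u := codeg_big w0 S1 l1 lk s6 f_ge (u := u).
have A_le := ms_A_le w0 S1 l1 lk s6 f_ge T_ge.
have A_ge := ms_A_ge w0 S1 l1 lk s6 f_ge T_ge.
have HW z := rW_le w0 S1 l1 lk s6 f_ge T_ge (z := z).
have HD z := deg_W_aa w0 S1 l1 lk s6 f_ge T_ge (z := z).
have HP u := P_ge w0 S1 l1 lk s6 f_ge (u := u).
suff : tot arc w k l S <= M by rewrite leNgt TM.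
have [kl|lk'] := leqP k l.
  have {}kl : k = l by apply/eqP; rewrite eqn_leq kl lk.
  exact: tot_le_eq AS HA A_le A_ge HW HD HP _ kl (M_eq kl).
have [l2|] := ltnP 1 l.
  exact: tot_le_gt AS HA A_le A_ge HW HD HP _ l2 (M_gt lk').
move=> l2; have {}l2 : l = 1%N by apply/eqP; rewrite eqn_leq l2 l1.
subst l; apply: tot_le_one AS HA A_le A_ge HW HD HP _ (M_gt lk') => //.
by move: s6; rewrite addn1.
Qed.

End Regular.

Section Scale.
Variables (V : finType) (arc : rel V).

Lemma cnt_scale (w : R) (nb : V -> {set V}) p q X Y :
  cnt w nb p q X Y = w ^+ (p + q) * cnt 1 nb p q X Y.
Proof.
elim: p X Y => [|p IH] X Y /=.
  rewrite add0n; elim: q Y => [|q IHq] Y /=; first by rewrite mul1r.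
  by rewrite exprS -mulrA !mulr_sumr; apply: eq_bigr => y _; rewrite IHq mul1r.
by rewrite addSn exprS -mulrA !mulr_sumr; apply: eq_bigr => y _; rewrite IH mul1r.
Qed.

Lemma ctr_scale (w : R) S v : ctr arc w k l S v = w ^+ s * ctr arc 1 k l S v.
Proof. exact: cnt_scale. Qed.

Lemma tot_scale (w : R) S : tot arc w k l S = w ^+ s.+1 * tot arc 1 k l S.
Proof.
rewrite /tot exprS -mulrA !mulr_sumr; apply: eq_bigr => v _.
by rewrite ctr_scale mul1r.
Qed.

Lemma leaf_scale (w : R) S v : leaf arc w k l S v = w ^+ s * leaf arc 1 k l S v.
Proof.
have e1 : (k.-1 + l = s.-1)%N by case: k k1.
have e2 : (k + l.-1 = s.-1)%N by case: l l1 => // n _; rewrite addnS.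
have e : w ^+ s = w * w ^+ s.-1 by rewrite -exprS prednK.
rewrite /leaf mulrDr e; congr (_ + _); rewrite -mulrA !mulr_sumr;
  by apply: eq_bigr => u _; rewrite cnt_scale ?e1 ?e2 mul1r; ring.
Qed.

Lemma tot_crude S : tot arc 1 k l S <= #|S|%:R ^+ s.+1 :> R.
Proof.
have m1 X : ms 1 X = #|X|%:R :> R by rewrite msE mul1r.
rewrite exprS -m1; apply: ms_sum_le => // v _; apply: (le_trans (cnt_le _ ler01 _ _ _ _)).
rewrite exprD; apply: ler_pM; rewrite ?exprn_ge0 ?ms_ge0 //.
  by apply: msX_le => //; apply: Out_sub.
by apply: msX_le => //; apply: In_sub.
Qed.

(* Induction on [#|S|]: either some vertex lies in few stars and can be deleted,
   or [tot_regular] applies. *)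
Lemma tot_bound S : tot arc 1 k l S <= M * #|S|%:R ^+ s.+1 + (1000 * s)%:R ^+ s.+1.
Proof.
have M0 : 0 <= M.
  have := M_ge; have := @mean_max_ge R s s0 => b4 H.
  have S0 : 0 < s.+1%:R :> R by rewrite ltr0n.
  rewrite -(pmulr_rge0 _ S0); apply: le_trans H; rewrite mulr_ge0 ?(ltW h0) //; lra.
move En : #|S| => n; elim: n S En => [|n IH] S En.
  by apply: (le_trans (tot_crude S)); rewrite En expr0n mulr0 add0r exprn_ge0.
have [small|big] := ltnP n (1000 * s).
  apply: (le_trans (tot_crude S)); rewrite En -[leLHS]add0r; apply: lerD.
    by rewrite mulr_ge0 ?exprn_ge0.
  by apply: lerXn2r; rewrite ?nnegrE // ler_nat.
have n0 : 0 < n.+1%:R :> R by rewrite ltr0n.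
(* The threshold is a lower bound for [M * ((n + 1)^(s + 1) - n^(s + 1))], the growth of the main
   term, so deleting such a vertex preserves the bound. *)
case: (boolP [exists v in S,
    ctr arc 1 k l S v + leaf arc 1 k l S v <= s.+1%:R * M * n%:R ^+ s]).
  case/exists_inP => v vS Hv; apply: (le_trans (tot_del _ _ _ ler01 vS)).
  have Ev : #|S :\ v| = n by apply/eqP; rewrite -eqSS -En (cardsD1 v S) vS.
  have H := IH _ Ev; rewrite mul1r.
  have G := exprD_ge s.+1 (ler0n R n) ler01; rewrite mulr1 natr1 /= in G.
  by have := ler_wpM2l M0 G; lra.
rewrite negb_exists_in => /forall_inP Hall.
pose w : R := n.+1%:R^-1.
have w0 : 0 <= w by rewrite invr_ge0 ltW.
have S1 : ms w S = 1 by rewrite msE En mulVf // lt0r_neq0.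
have nw : n.+1%:R * w = 1 by rewrite mulfV // lt0r_neq0.
have Hw : tot arc w k l S <= M.
  apply: tot_regular => // v vS; have := Hall v vS; rewrite -ltNge => Hv.
  rewrite ctr_scale leaf_scale -mulrDr.
  have ws0 : 0 <= w ^+ s by rewrite exprn_ge0.
  apply: le_trans (ler_wpM2l ws0 (ltW Hv)).
  have -> : w ^+ s * (s.+1%:R * M * n%:R ^+ s) = (1 - w) ^+ s * (s.+1%:R * M).
    have -> : 1 - w = w * n%:R by rewrite -{1}nw -natr1; ring.
    by rewrite exprMn; ring.
  (* The origin of [999 / 1000]: with at least [1000 * s] vertices, replacing [n + 1] by [n] in the
     threshold costs at most this factor. *)
  have B : 999 / 1000 <= (1 - w) ^+ s.
    have w1 : w <= 1 by rewrite invf_le1 // ler1n.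
    have := @bernoulli R (- w) s ltac:(lra).
    have : s%:R * w <= 1 / 1000.
      have : (1000 * s)%:R <= n.+1%:R :> R by rewrite ler_nat leqW.
      rewrite natrM => /(ler_wpM2r w0); rewrite nw; lra.
    by lra.
  have SM : 0 <= s.+1%:R * M by rewrite mulr_ge0.
  apply: le_trans (ler_wpM2r SM B).
  by have := M_ge; lra.
rewrite tot_scale in Hw.
have -> : tot arc 1 k l S = n.+1%:R ^+ s.+1 * (w ^+ s.+1 * tot arc 1 k l S).
  by rewrite mulrA -exprMn nw expr1n mul1r.
rewrite -[leLHS]addr0; apply: lerD; last by rewrite exprn_ge0.
by rewrite [leRHS]mulrC ler_wpM2l // exprn_ge0.
Qed.

End Scale.
End Induction.

(** * From tuples to induced stars *)

Section Ind.
Variables (R : realFieldType) (V : finType) (nb : V -> {set V}).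
Hypothesis nbC : forall x y, (x \in nb y) = (y \in nb x).
Implicit Types (X Y P Q : {set V}).

Definition stable P := [forall x in P, forall y in P, y \notin nb x].

Definition indep_pairs k l X Y : {set {set V} * {set V}} :=
  [set PQ : {set V} * {set V} | [&& PQ.1 \subset X, #|PQ.1| == k, PQ.2 \subset Y,
     #|PQ.2| == l & stable (PQ.1 :|: PQ.2)]].

Lemma stableP P : reflect {in P &, forall x y, y \notin nb x} (stable P).
Proof.
apply: (iffP forall_inP) => [H x y xP yP|H x xP]; first exact: (forall_inP (H x xP)).
by apply/forall_inP => y yP; apply: H.
Qed.

Lemma stableS P Q : P \subset Q -> stable Q -> stable P.
Proof.
move=> /subsetP PQ /stableP H; apply/stableP => x y /PQ xQ /PQ yQ; exact: H.
Qed.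

Lemma stable_D P Q X x : x \in Q -> P \subset Q -> stable Q -> P \subset X -> P \subset X :\: nb x.
Proof.
move=> xQ /subsetP PQ /stableP H /subsetP PX; apply/subsetP=> y yP.
by rewrite in_setD PX // andbT; apply: H => //; apply: PQ.
Qed.

Lemma indep_pairs_out k l X Y : (k.+1 * #|indep_pairs k.+1 l X Y| <=
  \sum_(x in X) #|indep_pairs k l (X :\: nb x) (Y :\: nb x)|)%N.
Proof.
set I := indep_pairs k.+1 l X Y.
have -> : (k.+1 * #|I| = \sum_(PQ in I) \sum_(x in X | x \in PQ.1) 1)%N.
  rewrite mulnC -sum_nat_const; apply: eq_bigr => -[P Q].
  rewrite /I inE /= => /and5P[/setIidPr PX /eqP cP _ _ _].
  by rewrite -cP -sum1_card; apply: eq_bigl => x; rewrite -[in LHS]PX inE.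
rewrite (exchange_big_dep (mem X)) /=; last by move=> ? ? _ /andP[].
apply: leq_sum => x xX; rewrite sum1_card.
pose f (PQ : {set V} * {set V}) := (PQ.1 :\ x, PQ.2).
rewrite -(card_in_imset (f := f)); last first.
  move=> [P Q] [P' Q'] /andP[_ /andP[_ xP]] /andP[_ /andP[_ xP']].
  rewrite /= in xP xP'.
  by rewrite /f /= => -[e ->]; rewrite -(setD1K xP) e setD1K.
apply: subset_leq_card; apply/subsetP=> _ /imsetP[[P Q] /andP[+ /andP[_ xP]] ->].
rewrite /I inE /= => /and5P[PX /eqP cP QY cQ st]; rewrite /= in xP.
rewrite inE /=; have xPQ : x \in P :|: Q by rewrite inE xP.
apply/and5P; split=> //.
- apply: (stable_D xPQ) => //; last by apply: subset_trans PX; apply: subsetDl.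
  by apply: subset_trans (subsetUl _ _); apply: subsetDl.
- by move: cP; rewrite (cardsD1 x) xP add1n => -[->].
- by apply: (stable_D xPQ) => //; apply: subsetUr.
by apply: stableS st; apply: setSU; apply: subsetDl.
Qed.

Lemma indep_pairs_in l X Y : (l.+1 * #|indep_pairs 0 l.+1 X Y| <=
  \sum_(x in Y) #|indep_pairs 0 l (X :\: nb x) (Y :\: nb x)|)%N.
Proof.
set I := indep_pairs 0 l.+1 X Y.
have -> : (l.+1 * #|I| = \sum_(PQ in I) \sum_(x in Y | x \in PQ.2) 1)%N.
  rewrite mulnC -sum_nat_const; apply: eq_bigr => -[P Q].
  rewrite /I inE /= => /and5P[_ _ /setIidPr QY /eqP cQ _].
  by rewrite -cQ -sum1_card; apply: eq_bigl => x; rewrite -[in LHS]QY inE.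
rewrite (exchange_big_dep (mem Y)) /=; last by move=> ? ? _ /andP[].
apply: leq_sum => x xX; rewrite sum1_card.
pose f (PQ : {set V} * {set V}) := (PQ.1, PQ.2 :\ x).
rewrite -(card_in_imset (f := f)); last first.
  move=> [P Q] [P' Q'] /andP[_ /andP[_ xP]] /andP[_ /andP[_ xP']].
  rewrite /= in xP xP'.
  by rewrite /f /= => -[-> e]; rewrite -(setD1K xP) e setD1K.
apply: subset_leq_card; apply/subsetP=> _ /imsetP[[P Q] /andP[+ /andP[_ xP]] ->].
rewrite /I inE /= => /and5P[PX cP QY /eqP cQ st]; rewrite /= in xP.
rewrite inE /=; have xPQ : x \in P :|: Q by rewrite inE xP orbT.
apply/and5P; split=> //.
- by apply: (stable_D xPQ) => //; apply: subsetUl.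
- apply: (stable_D xPQ) => //; last by apply: subset_trans QY; apply: subsetDl.
  by apply: subset_trans (subsetUr _ _); apply: subsetDl.
- by move: cQ; rewrite (cardsD1 x) xP add1n => -[->].
by apply: stableS st; apply: setUS; apply: subsetDl.
Qed.

(** Each pair of sets appears once for every ordering of both sets; tuples with repeated entries
    only enlarge the right side. *)
Lemma indep_pairs_le k l X Y :
  (k`! * l`! * #|indep_pairs k l X Y|)%:R <= cnt 1 nb k l X Y :> R.
Proof.
elim: k X Y => [|k IH] X Y.
  rewrite fact0 mul1n; elim: l X Y => [|l IH] X Y.
    rewrite fact0 mul1n /= -[leRHS]/(1%:R) ler_nat.
    rewrite -(cards1 ((set0, set0) : {set V} * {set V})).
    apply: subset_leq_card; apply/subsetP=> -[P Q]; rewrite !inE /=.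
    by case/and5P=> _ /eqP/cards0_eq -> _ /eqP/cards0_eq -> _.
  have H := indep_pairs_in l X Y.
  apply: (@le_trans _ _ (l`!%:R * (\sum_(x in Y) #|indep_pairs 0 l (X :\: nb x) (Y :\: nb x)|)%:R)).
    by rewrite -natrM ler_nat factS (mulnC l.+1) -mulnA leq_mul2l H orbT.
  rewrite natr_sum mulr_sumr; apply: ler_sum => y _; rewrite mul1r.
  by apply: le_trans (IH (X :\: nb y) (Y :\: nb y)); rewrite natrM.
have H := indep_pairs_out k l X Y.
apply: (@le_trans _ _ ((k`! * l`!)%:R * (\sum_(x in X) #|indep_pairs k l (X :\: nb x) (Y :\: nb x)|)%:R)).
  by rewrite -natrM ler_nat factS -(mulnA k.+1) (mulnC k.+1) -mulnA leq_mul2l H orbT.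
rewrite natr_sum mulr_sumr; apply: ler_sum => y _; rewrite mul1r -natrM.
exact: IH.
Qed.

End Ind.

Local Open Scope nat_scope.

(** * Induced copies as a centre with two leaf sets *)

Section Link.
Variables (k l n : nat) (G : {set 'I_n * 'I_n}).
Hypothesis G_loopless : loopless G.

Definition arc_of (x y : 'I_n) := (x, y) \in G.
Notation nb := (nbr arc_of).
Notation Out := (Out arc_of setT).
Notation In := (In arc_of setT).
Notation m := (k + l + 1)%N.

Let pf0 : (0 < m)%N. Proof. by rewrite addn1. Qed.
Let pf1 (i : 'I_k) : (i.+1 < m)%N. Proof. by have := ltn_ord i; lia. Qed.
Let pf2 (j : 'I_l) : (k + 1 + j < m)%N. Proof. by have := ltn_ord j; lia. Qed.
Definition center : 'I_m := Ordinal pf0.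
Definition outleaf (i : 'I_k) : 'I_m := Ordinal (pf1 i).
Definition inleaf (j : 'I_l) : 'I_m := Ordinal (pf2 j).

Lemma outleaf_inj : injective outleaf.
Proof. by move=> i j [] /val_inj. Qed.
Lemma inleaf_inj : injective inleaf.
Proof. by move=> i j [] /addnI/val_inj. Qed.

Lemma outleaf_center i : outleaf i != center. Proof. by []. Qed.
Lemma inleaf_center j : inleaf j != center.
Proof. by rewrite -val_eqE /= addn1. Qed.

Lemma star_ordP (p : 'I_m) :
  [\/ p = center, exists i, p = outleaf i | exists j, p = inleaf j].
Proof.
case: p => [[|p] pm]; first by constructor 1; apply: val_inj.
have [pk|kp] := ltnP p k.
  by constructor 2; exists (Ordinal pk); apply: val_inj.
have pl : (p - k < l)%N by lia.
by constructor 3; exists (Ordinal pl); apply: val_inj => /=; lia.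
Qed.

Lemma ostar_center_out i : (center, outleaf i) \in ostar k l.
Proof. by rewrite inE /= ltn_ord. Qed.
Lemma ostar_out_center i : (outleaf i, center) \in ostar k l = false.
Proof. by rewrite inE /=; have := ltn_ord i; lia. Qed.
Lemma ostar_in_center j : (inleaf j, center) \in ostar k l.
Proof. by rewrite inE /= leq_addr orbT. Qed.
Lemma ostar_center_in j : (center, inleaf j) \in ostar k l = false.
Proof. by rewrite inE /=; have := ltn_ord j; lia. Qed.
Lemma ostar_leaves p q : p != center -> q != center -> ((p, q) \in ostar k l) = false.
Proof.
move=> /eqP pc /eqP qc; rewrite inE /=; apply/negbTE/negP => H.
case: p pc H => [[|p] pm] pc; first by case: pc; apply: val_inj.
by case: q qc => [[|q] qm] qc; first by case: qc; apply: val_inj.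
Qed.

Lemma loopless_nb x : x \notin nb x.
Proof. by rewrite inE /arc_of orbb; apply: (forallP G_loopless). Qed.

Lemma ind_count_le :
  (ind_count (ostar k l) G <= \sum_v #|indep_pairs nb k l (Out v) (In v)|)%N.
Proof.
pose D := [set t : 'I_n * ({set 'I_n} * {set 'I_n}) |
   t.2 \in indep_pairs nb k l (Out t.1) (In t.1)].
have -> : (\sum_v #|indep_pairs nb k l (Out v) (In v)| = #|D|)%N.
  rewrite -sum1_card (eq_bigl (fun t => t.2 \in indep_pairs nb k l (Out t.1) (In t.1))).
    rewrite -(pair_big_dep predT (fun v PQ => PQ \in indep_pairs nb k l (Out v) (In v)) (fun _ _ => 1%N)) /=.
    by apply: eq_bigr => v _; rewrite sum1_card.
  by move=> t; rewrite [in LHS]inE.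
pose g (t : 'I_n * ({set 'I_n} * {set 'I_n})) := t.1 |: (t.2.1 :|: t.2.2).
apply: leq_trans (leq_imset_card g D); apply: subset_leq_card.
apply/subsetP=> W; rewrite inE => /existsP[f /and3P[/injectiveP finj /eqP fW /forallP fH]].
have arcE p q : arc_of (f p) (f q) = ((p, q) \in ostar k l).
  by have /forallP/(_ q)/eqP := fH p.
pose P := [set f (outleaf i) | i : 'I_k]; pose Q := [set f (inleaf j) | j : 'I_l].
have stab p q : p != center -> q != center -> f q \notin nb (f p).
  by move=> pc qc; rewrite inE !arcE !ostar_leaves.
have cP : #|P| = k.
  by rewrite card_imset; [rewrite card_ord|move=> i j /finj/outleaf_inj].
have fP i : f (outleaf i) \in P by apply: imset_f.
have fQ j : f (inleaf j) \in Q by apply: imset_f.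
have cQ : #|Q| = l.
  by rewrite card_imset; [rewrite card_ord|move=> i j /finj/inleaf_inj].
apply/imsetP; exists (f center, (P, Q)).
  rewrite inE /= inE /=; apply/and5P; split.
  - apply/subsetP=> _ /imsetP[i _ ->]; rewrite !inE /outarc /= !arcE.
    by rewrite ostar_center_out ostar_out_center.
  - by rewrite cP.
  - apply/subsetP=> _ /imsetP[j _ ->]; rewrite !inE /outarc /= !arcE.
    by rewrite ostar_center_in ostar_in_center.
  - by rewrite cQ.
  have leafP x : x \in P :|: Q -> exists2 p, p != center & x = f p.
    case/setUP => /imsetP[i _ ->]; first by exists (outleaf i).
    by exists (inleaf i) => //; apply: inleaf_center.
  by apply/stableP=> x y /leafP[p pc ->] /leafP[q qc ->]; apply: stab.
rewrite -fW /g /=; apply/setP=> x; apply/imsetP/idP.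
  case=> p _ ->; rewrite !inE; case: (star_ordP p) => [->|[i ->]|[j ->]].
  - by rewrite eqxx.
  - by rewrite fP orbT.
  by rewrite fQ !orbT.
rewrite !inE => /or3P[/eqP ->|/imsetP[i _ ->]|/imsetP[j _ ->]].
- by exists center; rewrite ?classical_sets.in_setT.
- by exists (outleaf i); rewrite ?classical_sets.in_setT.
by exists (inleaf j); rewrite ?classical_sets.in_setT.
Qed.

Hypothesis k2 : (1 < k)%N.
Hypothesis nb_stable : forall v, stable nb (nb v).

Definition star_pairs : {set 'I_n * ({set 'I_n} * {set 'I_n})} :=
  [set t : 'I_n * ({set 'I_n} * {set 'I_n}) | [&& t.2.1 \subset Out t.1, #|t.2.1| == k, t.2.2 \subset In t.1 & #|t.2.2| == l]].

Lemma star_pairs_copy t : t \in star_pairs ->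
  induced_copy (ostar k l) G (t.1 |: (t.2.1 :|: t.2.2)).
Proof.
case: t => v [P Q]; rewrite inE /= => /and4P[/subsetP PO /eqP cP /subsetP QI /eqP cQ].
pose f := [ffun p : 'I_m => if val p == 0%N then v
  else if (p <= k)%N then nth v (enum P) p.-1 else nth v (enum Q) (p - k.+1)].
have fc : f center = v by rewrite ffunE.
have fo i : f (outleaf i) = nth v (enum P) i.
  by rewrite ffunE /= ltn_ord.
have fi j : f (inleaf j) = nth v (enum Q) j.
  rewrite ffunE /= addn1 addSn /= ltnNge leq_addr /=.
  by congr nth; lia.
have foP i : f (outleaf i) \in P by rewrite fo -mem_enum mem_nth // -cardE cP.
have fiQ j : f (inleaf j) \in Q by rewrite fi -mem_enum mem_nth // -cardE cQ.
have oP x : x \in P -> arc_of v x /\ ~~ arc_of x v.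
  by move=> /PO; rewrite !inE /outarc /= => /andP[].
have iQ x : x \in Q -> arc_of x v /\ ~~ arc_of v x.
  by move=> /QI; rewrite !inE /outarc /= => /andP[].
have loop x : arc_of x x = false.
  by apply/negbTE; apply: (forallP G_loopless).
have PQ x y : x \in P -> y \in Q -> x != y.
  by move=> /oP[a1 _] /iQ[_ a2]; apply: contraTneq a1 => ->.
have nbPQ x : x \in P :|: Q -> x \in nb v.
  by case/setUP=> [/oP[a _]|/iQ[a _]]; rewrite inE a ?orbT.
have st x y : x \in P :|: Q -> y \in P :|: Q -> arc_of x y = false.
  move=> /nbPQ xv /nbPQ yv; have /stableP/(_ x y xv yv) := nb_stable v.
  by rewrite inE negb_or => /andP[/negbTE].
have uP := enum_uniq (mem P); have uQ := enum_uniq (mem Q).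
apply/existsP; exists f; apply/and3P; split.
- apply/injectiveP=> p q.
  case: (star_ordP p) => [->|[i ->]|[j ->]]; case: (star_ordP q) => [->|[i' ->]|[j' ->]] //.
  + by rewrite fc => e; have [] := oP _ (foP i'); rewrite -e loop.
  + by rewrite fc => e; have [] := iQ _ (fiQ j'); rewrite -e loop.
  + by rewrite fc => e; have [] := oP _ (foP i); rewrite e loop.
  + rewrite !fo => /eqP; rewrite nth_uniq -?cardE ?cP // => /eqP e.
    by congr outleaf; apply: val_inj.
  + by move=> e; have := PQ _ _ (foP i) (fiQ j'); rewrite e eqxx.
  + by rewrite fc => e; have [] := iQ _ (fiQ j); rewrite e loop.
  + by move=> e; have := PQ _ _ (foP i') (fiQ j); rewrite e eqxx.
  rewrite !fi => /eqP; rewrite nth_uniq -?cardE ?cQ // => /eqP e.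
  by congr inleaf; apply: val_inj.
- apply/eqP/setP=> x; apply/imsetP/idP.
    case=> p _ ->; rewrite !inE; case: (star_ordP p) => [->|[i ->]|[j ->]].
    + by rewrite fc eqxx.
    + by rewrite foP orbT.
    by rewrite fiQ !orbT.
  rewrite !inE => /or3P[/eqP ->|xP|xQ].
  + by exists center; rewrite ?classical_sets.in_setT.
  + have iP : (index x (enum P) < k)%N by rewrite -cP cardE index_mem mem_enum.
    by exists (outleaf (Ordinal iP)); rewrite ?classical_sets.in_setT // fo nth_index // mem_enum.
  have iQ' : (index x (enum Q) < l)%N by rewrite -cQ cardE index_mem mem_enum.
  by exists (inleaf (Ordinal iQ')); rewrite ?classical_sets.in_setT // fi nth_index // mem_enum.
apply/forallP=> p; apply/forallP=> q; rewrite -/(arc_of _ _); apply/eqP.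
case: (star_ordP p) => [->|[i ->]|[j ->]]; case: (star_ordP q) => [->|[i' ->]|[j' ->]].
- by rewrite fc loop inE /=; lia.
- by rewrite fc ostar_center_out; have [-> _] := oP _ (foP i').
- by rewrite fc ostar_center_in; have [_ /negbTE ->] := iQ _ (fiQ j').
- by rewrite fc ostar_out_center; have [_ /negbTE ->] := oP _ (foP i).
- by rewrite ostar_leaves ?outleaf_center ?inleaf_center // st // inE foP.
- by rewrite ostar_leaves ?outleaf_center ?inleaf_center // st // inE ?foP ?fiQ ?orbT.
- by rewrite fc ostar_in_center; have [-> _] := iQ _ (fiQ j).
- by rewrite ostar_leaves ?outleaf_center ?inleaf_center // st // inE ?foP ?fiQ ?orbT.
by rewrite ostar_leaves ?outleaf_center ?inleaf_center // st // inE ?foP ?fiQ ?orbT.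
Qed.

(** Two different centres of the same set would be adjacent, and an out-leaf of the second, other
    than the first centre, would close a triangle, which [nb_stable] forbids; [k >= 2] provides such
    a leaf. *)
Lemma star_pairs_inj :
  {in star_pairs &, injective (fun t => t.1 |: (t.2.1 :|: t.2.2))}.
Proof.
move=> [v [P Q]] [v' [P' Q']]; rewrite !inE /=.
move=> /and4P[PO /eqP cP QI /eqP cQ] /and4P[PO' /eqP cP' QI' /eqP cQ'] E.
have nbU u (A B : {set 'I_n}) : A \subset Out u -> B \subset In u -> A :|: B \subset nb u.
  by move=> AO BI; rewrite subUset (subset_trans AO (Out_nbr _ _ _)) (subset_trans BI (In_nbr _ _ _)).
have N := nbU _ _ _ PO QI; have N' := nbU _ _ _ PO' QI'.
have e : v = v'.
  apply/eqP/negPn/negP => vv'.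
  have v'N : v' \in nb v.
    have : v' \in v |: (P :|: Q) by rewrite E setU11.
    by rewrite in_setU1 eq_sym (negbTE vv') /=; apply: (subsetP N).
  have sub : P' \subset [set v].
    apply/subsetP=> x xP'; rewrite inE; apply/negPn/negP => xv.
    have xN' : x \in nb v' by apply: (subsetP N'); rewrite inE xP'.
    have : x \in v |: (P :|: Q) by rewrite E !inE xP' orbT.
    rewrite in_setU1 (negbTE xv) /= => /(subsetP N) xN.
    by have /stableP/(_ v' x v'N xN) := nb_stable v; rewrite xN'.
  by have := subset_leq_card sub; rewrite cards1 cP' leqNgt k2.
subst v'.
have EU : P :|: Q = P' :|: Q'.
  have: (v |: (P :|: Q)) :\ v = (v |: (P' :|: Q')) :\ v by rewrite E.
  by rewrite !setU1K // ?(contra _ (loopless_nb v)) //; apply: subsetP.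
have dj := disj_Out_In arc_of setT v.
have getP (A B : {set 'I_n}) : A \subset Out v -> B \subset In v -> (A :|: B) :&: Out v = A.
  move=> AO BI; rewrite setIUl (setIidPl AO) (_ : B :&: Out v = set0) ?setU0 //.
  by apply/eqP; rewrite setI_eq0 disjoint_sym; apply: disjointWr BI dj.
have getQ (A B : {set 'I_n}) : A \subset Out v -> B \subset In v -> (A :|: B) :&: In v = B.
  move=> AO BI; rewrite setIUl (setIidPl BI) (_ : A :&: In v = set0) ?set0U //.
  by apply/eqP; rewrite setI_eq0; apply: disjointWl AO dj.
by rewrite -(getP _ _ PO QI) EU getP // -(getQ _ _ PO QI) EU getQ.
Qed.

Lemma ind_count_ge :
  (\sum_v 'C(#|Out v|, k) * 'C(#|In v|, l) <= ind_count (ostar k l) G)%N.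
Proof.
have -> : (\sum_v 'C(#|Out v|, k) * 'C(#|In v|, l) = #|star_pairs|)%N.
  rewrite -sum1_card (eq_bigl (fun t : 'I_n * ({set 'I_n} * {set 'I_n}) => [&& t.2.1 \subset Out t.1, #|t.2.1| == k,
     t.2.2 \subset In t.1 & #|t.2.2| == l])); last by move=> t; rewrite [in LHS]inE.
  rewrite -(pair_big_dep predT (fun v (PQ : {set 'I_n} * {set 'I_n}) => [&& PQ.1 \subset Out v, #|PQ.1| == k,
     PQ.2 \subset In v & #|PQ.2| == l]) (fun _ _ => 1%N)) /=.
  apply: eq_bigr => v _; rewrite sum1_card -!cards_draws -cardsX.
  by apply: eq_card => -[P Q]; rewrite !inE /= -!andbA.
rewrite -(card_in_imset star_pairs_inj); apply: subset_leq_card.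
by apply/subsetP=> _ /imsetP[t tD ->]; rewrite inE star_pairs_copy.
Qed.

End Link.

(** * The lower bound construction *)

Lemma sum_mod_window (N m r : nat) (f : nat -> nat) : (0 < N)%N ->
  (\sum_(m <= i < m + N * r) f (i %% N) = r * \sum_(0 <= i < N) f i)%N.
Proof.
move=> N0.
have one m' : (\sum_(m' <= i < m' + N) f (i %% N) = \sum_(0 <= i < N) f i)%N.
  elim: m' => [|m' IH].
    rewrite add0n; apply: eq_big_nat => i /andP[_ iN]; by rewrite modn_small.
  rewrite -IH addSn big_nat_recr /=; last by lia.
  by rewrite [RHS]big_ltn; [rewrite modnDr addnC|lia].
elim: r m => [|r IH] m; first by rewrite muln0 addn0 big_geq.
rewrite (big_cat_nat (n := m + N)) ?leq_addr //=; last by rewrite leq_add2l mulnS leq_addr.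
by rewrite one mulnS addnA IH mulSn.
Qed.

(** The orientation will depend on [(x + y) %% N] only; seen from either side, a block of [N * r]
    consecutive vertices then has exactly [t * r] residues below [t]. *)
Lemma count_mod_window (N t m r x : nat) (p : bool) : (0 < N)%N -> (t <= N)%N ->
  (\sum_(m <= i < m + N * r) (p == ((x + i) %% N < t)%N) = (if p then t else N - t) * r)%N.
Proof.
move=> N0 tN; have := sum_mod_window (x + m) r (fun i => p == (i < t)%N : nat) N0.
have -> : (\sum_(0 <= i < N) (p == (i < t)) = if p then t else N - t)%N.
  rewrite (big_cat_nat (n := t)) //=.
  have -> : (\sum_(0 <= i < t) (p == (i < t)) = t * p)%N.
    rewrite (eq_big_nat _ _ (F2 := fun=> p : nat)) ?sum_nat_const_nat ?subn0 //.
    by move=> i /andP[_ ->]; case: p.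
  have -> : (\sum_(t <= i < N) (p == (i < t)) = (N - t) * ~~ p)%N.
    rewrite (eq_big_nat _ _ (F2 := fun=> ~~ p : nat)) ?sum_nat_const_nat //.
    by move=> i /andP[ti _]; rewrite ltnNge ti; case: p.
  by case: p; rewrite !(muln0, muln1, addn0).
rewrite [RHS]mulnC => <-; rewrite [x + m]addnC -addnAC big_addn addnK.
by apply: eq_bigr => i _; rewrite addnC.
Qed.

Section Construction.
Variables (k l n N t a b : nat).
Hypotheses (k2 : (1 < k)%N) (N0 : (0 < N)%N) (tN : (t <= N)%N) (abn : (N * a + N * b <= n)%N).

(* A balanced orientation of the complete bipartite graph between [0, Na) and
   [Na, Na + Nb), together with all arcs from [0, Na) to the remaining vertices *)
Definition bip_arc (x y : nat) : bool :=
  if (x < N * a)%N then (N * a <= y)%N && ((y < N * a + N * b)%N ==> (t <= (x + y) %% N)%N)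
  else [&& (x < N * a + N * b)%N, (y < N * a)%N & ((x + y) %% N < t)%N].

Definition bip_graph : {set 'I_n * 'I_n} := [set p : 'I_n * 'I_n | bip_arc p.1 p.2].

Lemma bip_arc_sides x y : bip_arc x y -> (x < N * a)%N != (y < N * a)%N.
Proof. by rewrite /bip_arc; case: ifP => xa; case: (ltnP y (N * a)); rewrite ?andbF. Qed.

Lemma bip_arc_anti x y : bip_arc x y -> ~~ bip_arc y x.
Proof.
rewrite /bip_arc [y + x]addnC; case: (ltnP x (N * a)) => xa; case: (ltnP y (N * a)) => ya //=.
  by case: ltnP => //= yb; rewrite -leqNgt.
  by move=> /andP[-> ]; rewrite /= -ltnNge.
by rewrite andbF.
Qed.

Lemma bip_loopless : loopless bip_graph.
Proof.
by apply/forallP=> x; rewrite inE; apply/negP => /bip_arc_sides; rewrite eqxx.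
Qed.

Notation arc := (arc_of bip_graph).

Lemma bip_nbr x y : x \in nbr arc y -> (x < N * a)%N != (y < N * a)%N.
Proof.
rewrite inE /arc_of !inE /= => /orP[|] /bip_arc_sides //.
by rewrite eq_sym.
Qed.

Lemma bip_stable v : stable (nbr arc) (nbr arc v).
Proof.
apply/stableP=> x y /bip_nbr xv /bip_nbr yv; apply/negP => /bip_nbr.
by move: xv yv; do 3 case: (_ < _)%N.
Qed.

Lemma bip_Out v : #|Out arc setT v| = (\sum_(0 <= i < n) bip_arc v i)%N.
Proof.
rewrite big_mkord -sum1_card big_mkcond /=; apply: eq_bigr => i _.
rewrite !inE /outarc /arc_of !inE /=; case E : (bip_arc v i) => //=.
by rewrite bip_arc_anti.
Qed.

Lemma bip_In v : #|In arc setT v| = (\sum_(0 <= i < n) bip_arc i v)%N.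
Proof.
rewrite big_mkord -sum1_card big_mkcond /=; apply: eq_bigr => i _.
rewrite !inE /outarc /arc_of !inE /=; case E : (bip_arc i v) => //=.
by rewrite bip_arc_anti.
Qed.

Lemma sum_split3 (F : nat -> nat) : (\sum_(0 <= i < n) F i =
  \sum_(0 <= i < 0 + N * a) F i + (\sum_(N * a <= i < N * a + N * b) F i
    + \sum_(N * a + N * b <= i < n) F i))%N.
Proof.
rewrite add0n (big_cat_nat (n := N * a)) //=; last by lia.
by rewrite [X in _ + X = _](big_cat_nat (n := N * a + N * b)) ?leq_addr.
Qed.

Lemma bip_Out_A (v : 'I_n) : (v < N * a)%N ->
  (n - N * a - N * b + (N - t) * b <= #|Out arc setT v|)%N.
Proof.
move=> va; rewrite bip_Out sum_split3 addnC; apply: leq_trans (leq_addl _ _).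
apply: leq_add.
  rewrite -(@count_mod_window N t (N * a) b v false N0 tN); apply: eq_leq.
  apply: eq_big_nat => i /andP[ai ib].
  by rewrite /bip_arc va ai ib /=; case: leqP.
rewrite -subnDA -[leqLHS]muln1 -sum_nat_const_nat; apply: eq_leq.
apply: eq_big_nat => i /andP[bi _].
by rewrite /bip_arc va ltnNge bi /= (leq_trans (leq_addr _ _) bi).
Qed.

Lemma bip_In_A (v : 'I_n) : (v < N * a)%N -> (t * b <= #|In arc setT v|)%N.
Proof.
move=> va; rewrite bip_In sum_split3; apply: leq_trans (leq_addl _ _).
apply: leq_trans (leq_addr _ _).
rewrite -(@count_mod_window N t (N * a) b v true N0 tN); apply: eq_leq.
apply: eq_big_nat => i /andP[ai ib].
by rewrite /bip_arc va ib (ltnNge i (N * a)) ai /= [i + v]addnC; case: leqP.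
Qed.

Lemma bip_Out_B (v : 'I_n) : (N * a <= v < N * a + N * b)%N ->
  (t * a <= #|Out arc setT v|)%N.
Proof.
move=> /andP[av vb]; rewrite bip_Out sum_split3; apply: leq_trans (leq_addr _ _).
rewrite -(@count_mod_window N t 0 a v true N0 tN); apply: eq_leq.
apply: eq_big_nat => i /andP[_ ia].
by rewrite /bip_arc (ltnNge v (N * a)) av vb ia /=; case: leqP.
Qed.

Lemma bip_In_B (v : 'I_n) : (N * a <= v < N * a + N * b)%N ->
  ((N - t) * a <= #|In arc setT v|)%N.
Proof.
move=> /andP[av vb]; rewrite bip_In sum_split3; apply: leq_trans (leq_addr _ _).
rewrite -(@count_mod_window N t 0 a v false N0 tN); apply: eq_leq.
apply: eq_big_nat => i /andP[_ ia].
by rewrite /bip_arc ia av vb /= [i + v]addnC; case: leqP.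
Qed.

Lemma ind_count_bip :
  (N * a * ('C(n - N * a - N * b + (N - t) * b, k) * 'C(t * b, l)) +
   N * b * ('C(t * a, k) * 'C((N - t) * a, l)) <= ind_count (ostar k l) bip_graph)%N.
Proof.
apply: leq_trans (ind_count_ge l bip_loopless k2 bip_stable).
pose F i := if (i < N * a)%N then ('C(n - N * a - N * b + (N - t) * b, k) * 'C(t * b, l))%N
  else if (i < N * a + N * b)%N then ('C(t * a, k) * 'C((N - t) * a, l))%N else 0%N.
apply: (@leq_trans (\sum_(0 <= i < n) F i)); last first.
  rewrite big_mkord; apply: leq_sum => v _; rewrite /F.
  case: ltnP => va.
    by rewrite leq_mul // leq_bin2l // ?bip_Out_A ?bip_In_A.
  case: ltnP => vb //.
  by rewrite leq_mul // leq_bin2l // ?bip_Out_B ?bip_In_B ?va.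
rewrite sum_split3 addnA; apply: leq_trans (leq_addr _ _); apply: eq_leq; congr (_ + _)%N.
  rewrite add0n (eq_big_nat _ _ (F2 := fun=> F 0%N)) => [|i /andP[_ ia]].
    rewrite sum_nat_const_nat subn0 /F; case: ltnP => //.
    by rewrite leqn0 => /eqP ->; rewrite !mul0n.
  by rewrite /F ia (leq_ltn_trans _ ia).
rewrite (eq_big_nat _ _ (F2 := fun=> ('C(t * a, k) * 'C((N - t) * a, l))%N)).
  by rewrite sum_nat_const_nat addKn.
by move=> i /andP[ai ib]; rewrite /F ib ltnNge ai.
Qed.

End Construction.

From mathcomp Require Import all_classical all_reals all_analysis.
Import Order.TTheory GRing.Theory Num.Theory numFieldNormedType.Exports.
Local Open Scope classical_set_scope.
Local Open Scope ring_scope.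

(** * Limits *)

Section Limits.
Variable R : realType.
Implicit Types (f g : nat -> R) (u : nat -> nat).

Lemma cvg_eq_pos f g (y : R) : (forall n, (0 < n)%N -> f n = g n) ->
  f @ \oo --> y -> g @ \oo --> y.
Proof.
move=> fg; apply: cvg_trans; apply: near_eq_cvg.
by near=> n; apply: fg; near: n; exists 1%N.
Unshelve. all: by end_near. Qed.

Lemma cvg_inv_nat : (n%:R^-1 : R) @[n --> \oo] --> (0 : R).
Proof.
apply: (proj2 (gtr0_cvgV0 _)); last exact: cvgr_idn.
by exists 1%N => // n /= n0; rewrite ltr0n.
Qed.

Lemma cvg_floor_ratio (x : R) : 0 <= x ->
  (Num.trunc (x * n%:R))%:R / n%:R @[n --> \oo] --> x.
Proof.
move=> x0; apply: (@squeeze_cvgr _ _ _ R (fun n => x - n%:R^-1) (fun=> x)).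
- exists 1%N => // n /= n0; have n0' : 0 < n%:R :> R by rewrite ltr0n.
  have /andP[h1 h2] := truncn_itv (mulr_ge0 x0 (ler0n R n)).
  rewrite ler_pdivlMr // ler_pdivrMr // h1 andbT mulrBl mulVf ?lt0r_neq0 //.
  by rewrite lerBlDr natr1 ltW.
- by rewrite -[X in _ --> X]subr0; apply: cvgB; [exact: cvg_cst|exact: cvg_inv_nat].
exact: cvg_cst.
Qed.

Lemma cvg_subn_ratio u (x : R) j : (u n)%:R / n%:R @[n --> \oo] --> x ->
  (u n - j)%:R / n%:R @[n --> \oo] --> x.
Proof.
move=> ux; apply: (@squeeze_cvgr _ _ _ R (fun n => (u n)%:R / n%:R - j%:R * n%:R^-1)
  (fun n => (u n)%:R / n%:R)) => //.
  exists 1%N => // n /= n0; rewrite -mulrBl !ler_wpM2r ?invr_ge0 ?ler_nat ?leq_subr //.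
  by rewrite lerBlDr -natrD ler_nat; lia.
rewrite -[X in _ --> X]subr0; apply: cvgB => //.
rewrite -[X in _ --> X](mulr0 j%:R); apply: cvgM; [exact: cvg_cst|exact: cvg_inv_nat].
Qed.

Lemma cvg_bin_ratio u (x : R) j : (u n)%:R / n%:R @[n --> \oo] --> x ->
  'C(u n, j)%:R / n%:R ^+ j @[n --> \oo] --> x ^+ j / j`!%:R.
Proof.
move=> ux; have f0 : j`!%:R != 0 :> R by rewrite pnatr_eq0 -lt0n fact_gt0.
have: (u n ^_ j)%:R / n%:R ^+ j @[n --> \oo] --> x ^+ j.
  elim: j {f0} => [|j IH].
    by apply: (@cvg_eq_pos (fun=> 1)); [move=> n _; rewrite !expr0 divr1|exact: cvg_cst].
  rewrite [X in _ --> X]exprSr; apply: (cvg_eq_pos _ (cvgM IH (cvg_subn_ratio j ux))).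
  by move=> n _ /=; rewrite ffactnSr natrM exprSr invfM mulrACA.
move=> H; apply: (@cvg_eq_pos (fun n => ((u n ^_ j)%:R / n%:R ^+ j) * j`!%:R^-1)).
  by move=> n _; rewrite -bin_ffact natrM mulrAC mulfK // mulrC.
by apply: cvgM => //; exact: cvg_cst.
Qed.

Lemma cvg_bin_inv j : n%:R ^+ j / 'C(n, j)%:R @[n --> \oo] --> (j`!%:R : R).
Proof.
have H1 : (n%:R / n%:R : R) @[n --> \oo] --> (1 : R).
  apply: (@cvg_eq_pos (fun=> 1)); last exact: cvg_cst.
  by move=> n n0; rewrite divff // pnatr_eq0 -lt0n.
have := @cvg_bin_ratio id _ j H1; rewrite expr1n div1r => H.
have f0 : j`!%:R^-1 != 0 :> R by rewrite invr_eq0 pnatr_eq0 -lt0n fact_gt0.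
rewrite -[X in _ --> X]invrK; apply: (cvg_eq_pos _ (cvgV f0 H)) => n _ /=.
by rewrite invfM invrK mulrC.
Qed.

Section SupLimit.
Variables (S : set R) (C : R) (u U : nat -> R).
Hypotheses (C0 : 0 < C) (supS : has_sup S).
Hypothesis lower : forall x, S x -> exists2 y, x <= y &
  exists2 L, (forall n, L n <= u n) & L @ \oo --> C * y.

Lemma cvg_to_sup : (forall n, u n <= U n) -> U @ \oo --> C * sup S ->
  u @ \oo --> C * sup S.
Proof.
move=> uU /cvgrPdist_lt HU; apply/cvgrPdist_lt => e e0.
have e0' : 0 < e / C / 2 by rewrite !divr_gt0.
have [x Sx xs] := sup_adherent e0' supS.
have [y xy [L Lu /cvgrPdist_lt/(_ (e / 2)) HL]] := lower Sx.
have e2 : 0 < e / 2 by rewrite divr_gt0.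
have cy : C * sup S - e / 2 < C * y.
  have -> : e / 2 = C * (e / C / 2) by field; apply: lt0r_neq0.
  by rewrite -mulrBr ltr_pM2l //; apply: lt_le_trans xy.
near=> n.
have h1 : `|C * sup S - U n| < e by near: n; apply: HU.
have h2 : `|C * y - L n| < e / 2 by near: n; apply: HL.
have := Lu n; have := uU n; move: h1 h2; rewrite !ltr_norml; lra.
Unshelve. all: by end_near. Qed.
End SupLimit.
End Limits.

(** * Limit density of the construction *)

Section Lower.
Variables (R : realType) (k l N t : nat) (al ph : R).
Hypotheses (k2 : (1 < k)%N) (N0 : (0 < N)%N) (tN : (t <= N)%N).
Hypotheses (al0 : 0 <= al) (ph0 : 0 <= ph) (alph : al + ph <= 1).

Let NR : 0 < N%:R :> R. Proof. by rewrite ltr0n. Qed.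
Let Nn : N%:R != 0 :> R. Proof. exact: lt0r_neq0. Qed.
Let a n := Num.trunc (al / N%:R * n%:R).
Let b n := Num.trunc (ph / N%:R * n%:R).
Let o n := (n - N * a n - N * b n + (N - t) * b n)%N.

Let aN0 : 0 <= al / N%:R. Proof. by rewrite divr_ge0. Qed.
Let bN0 : 0 <= ph / N%:R. Proof. by rewrite divr_ge0. Qed.

Let ab_le n : (N * a n + N * b n <= n)%N.
Proof.
have tr (x : R) : 0 <= x -> (N * Num.trunc (x / N%:R * n%:R))%:R <= x * n%:R.
  move=> x0; have /andP[h _] := truncn_itv (mulr_ge0 (divr_ge0 x0 (ltW NR)) (ler0n R n)).
  rewrite natrM; apply: le_trans (ler_wpM2l (ltW NR) h) _.
  by rewrite mulrA mulrCA mulfV // mulr1.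
rewrite -(ler_nat R) natrD; apply: le_trans (lerD (tr _ al0) (tr _ ph0)) _.
by rewrite -mulrDl -[leRHS]mul1r ler_wpM2r.
Qed.

Let cvg_scaled (m : nat) (x : R) (v : nat -> nat) : (v n)%:R / n%:R @[n --> \oo] --> x ->
  (m * v n)%N%:R / n%:R @[n --> \oo] --> m%:R * x.
Proof.
move=> vx; apply: (cvg_eq_pos _ (cvgMr vx)) => n _ /=.
by rewrite natrM mulrA.
Qed.

Let cvg_o : (o n)%:R / n%:R @[n --> \oo] --> 1 - al - t%:R / N%:R * ph.
Proof.
have ca := @cvg_scaled N _ _ (cvg_floor_ratio aN0).
have cb := @cvg_scaled t _ _ (cvg_floor_ratio bN0).
have -> : 1 - al - t%:R / N%:R * ph = 1 - N%:R * (al / N%:R) - t%:R * (ph / N%:R).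
  by field.
apply: (cvg_eq_pos _ (cvgB (cvgB (cvg_cst (1 : R)) ca) cb)) => n n0 /=.
have n0' : n%:R != 0 :> R by rewrite pnatr_eq0 -lt0n.
rewrite -[LHS]/(1 - (N * a n)%:R / n%:R - (t * b n)%:R / n%:R) -[X in X - _ - _](divff n0') -!mulrBl; congr (_ / _).
have -> : o n = (n - N * a n - t * b n)%N.
  rewrite /o; have := ab_le n; have := leq_mul tN (leqnn (b n)).
  by rewrite mulnBl; lia.
have := ab_le n; have := leq_mul tN (leqnn (b n)) => h1 h2.
by rewrite !natrB //; lia.
Qed.

(** [al] and [ph] are the limit weights of the first and of the balanced block. A vertex of the
    first block has in-weight [t / N * ph], and all else outside its block is out-neighbourhood. *)
Lemma bip_lower : exists2 L : nat -> R, (forall n, L n <= ind_max R (ostar k l) n) &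
  L @ \oo --> (k + l + 1)`!%:R / (k`! * l`!)%:R *
   (al * ((1 - al - t%:R / N%:R * ph) ^+ k * (t%:R / N%:R * ph) ^+ l) +
    ph * ((t%:R / N%:R * al) ^+ k * ((1 - t%:R / N%:R) * al) ^+ l)).
Proof.
exists (fun n => (N * a n * ('C(o n, k) * 'C(t * b n, l)) +
    N * b n * ('C(t * a n, k) * 'C((N - t) * a n, l)))%:R / 'C(n, k + l + 1)%:R).
  move=> n; apply: le_trans (le_bigmax_cond 0 (ind_density R (ostar k l))
    (bip_loopless n N t (a n) (b n))).
  by rewrite ler_wpM2r ?invr_ge0 // ler_nat; apply: ind_count_bip.
have ca := cvg_floor_ratio aN0; have cb := cvg_floor_ratio bN0.
have c1 := @cvg_bin_ratio _ _ _ k cvg_o.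
have c2 := @cvg_bin_ratio _ _ _ l (@cvg_scaled t _ _ cb).
have c3 := @cvg_bin_ratio _ _ _ k (@cvg_scaled t _ _ ca).
have c4 := @cvg_bin_ratio _ _ _ l (@cvg_scaled (N - t) _ _ ca).
have c5 := @cvg_scaled N _ _ ca; have c6 := @cvg_scaled N _ _ cb.
have -> : (k + l + 1)`!%:R / (k`! * l`!)%:R *
   (al * ((1 - al - t%:R / N%:R * ph) ^+ k * (t%:R / N%:R * ph) ^+ l) +
    ph * ((t%:R / N%:R * al) ^+ k * ((1 - t%:R / N%:R) * al) ^+ l)) =
   (N%:R * (al / N%:R) * ((1 - al - t%:R / N%:R * ph) ^+ k / k`!%:R *
       ((t%:R * (ph / N%:R)) ^+ l / l`!%:R)) +
    N%:R * (ph / N%:R) * ((t%:R * (al / N%:R)) ^+ k / k`!%:R *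
       (((N - t)%N%:R * (al / N%:R)) ^+ l / l`!%:R))) * (k + l + 1)`!%:R :> R.
  have fk : k`!%:R != 0 :> R by rewrite pnatr_eq0 -lt0n fact_gt0.
  have fl : l`!%:R != 0 :> R by rewrite pnatr_eq0 -lt0n fact_gt0.
  have NM x : N%:R * (x / N%:R) = x :> R by rewrite mulrCA mulfV // mulr1.
  have tM x : t%:R * (x / N%:R) = t%:R / N%:R * x :> R by rewrite mulrCA mulrC.
  have NtM x : (N - t)%N%:R * (x / N%:R) = (1 - t%:R / N%:R) * x :> R.
    by rewrite natrB // mulrBl NM tM mulrBl mul1r.
  rewrite !NM !tM NtM natrM.
  move: ((1 - al - _) ^+ k) ((_ * ph) ^+ l) ((_ * al) ^+ k) ((_ * al) ^+ l).
  by move=> x1 x2 x3 x4; field; rewrite fk fl.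
apply: (cvg_eq_pos _ (cvgM (cvgD (cvgM c5 (cvgM c1 c2)) (cvgM c6 (cvgM c3 c4)))
  (@cvg_bin_inv R (k + l + 1)))) => n n0.
have n0' : n%:R != 0 :> R by rewrite pnatr_eq0 -lt0n.
rewrite -[LHS]/(((N * a n)%:R / n%:R * ('C(o n, k)%:R / n%:R ^+ k * ('C(t * b n, l)%:R / n%:R ^+ l))
  + (N * b n)%:R / n%:R * ('C(t * a n, k)%:R / n%:R ^+ k * ('C((N - t) * a n, l)%:R / n%:R ^+ l)))
  * (n%:R ^+ (k + l + 1) / 'C(n, k + l + 1)%:R)).
rewrite natrD ![(_ * ('C(_, _) * _))%N%:R]natrM.
rewrite ![('C(_, _) * 'C(_, _))%N%:R]natrM !exprD expr1.
have nk : n%:R ^+ k != 0 :> R by rewrite expf_neq0.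
have nl : n%:R ^+ l != 0 :> R by rewrite expf_neq0.
move: ('C(n, _)%:R^-1 : R) (n%:R ^+ k : R) (n%:R ^+ l : R) nk nl => d x y x0 y0.
by field; rewrite n0' x0 y0.
Qed.
End Lower.

(** * Passage from tuples to the limit *)

Section Upper.
Variables (R : realType) (k l : nat) (M : R).
Hypotheses (l1 : (0 < l)%N) (lk : (l <= k)%N) (s6 : (6 <= k + l)%N).
Hypothesis M_eq : k = l -> forall x : R, 0 <= x -> x <= 1 ->
  star_max R k l * (x * (1 - x) ^+ (k + l) + (1 - x) * x ^+ (k + l)) <= M.
Hypothesis M_gt : (l < k)%N -> forall x y z : R, 0 <= x -> 0 <= y -> 0 <= z ->
  x + y + z = 1 -> x <= 1 / 2 ->
  x * (y ^+ k * z ^+ l + inner_max R k l * x ^+ (k + l).-1 * z) <= M.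

Let K : R := (1000 * (k + l))%:R ^+ (k + l).+1.

Lemma ind_density_le n (G : {set 'I_n * 'I_n}) : loopless G ->
  ind_density R (ostar k l) G <=
    (k`! * l`!)%:R^-1 * (M * n%:R ^+ (k + l).+1 + K) / 'C(n, k + l + 1)%:R.
Proof.
move=> GL; rewrite ler_wpM2r ?invr_ge0 //.
have F0 : 0 < (k`! * l`!)%:R :> R by rewrite ltr0n muln_gt0 !fact_gt0.
rewrite -(ler_pM2l F0) mulVKf ?lt0r_neq0 // -natrM.
have H := tot_bound l1 lk s6 M_eq M_gt (arc_of G) finset.setT.
rewrite cardsT card_ord in H; apply: le_trans H.
apply: le_trans (_ : (k`! * l`! * \sum_v #|indep_pairs (nbr (arc_of G)) k l
  (Out (arc_of G) finset.setT v) (In (arc_of G) finset.setT v)|)%:R <= _).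
  by rewrite ler_nat leq_mul2l ind_count_le ?orbT.
rewrite big_distrr natr_sum /= /tot.
rewrite [leRHS](eq_bigl predT); last by move=> v; rewrite finset.in_setT.
by apply: ler_sum => v _; rewrite mul1r; apply: indep_pairs_le; apply: nbrC.
Qed.

Definition upper_seq n : R :=
  (k`! * l`!)%:R^-1 * (M * n%:R ^+ (k + l).+1 + K) / 'C(n, k + l + 1)%:R.

Lemma ind_max_le n : ind_max R (ostar k l) n <= upper_seq n.
Proof.
apply: bigmax_le => [|G GL]; last exact: ind_density_le.
apply: le_trans (ind_density_le (G := finset.set0) _); first by rewrite divr_ge0.
by apply/forallP=> x; rewrite inE.
Qed.

Lemma cvg_upper_seq : upper_seq @ \oo --> (k + l + 1)`!%:R / (k`! * l`!)%:R * M.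
Proof.
have c1 := @cvg_bin_inv R (k + l + 1).
have c2 := @cvg_inv_nat R.
have c3 j : (n%:R^-1 : R) ^+ j.+1 @[n --> \oo] --> (0 : R).
  elim: j => [|j IH]; first exact: c2.
  rewrite -[X in _ --> X](mul0r (0 : R)); apply: (cvg_eq_pos _ (cvgM c2 IH)) => n _.
  by rewrite [RHS]exprS.
have -> : (k + l + 1)`!%:R / (k`! * l`!)%:R * M =
   (k`! * l`!)%:R^-1 * ((M + K * 0) * (k + l + 1)`!%:R) by ring.
apply: (cvg_eq_pos _ (cvgMr (cvgM (cvgD (cvg_cst M) (cvgMr (c3 (k + l)%N))) c1))) => n n0.
have n0' : n%:R ^+ (k + l + 1) != 0 :> R by rewrite expf_neq0 // pnatr_eq0 -lt0n.
rewrite -[LHS]/((k`! * l`!)%:R^-1 * ((M + K * n%:R^-1 ^+ (k + l).+1) *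
   (n%:R ^+ (k + l + 1) / 'C(n, k + l + 1)%:R))) /upper_seq exprVn -(addn1 (k + l)).
move: ('C(n, _)%:R^-1 : R) (n%:R ^+ _ : R) n0' => d x x0.
move: ((k`! * l`!)%:R^-1 : R) => f.
by field.
Qed.
End Upper.

(** * The case k = l *)

Section Equal.
Variables (R : realType) (k : nat).
Hypotheses (k3 : (6 <= k + k)%N).

Definition eq_values : set R := [set x : R | exists a : R, [/\ 0 <= a, a <= 1 &
   x = a * (1 - a) ^+ (2 * k) + (1 - a) * a ^+ (2 * k)]].

Lemma eq_values_sup : has_sup eq_values.
Proof.
split; first by exists (0 * (1 - 0) ^+ (2 * k) + (1 - 0) * 0 ^+ (2 * k)), 0.
exists (1 + 1) => _ [a [a0 a1 ->]]; have a1' : 0 <= 1 - a by rewrite subr_ge0.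
have a2 : 1 - a <= 1 by lra.
by apply: lerD; apply: mulr_ile1; rewrite ?exprn_ge0 ?exprn_ile1.
Qed.

Let k0 : (0 < k)%N. Proof. by lia. Qed.

Lemma star_max_diag : star_max R k k = (2 ^ (2 * k))%:R^-1.
Proof.
have kn : k%:R ^+ (2 * k) != 0 :> R by rewrite expf_neq0 // pnatr_eq0 -lt0n.
by rewrite /star_max -exprD natrX addnn -mul2n natrM exprMn invfM mulrCA divff ?mulr1.
Qed.

Lemma main_eq : ind_max R (ostar k k) @ \oo -->
   (((2 * k + 1)`!)%N%:R / (2 ^ (2 * k) * (k`!) ^ 2)%N%:R) * sup eq_values.
Proof.
have F0 : k`!%:R != 0 :> R by rewrite pnatr_eq0 -lt0n fact_gt0.
have kk : (k + k = 2 * k)%N by rewrite addnn -mul2n.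
have ubS := ub_le_sup (proj2 eq_values_sup).
have Meq : k = k -> forall x : R, 0 <= x -> x <= 1 ->
    star_max R k k * (x * (1 - x) ^+ (k + k) + (1 - x) * x ^+ (k + k)) <=
    (2 ^ (2 * k))%:R^-1 * sup eq_values.
  move=> _ x x0 x1; rewrite star_max_diag ler_wpM2l ?invr_ge0 //; apply: ubS.
  by exists x; rewrite kk.
have Mgt : (k < k)%N -> forall x y z : R, 0 <= x -> 0 <= y -> 0 <= z ->
  x + y + z = 1 -> x <= 1 / 2 ->
  x * (y ^+ k * z ^+ k + inner_max R k k * x ^+ (k + k).-1 * z) <= (2 ^ (2 * k))%:R^-1 * sup eq_values.
  by rewrite ltnn.
have E x : ((2 * k + 1)`!)%N%:R / (2 ^ (2 * k) * (k`!) ^ 2)%N%:R * x =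
    (k + k + 1)`!%:R / (k`! * k`!)%:R * ((2 ^ (2 * k))%:R^-1 * x) :> R.
  rewrite kk !natrM.
  have t0 : (2 ^ (2 * k))%:R != 0 :> R by rewrite pnatr_eq0 -lt0n expn_gt0.
  by move: ((2 ^ _)%:R : R) (_`!%:R : R) t0 => y z y0; field; rewrite y0 F0.
apply: (cvg_to_sup (U := upper_seq k k ((2 ^ (2 * k))%:R^-1 * sup eq_values))).
- by rewrite divr_gt0 // ltr0n ?muln_gt0 ?expn_gt0 ?fact_gt0.
- exact: eq_values_sup.
- move=> _ [a [a0 a1 ->]]; exists (a * (1 - a) ^+ (2 * k) + (1 - a) * a ^+ (2 * k)) => //.
  have k2 : (1 < k)%N by lia.
  (* With [ph = 1 - a] the third block has limit weight 0; [N = 2] and [t = 1] balance in- and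
     out-degrees on both sides. *)
  have [L L1 L2] := @bip_lower R k k 2 1 a (1 - a) k2 isT isT a0 ltac:(lra) ltac:(lra).
  exists L => //; rewrite E.
  suff <- : (a * ((1 - a - 1 / 2 * (1 - a)) ^+ k * (1 / 2 * (1 - a)) ^+ k) +
    (1 - a) * ((1 / 2 * a) ^+ k * ((1 - 1 / 2) * a) ^+ k)) =
    (2 ^ (2 * k))%:R^-1 * (a * (1 - a) ^+ (2 * k) + (1 - a) * a ^+ (2 * k)) by [].
  have -> : 1 - a - 1 / 2 * (1 - a) = 2^-1 * (1 - a) by field.
  rewrite (_ : 1 - 1 / 2 = 2^-1 :> R); last by field.
  by rewrite div1r -!exprD kk natrX !exprMn exprVn; ring.
- by move=> n; apply: ind_max_le.
by rewrite E; apply: cvg_upper_seq.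
Qed.
End Equal.

(** * The case k > l *)

Section Greater.
Variables (R : realType) (k l : nat).
Hypotheses (l1 : (0 < l)%N) (lk : (l < k)%N) (s6 : (6 <= k + l)%N).

Notation s := (k + l)%N.
Notation c := (inner_max R k l).
Notation h := (star_max R k l).

Let s0 : (0 < s)%N. Proof. by lia. Qed.
Let s1 : (1 < s)%N. Proof. by lia. Qed.
Let N0 : (0 < s.-1)%N. Proof. by lia. Qed.
Let tN : (k.-1 <= s.-1)%N. Proof. by lia. Qed.
Let sk : (s <= 2 * k)%N. Proof. by lia. Qed.
Let predE : s.-1 = (k.-1 + l)%N. Proof. by lia. Qed.
Let ld : (l * 2 <= s.-1)%N. Proof. by lia. Qed.
Let lk1 : (l <= k.-1)%N. Proof. by lia. Qed.
Let k0 : (0 < k)%N. Proof. exact: ltn_trans lk. Qed.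
Let k2 : (1 < k)%N. Proof. exact: leq_ltn_trans lk. Qed.
Let sR : 0 < s%:R :> R. Proof. by rewrite ltr0n addn_gt0 k0. Qed.
Let NR : 0 < s.-1%:R :> R. Proof. by rewrite ltr0n. Qed.

Let xi : R := k.-1%:R / s.-1%:R.
Let d1 : R := l%:R / s.-1%:R.
Let km : R := k%:R / s%:R.

Definition star_val (a d : R) : R :=
  a * (1 - a) ^+ s * d ^+ k * (1 - d) ^+ l + c * (1 - a) * a ^+ s * (1 - d).

Let xi_d1 : 1 - xi = d1.
Proof.
have e : s.-1%:R = k.-1%:R + l%:R :> R by rewrite -natrD predE.
rewrite /xi /d1 -[X in X - _](@divff _ s.-1%:R) ?lt0r_neq0 // -mulrBl; congr (_ / _).
by rewrite e; ring.
Qed.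

Let km_sub : 1 - km = l%:R / s%:R.
Proof.
rewrite /km -[X in X - _](@divff _ s%:R) ?lt0r_neq0 // -mulrBl; congr (_ / _).
by rewrite natrD; ring.
Qed.

Let xi_gt0 : 0 < xi. Proof. by rewrite divr_gt0 // ltr0n -subn1 subn_gt0. Qed.
Let d1_gt0 : 0 < d1. Proof. by rewrite divr_gt0 // ltr0n. Qed.
Let d1_le : d1 <= 1 / 2.
Proof.
rewrite ler_pdivrMr // mulrAC mul1r ler_pdivlMr //.
by rewrite mulr_natr -mulrnA ler_nat.
Qed.
Let km_ge0 : 0 <= km. Proof. by rewrite divr_ge0. Qed.
Let km_le1 : km <= 1. Proof. by rewrite ler_pdivrMr // mul1r ler_nat leq_addr. Qed.
Let d1_km : d1 <= km.
Proof.
rewrite ler_pdivrMr // mulrAC ler_pdivlMr // -!natrM ler_nat.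
by case: k lk l1 => // m ml l0; rewrite addSn /=; nia.
Qed.

Let inner_maxE : c = xi ^+ k.-1 * d1 ^+ l.
Proof.
rewrite /xi /d1 !expr_div_n mulrACA -invfM -exprD /inner_max; congr (_ / _ ^+ _).
by case: k k0.
Qed.

Let star_maxE : h = km ^+ k * (1 - km) ^+ l.
Proof. by rewrite km_sub /km !expr_div_n mulrACA -invfM -exprD. Qed.

(** The balanced block must send the weight [(1 - a) * (1 - d)] into each vertex of the first one,
    so its weight is that divided by [xi]; this fits into [1 - a] because [d >= 1 - xi = d1]. *)
Lemma star_val_lower a d : 0 <= a -> a <= 1 -> d1 <= d -> d <= 1 ->
  exists2 L : nat -> R, (forall n, L n <= ind_max R (ostar k l) n) &
    L @ \oo --> (k + l + 1)`!%:R / (k`! * l`!)%:R * star_val a d.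
Proof.
move=> a0 a1 dl dh; pose ph := (1 - a) * (1 - d) / xi.
have ph0 : 0 <= ph by rewrite divr_ge0 ?mulr_ge0 ?subr_ge0 // ltW.
have phx : xi * ph = (1 - a) * (1 - d) by rewrite /ph mulrC divfK // lt0r_neq0.
have aph : a + ph <= 1.
  suff : ph <= 1 - a by lra.
  rewrite ler_pdivrMr // ler_wpM2l ?subr_ge0 //; move: xi_d1; lra.
have [L L1 L2] := @bip_lower R k l s.-1 k.-1 a ph k2 N0 tN a0 ph0 aph.
exists L => //; suff <- : a * ((1 - a - xi * ph) ^+ k * (xi * ph) ^+ l) +
    ph * ((xi * a) ^+ k * ((1 - xi) * a) ^+ l) = star_val a d by [].
have e : xi ^+ k = xi * xi ^+ k.-1 by rewrite -exprS prednK.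
rewrite xi_d1 /star_val inner_maxE (exprMn _ xi a) (exprMn _ d1 a) e.
have -> : ph * (xi * xi ^+ k.-1 * a ^+ k * (d1 ^+ l * a ^+ l)) =
   (xi * ph) * (xi ^+ k.-1 * d1 ^+ l) * (a ^+ k * a ^+ l) by ring.
rewrite phx -exprD.
have -> : 1 - a - (1 - a) * (1 - d) = (1 - a) * d by ring.
by rewrite (exprMn _ (1 - a) d) (exprMn _ (1 - a) (1 - d)) !exprD; ring.
Qed.

(* Below [d1] the construction is not available; there [star_val] is bounded by a
   mean of its value at [d1] and of a term controlled by [inner_max_small]. *)
Lemma star_val_le_d1 a d : 0 <= a -> a <= 1 -> 0 <= d -> d <= d1 ->
  star_val a d <= d / d1 * star_val a d1 + (1 - d / d1) * (c * (1 - a) * a ^+ s).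
Proof.
move=> a0 a1 d0 dd; have [dp dn] : 0 < d1 /\ d1 != 0 by rewrite lt0r_neq0.
have H : d ^+ k * (1 - d) ^+ l <= d / d1 * (d1 ^+ k * (1 - d1) ^+ l).
  (* As [l <= k - 1], one factor [x] splits off, and the rest increases on [[0, 1 / 2]], which
     contains [d1]. *)
  have e (x : R) : x ^+ k * (1 - x) ^+ l = x * (x ^+ (k.-1 - l) * (x * (1 - x)) ^+ l).
    by rewrite exprMn !mulrA -exprS -exprD; rewrite addSn subnK // prednK.
  rewrite !e [leRHS]mulrA (divfK dn) ler_wpM2l // ler_pM ?exprn_ge0 ?mulr_ge0 ?subr_ge0 //.
  - by move: d1_le; lra.
  - by apply: lerXn2r; rewrite ?nnegrE // ltW.
  apply: lerXn2r; rewrite ?nnegrE ?mulr_ge0 ?subr_ge0 // ?(ltW dp) //.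
  - by move: d1_le; lra.
  - by move: d1_le; lra.
  by move: d1_le; nra.
have A0 : 0 <= a * (1 - a) ^+ s by rewrite mulr_ge0 ?exprn_ge0 ?subr_ge0.
have := ler_wpM2l A0 H; rewrite /star_val; move: c => e; rewrite -!mulrA => {}H.
apply: le_trans (lerD H (lexx _)) _.
rewrite le_eqVlt; apply/orP; left; apply/eqP.
by move: (d1 ^+ k) ((1 - d1) ^+ l) ((1 - a) ^+ s) (a ^+ s) => x y z t; field.
Qed.

Lemma star_val_km a : 0 <= a -> a <= 1 -> a * (1 - a) ^+ s * h <= star_val a km.
Proof.
move=> a0 a1; rewrite star_maxE /star_val; have := inner_max_ge0 R k l; move: c => e e0.
by rewrite -!mulrA lerDl !mulr_ge0 ?exprn_ge0 ?subr_ge0.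
Qed.

(** For [a <= 1 / 2] the left side bounds [c * (1 - a) * a^s], so that term never beats a value at
    which the construction exists. Numerically, [c <= 11 / 2 * h] and
    [11 / 2 * (7 / 128) < 4 / 11]. *)
Lemma inner_max_small : c * 2^-1 ^+ s.+1 <= star_val s.+1%:R^-1 km.
Proof.
have S1 : s.+1%:R^-1 <= 1 :> R by rewrite invf_le1 // ler1n.
apply: le_trans (star_val_km _ S1); last by rewrite invr_ge0 ltW.
have bE : (1 - s.+1%:R^-1) ^+ s = mean_max R s.
  rewrite /mean_max; congr (_ ^+ _).
  have Sn : s.+1%:R != 0 :> R by exact: lt0r_neq0.
  by apply: (mulIf Sn); rewrite mulrBl mul1r mulVf // divfK // -natr1 addrK.
rewrite bE -mulrA ler_pdivlMl //.
have h0 : 0 < h by apply: star_max_gt0.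
have b4 := @mean_max_ge R s s0.
have ch : c <= 11 / 2 * h.
  have kc : k%:R * c <= leaf_bound R k l.
    rewrite /inner_max /leaf_bound mulrA ler_wpM2r ?invr_ge0 ?exprn_ge0 // mulrA.
    by rewrite ler_wpM2r ?exprn_ge0 // predn_exp_le.
  have := le_trans kc (leaf_bound_hh R s1).
  have sk2 : s%:R <= 2 * k%:R :> R by rewrite -natrM ler_nat.
  have kR : 0 < k%:R :> R by rewrite ltr0n.
  move=> H; rewrite -(ler_pM2l kR); apply: (le_trans H).
  have := ler_wpM2r (ltW h0) sk2; lra.
have p : s.+1%:R * 2^-1 ^+ s.+1 <= 7 / 128 :> R.
  rewrite -(subnK s6); elim: (s - 6)%N => [|m IH]; first by rewrite add0n !exprS expr0; lra.
  rewrite addSn exprS.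
  have m0 : 0 <= 2^-1 ^+ (m + 6).+1 :> R by rewrite exprn_ge0.
  have : (m + 6).+2%:R <= 2 * (m + 6).+1%:R :> R.
    by rewrite -natrM ler_nat mul2n -addnn addSnnS leq_addl.
  move=> /(ler_wpM2r m0); lra.
have p0 : 0 <= s.+1%:R * 2^-1 ^+ s.+1 :> R by rewrite mulr_ge0 ?exprn_ge0.
have := ler_pM (inner_max_ge0 R k l) p0 ch p; have := ler_wpM2r (ltW h0) b4; lra.
Qed.

Definition gt_values : set R := [set x : R | exists a d : R,
   [/\ 0 <= a, a <= 2^-1, 0 <= d, d <= km & x = star_val a d]].

Lemma gt_values_sup : has_sup gt_values.
Proof.
split.
  by exists (star_val 0 0), 0, 0; split; rewrite ?invr_ge0.
exists (1 + c) => _ [a [d [a0 a1 d0 dk ->]]].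
have [a2 a3 d2 d3] : [/\ 0 <= 1 - a, 1 - a <= 1, 0 <= 1 - d & 1 - d <= 1].
  by move: km_le1; split; lra.
have := inner_max_ge0 R k l; rewrite /star_val; move: c => e c0; rewrite -!mulrA; apply: lerD.
  by rewrite !mulr_ile1 ?mulr_ge0 ?exprn_ge0 ?exprn_ile1 //; move: km_le1; lra.
by rewrite -[leRHS]mulr1 ler_wpM2l // !mulr_ile1 ?mulr_ge0 ?exprn_ge0 ?exprn_ile1 //; lra.
Qed.

(** Reason for the range of [d] in the theorem: beyond [km] both terms of [star_val] are at most
    their values at [km], the maximizer of [d^k * (1 - d)^l]. *)
Lemma gt_values_bound x y z : 0 <= x -> 0 <= y -> 0 <= z ->
  x + y + z = 1 -> x <= 1 / 2 ->
  x * (y ^+ k * z ^+ l + c * x ^+ s.-1 * z) <= sup gt_values.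
Proof.
move=> x0 y0 z0 xyz x1; have b0 : 0 < 1 - x by lra.
pose d := y / (1 - x).
have yd : y = (1 - x) * d by rewrite /d mulrC divfK // lt0r_neq0.
have zd : z = (1 - x) * (1 - d) by move: yd; lra.
have d0 : 0 <= d by rewrite divr_ge0 // ltW.
have dh : 0 <= 1 - d by rewrite -(pmulr_rge0 _ b0) -zd.
have -> : x * (y ^+ k * z ^+ l + c * x ^+ s.-1 * z) = star_val x d.
  rewrite yd zd /star_val !exprMn (exprD (1 - x)) -[in X in _ = _ + X](prednK s0).
  by rewrite exprS; ring.
have ubS := ub_le_sup (proj2 gt_values_sup).
have x2 : x <= 2^-1 by lra.
have [dk|kd] := leP d km; first by apply: ubS; exists x, d.
apply: le_trans (ubS _ _); last by exists x, km; split => //.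
have c0 := inner_max_ge0 R k l.
rewrite /star_val; apply: lerD; last first.
  rewrite ler_wpM2l ?mulr_ge0 ?exprn_ge0 //; first by rewrite ltW.
  by move: kd; lra.
rewrite -!mulrA -star_maxE !ler_wpM2l ?exprn_ge0 // ?(ltW b0) //.
have d_1 : d + (1 - d) = 1 by ring.
by have := @star_max_le R k l d (1 - d) d0 dh; rewrite d_1 expr1n mulr1.
Qed.

Lemma main_gt : ind_max R (ostar k l) @ \oo -->
   (k + l + 1)`!%:R / (k`! * l`!)%:R * sup gt_values.
Proof.
apply: (cvg_to_sup (U := upper_seq k l (sup gt_values))).
- by rewrite divr_gt0 // ltr0n ?muln_gt0 ?fact_gt0.
- exact: gt_values_sup.
- move=> _ [a [d [a0 a1 d0 dk ->]]]; have a2 : a <= 1 by lra.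
  have [dd|dd] := leP d1 d.
    exists (star_val a d) => //; apply: star_val_lower => //.
    exact: le_trans km_le1.
  have S1 : s.+1%:R^-1 <= 1 :> R by rewrite invf_le1 // ler1n.
  have S0 : 0 <= s.+1%:R^-1 :> R by rewrite invr_ge0.
  (* By [star_val_le_d1] the value is at most a mean of two quantities, each dominated by one of
     these two attainable values. *)
  pose m := Num.max (star_val a d1) (star_val s.+1%:R^-1 km).
  exists m; last first.
    rewrite /m; case: leP => _; apply: star_val_lower => //.
    by move: d1_le; lra.
  have r1 : d / d1 <= 1 by rewrite ler_pdivrMr // mul1r ltW.
  have r0 : 0 <= d / d1 by rewrite divr_ge0 // ltW.
  have H1 : star_val a d1 <= m by rewrite le_max lexx.
  have H2 : c * (1 - a) * a ^+ s <= m.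
    rewrite le_max; apply/orP; right; apply: le_trans inner_max_small.
    rewrite -mulrA ler_wpM2l ?inner_max_ge0 //.
    have -> : s.+1 = (s.-1 + 2)%N by rewrite addn2 prednK.
    rewrite -[in leLHS](prednK s0).
    rewrite exprS mulrA [leLHS]mulrC exprD; apply: ler_pM; rewrite ?exprn_ge0 //.
    - by rewrite mulr_ge0 // subr_ge0.
    - by apply: lerXn2r; rewrite ?nnegrE // invr_ge0.
    by rewrite -subr_ge0; have := sqr_ge0 (a - 2^-1); rewrite !expr2; lra.
  apply: (le_trans (star_val_le_d1 a0 a2 d0 (ltW dd))).
  have r2 : 0 <= 1 - d / d1 by rewrite subr_ge0.
  have := ler_wpM2l r0 H1; have := ler_wpM2l r2 H2; lra.
- move=> n; apply: ind_max_le => //; first exact: ltnW.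
    by move=> e; move: lk; rewrite e ltnn.
  by move=> _; apply: gt_values_bound.
apply: cvg_upper_seq.
Qed.

End Greater.

Theorem theorem1p1 (R : realType) (k l : nat) :
  (1 <= l)%N -> (l <= k)%N -> (6 <= k + l)%N ->
  (k = l ->
    ind_max R (ostar k l) @ \oo -->
      ((((2 * k + 1)`!)%N%:R / (2 ^ (2 * k) * (k`!) ^ 2)%N%:R) *
      sup [set x : R | exists a : R, [/\ 0 <= a, a <= 1 &
             x = a * (1 - a) ^+ (2 * k) + (1 - a) * a ^+ (2 * k)]] : R)) /\
  ((l + 1 <= k)%N ->
    ind_max R (ostar k l) @ \oo -->
      ((((k + l + 1)`!)%N%:R / (k`! * l`!)%N%:R) *
      sup [set x : R | exists a d : R,
             [/\ 0 <= a, a <= 2^-1, 0 <= d, d <= k%:R / (k + l)%N%:R &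
             x = a * (1 - a) ^+ (k + l) * d ^+ k * (1 - d) ^+ l
                 + (((k - 1) ^ (k - 1) * l ^ l)%N%:R / ((k + l - 1) ^ (k + l - 1))%N%:R)
                   * (1 - a) * a ^+ (k + l) * (1 - d)]] : R)).
Proof.
move=> l1 lk s6; split=> [kl|]; first by rewrite -kl; apply: main_eq; rewrite {2}kl.
rewrite addn1 => lk'.
have := @main_gt R k l l1 lk' s6; rewrite /gt_values /star_val /inner_max -!natrX -natrM.
by rewrite !subn1.
Qed.
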